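(* Let $(A,\mathfrak m)$ be a non-regular Gorenstein local ring of dimension $d\ge 1$ with residue field $k=A/\mathfrak m$. Let $N$ be a perfect $A$-module of dimension $t\ge 1$ and let $I$ be an ideal of definition of $N$. Let $n$ be an integer (possibly negative). Then (i) $r_1^{I,N}(\Omega^d k)=r_1^{I,N}(\Omega^n\Omega^d k)$; (ii) $s^1_{I,N}(\Omega^n\Omega^d k)=s^1_{I,N}(\Omega^d k)$.
   Context: All rings are commutative Noetherian and all modules are finitely generated. $\lambda(-)$ denotes length. Over a Cohen-Macaulay local ring, a non-zero module $N$ is perfect if and only if it is Cohen-Macaulay of finite projective dimension. An ideal of definition of $N$ is an ideal $I\subseteq\mathfrak m$ with $\lambda(N/IN)<\infty$. For $i\ge0$, $\Omega^i X$ is the $i$-th syzygy of $X$ (in a minimal free resolution); $\Omega^dk$ is maximal Cohen-Macaulay. For a maximal Cohen-Macaulay $A$-module $X$, put $X^*=\operatorname{Hom}_A(X,A)$; the cosyzygy of $X$ is $\Omega^{-1}X=(\Omega(X^* ))^*$, and recursively $\Omega^{-i}X=\Omega^{-1}(\Omega^{-(i-1)}X)$ for $i\ge 1$. For a maximal Cohen-Macaulay $A$-module $M$, the functions $j\mapsto\lambda(\operatorname{Tor}_1^A(M,N/I^jN))$ and $j\mapsto\lambda(\operatorname{Ext}^1_A(M,N/I^jN))$ are known to agree with polynomials for $j\gg0$; $r_1^{I,N}(M)$ and $s^1_{I,N}(M)$, respectively, denote the degrees of these polynomials. The zero polynomial has degree $-1$. *)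

(* Defs.v *)
From HB Require Import structures.
From mathcomp Require Import all_boot all_order all_algebra.
From mathcomp Require Import boolp classical_sets functions.

Set Implicit Arguments.
Unset Strict Implicit.
Unset Printing Implicit Defensive.

Import GRing.Theory.
Local Open Scope ring_scope.

(** Modules over [A : comNzRingType] are [lmodType A], submodules of [V] are
    [submodClosed V], and ideals of [A] (proper or not) are submodules of the
    regular module [A^o].  These predicates are boolean; by the classical
    axioms of [boolp] this is no restriction. *)

Notation ideal A := (submodClosed (A^o)).

Section Submodules.
Variable A : comNzRingType.
Implicit Types U V W : lmodType A.

Definition fullp V : V -> bool := fun _ => true.

Fact fullp_closed V : submod_closed (@fullp V).
Proof. by []. Qed.
HB.instance Definition _ V :=
  GRing.isSubmodClosed.Build A V (@fullp V) (@fullp_closed V).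

Definition full V : submodClosed V := GRing.SubmodClosed.clone A V (@fullp V) _.

Definition kerp U V (f : {linear U -> V}) : U -> bool := fun x => f x == 0.

Fact kerp_closed U V (f : {linear U -> V}) : submod_closed (kerp f).
Proof.
split=> [|a x y /eqP fx /eqP fy]; first by apply/eqP; rewrite linear0.
by apply/eqP; rewrite linearP fx fy scaler0 addr0.
Qed.
HB.instance Definition _ U V (f : {linear U -> V}) :=
  GRing.isSubmodClosed.Build A U (kerp f) (kerp_closed f).

Definition ker U V (f : {linear U -> V}) : submodClosed U :=
  GRing.SubmodClosed.clone A U (kerp f) _.

(* The intersection of all submodules containing [P]. *)
Definition submod_genp V (P : set V) : V -> bool :=
  fun x => `[< forall S : submodClosed V,
                 (forall y, P y -> y \in S) -> x \in S >].

Fact submod_genp_closed V (P : set V) : submod_closed (submod_genp P).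
Proof.
split=> [|a x y /asboolP Px /asboolP Py]; apply/asboolP => S PS.
  exact: rpred0.
by rewrite rpredD ?rpredZ ?Px ?Py.
Qed.
HB.instance Definition _ V (P : set V) :=
  GRing.isSubmodClosed.Build A V (submod_genp P) (submod_genp_closed P).

Definition submod_gen V (P : set V) : submodClosed V :=
  GRing.SubmodClosed.clone A V (submod_genp P) _.

Definition smod V (S : submodClosed V) := {x : V | x \in S}.

HB.instance Definition _ V (S : submodClosed V) := SubChoice.on (smod S).
HB.instance Definition _ V (S : submodClosed V) :=
  [SubChoice_isSubLmodule of smod S by <:].

(* MathComp's additive quotient [{quot S}] wants a [zmodClosed] predicate. *)
Definition subgroupp V (S : submodClosed V) : V -> bool := fun x => x \in S.

Fact subgroupp_closed V (S : submodClosed V) : zmod_closed (subgroupp S).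
Proof. exact (GRing.submodClosedP S). Qed.
HB.instance Definition _ V (S : submodClosed V) :=
  GRing.isZmodClosed.Build V (subgroupp S) (subgroupp_closed S).

Definition subgroup V (S : submodClosed V) : zmodClosed V :=
  GRing.ZmodClosed.clone V (subgroupp S) _.

Definition qmod V (S : submodClosed V) := Quotient.quot (subgroup S).

HB.instance Definition _ V (S : submodClosed V) := GRing.Zmodule.on (qmod S).

Definition qproj V (S : submodClosed V) (x : V) : qmod S :=
  \pi_(Quotient.quot (subgroup S))%qT x.

Definition qscale V (S : submodClosed V) (a : A) (x : qmod S) : qmod S :=
  qproj S (a *: repr (x : Quotient.quot (subgroup S))).

Fact qproj_eq V (S : submodClosed V) (x y : V) :
  (qproj S x == qproj S y) = (x - y \in S).
Proof. exact: (esym (Quotient.idealrBE (subgroup S) x y)). Qed.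

Fact qproj_surj V (S : submodClosed V) (x : qmod S) : exists y, x = qproj S y.
Proof. by exists (repr (x : Quotient.quot (subgroup S))); rewrite /qproj reprK. Qed.

Fact qprojD V (S : submodClosed V) (x y : V) :
  qproj S (x + y) = qproj S x + qproj S y.
Proof. exact: (raddfD (\pi_(Quotient.quot (subgroup S))%qT)). Qed.

Fact qscale_proj V (S : submodClosed V) a (x : V) :
  qscale a (qproj S x) = qproj S (a *: x).
Proof.
apply/eqP; rewrite /qscale qproj_eq -scalerBr rpredZ // -qproj_eq.
by rewrite {1}/qproj reprK.
Qed.

Fact qscaleA V (S : submodClosed V) a b (x : qmod S) :
  qscale a (qscale b x) = qscale (a * b) x.
Proof. by have [y ->] := qproj_surj x; rewrite !qscale_proj scalerA. Qed.

Fact qscale1 V (S : submodClosed V) : left_id 1 (@qscale V S).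
Proof. by move=> x; have [y ->] := qproj_surj x; rewrite qscale_proj scale1r. Qed.

Fact qscaleDr V (S : submodClosed V) : right_distributive (@qscale V S) +%R.
Proof.
move=> a x x'; have [y ->] := qproj_surj x; have [y' ->] := qproj_surj x'.
by rewrite -qprojD !qscale_proj scalerDr qprojD.
Qed.

Fact qscaleDl V (S : submodClosed V) (x : qmod S) :
  {morph (@qscale V S)^~ x : a b / a + b}.
Proof.
by move=> a b; have [y ->] := qproj_surj x; rewrite !qscale_proj scalerDl qprojD.
Qed.

HB.instance Definition _ V (S : submodClosed V) :=
  GRing.Zmodule_isLmodule.Build A (qmod S)
    (@qscaleA V S) (@qscale1 V S) (@qscaleDr V S) (@qscaleDl V S).

(* [Hom_A(V, A)], as a submodule of the module of all functions. *)
Definition linp V : (V -> A^o) -> bool := fun f => `[< linear f >].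

Fact linp_closed V : submod_closed (@linp V).
Proof.
split=> [|c f g /asboolP lf /asboolP lg]; apply/asboolP => a x y.
  by rewrite scaler0 addr0.
rewrite [LHS]/(c *: f (a *: x + y) + g (a *: x + y)) lf lg !scalerDr !scalerA.
by rewrite [c * a]mulrC addrACA.
Qed.
HB.instance Definition _ V :=
  GRing.isSubmodClosed.Build A (V -> A^o) (@linp V) (@linp_closed V).

Definition dual_mod V : lmodType A :=
  smod (GRing.SubmodClosed.clone A (V -> A^o) (@linp V) _).

(* [ker g / im f], where it is understood that [g \o f = 0]. *)
Section Homology.
Variables (U V W : lmodType A) (f : {linear U -> V}) (g : {linear V -> W}).

Definition boundaryp : smod (ker g) -> bool :=
  fun z => `[< exists u, f u = val z >].

Fact boundaryp_closed : submod_closed boundaryp.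
Proof.
split=> [|a x y /asboolP[u fu] /asboolP[v fv]]; apply/asboolP.
  by exists 0; rewrite linear0.
by exists (a *: u + v); rewrite linearP fu fv.
Qed.
HB.instance Definition _ :=
  GRing.isSubmodClosed.Build A (smod (ker g)) boundaryp boundaryp_closed.

Definition homology : lmodType A :=
  qmod (GRing.SubmodClosed.clone A (smod (ker g)) boundaryp _).

End Homology.

End Submodules.

Section Notions.
Variable A : comNzRingType.
Implicit Types (U V W M N L E P : lmodType A) (I J m : ideal A).

Definition zero_module V := forall x : V, x = 0.

Definition generated_by n V :=
  exists e : 'I_n -> V, forall x, exists c : 'I_n -> A,
    x = \sum_i c i *: e i.

Definition fin_gen V := exists n, generated_by n V.

Definition noetherian := forall J : ideal A, fin_gen (smod J).

(* [(A, m)] is local: [m] is the largest proper ideal. *)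
Definition is_local m :=
  1 \notin m /\ forall J : ideal A, 1 \notin J -> {subset J <= m}.

Definition is_max (Q : nat -> Prop) l :=
  Q l /\ forall l', Q l' -> (l' <= l)%N.

Definition strict_chain (T : Type) l (c : nat -> {pred T}) :=
  forall i, (i < l)%N ->
    {subset c i <= c i.+1} /\ exists2 x, x \in c i.+1 & x \notin c i.

Definition has_length V : nat -> Prop :=
  is_max (fun l => exists c : nat -> submodClosed V,
                     strict_chain l (fun i => c i : {pred V})).

(* [dim V = dim (A / Ann V)].  In particular [has_dim A^o d] says that the
   Krull dimension of the ring [A] is [d]. *)
Definition has_dim V : nat -> Prop :=
  is_max (fun l => exists p : nat -> prime_idealr A,
    strict_chain l (fun i => p i : {pred A}) /\
    forall i, (i <= l)%N ->
      forall a, (forall x : V, a *: x = 0) -> a \in p i).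

Definition regular_local m :=
  exists2 d, has_dim A^o d & generated_by d (smod m).

Definition exact_at U V W (f : {linear U -> V}) (g : {linear V -> W}) :=
  forall y, g y = 0 <-> exists x, f x = y.

Definition injective_module E :=
  forall U V (i : {linear U -> V}) (f : {linear U -> E}), injective i ->
    exists g : {linear V -> E}, forall x, g (i x) = f x.

Definition projective_module P :=
  forall U V (q : {linear U -> V}) (f : {linear P -> V}),
    (forall y, exists x, q x = y) ->
    exists g : {linear P -> U}, forall x, q (g x) = f x.

Definition finite_injdim V :=
  exists n (E : nat -> lmodType A) (e : {linear V -> E 0%N})
    (d : forall i, {linear E i -> E i.+1}),
    [/\ forall i, injective_module (E i),
        forall i, (n < i)%N -> zero_module (E i),
        injective e, exact_at e (d 0%N) &
        forall i, exact_at (d i) (d i.+1)].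

Definition finite_projdim V :=
  exists n (P : nat -> lmodType A) (e : {linear P 0%N -> V})
    (d : forall i, {linear P i.+1 -> P i}),
    [/\ forall i, projective_module (P i),
        forall i, (n < i)%N -> zero_module (P i),
        forall x, exists y, e y = x, exact_at (d 0%N) e &
        forall i, exact_at (d i.+1) (d i)].

Definition gorenstein_local m :=
  [/\ noetherian, is_local m & finite_injdim A^o].

(* [(a_0, ..., a_(i-1)) V] *)
Definition seq_mul (a : nat -> A) i V : submodClosed V :=
  submod_gen [set y : V | exists2 j, (j < i)%N & exists x, y = a j *: x].

Definition regular_seq m V l (a : nat -> A) :=
  [/\ forall i, (i < l)%N -> a i \in m,
      forall i, (i < l)%N -> forall x : V,
        a i *: x \in seq_mul a i V -> x \in seq_mul a i V &
      exists x : V, x \notin seq_mul a l V].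

Definition has_depth m V : nat -> Prop :=
  is_max (fun l => exists a, regular_seq m V l a).

Definition cohen_macaulay m V :=
  exists2 t, has_depth m V t & has_dim V t.

Definition perfect_module m V :=
  [/\ ~ zero_module V, cohen_macaulay m V & finite_projdim V].

Definition ideal_mul I V (S : submodClosed V) : submodClosed V :=
  submod_gen [set y | exists a x, [/\ a \in I, x \in S & y = a *: x]].

(* [V / I^j V], with [I^j V] computed as [I (I (... (I V)))]. *)
Definition quo_pow I j V : lmodType A :=
  qmod (iter j (@ideal_mul I V) (full V)).

Definition ideal_of_definition m N I :=
  {subset I <= m} /\ exists l, has_length (quo_pow I 1 N) l.

(** Syzygies, Tor and Ext.  Everything is computed from one chosen minimal
    free resolution [... -> A^(b 1) -> A^(b 0) -> M -> 0]; free modules consist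
    of row vectors. *)

Definition free_map M := {n & {linear 'rV[A]_n -> M}}.

Definition is_min_cover m M (c : free_map M) :=
  (forall x, exists v, projT2 c v = x) /\
  (forall v, projT2 c v = 0 -> forall j, v ord0 j \in m).

Definition zero_free_map M : free_map M :=
  existT _ 0%N (\0 : {linear 'rV[A]_0 -> M}).

(* A chosen minimal cover; it exists when [M] is finitely generated over the
   local ring [(A, m)]. *)
Definition min_cover m M : free_map M :=
  match pselect (exists c, is_min_cover m c) with
  | left h => projT1 (cid h)
  | right _ => zero_free_map M
  end.

Definition mu m M : nat := projT1 (min_cover m M).
Definition cover m M : {linear 'rV[A]_(mu m M) -> M} := projT2 (min_cover m M).

Definition syz m M : lmodType A := smod (ker (cover m M)).

Definition cosyz m M : lmodType A := dual_mod (syz m (dual_mod M)).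

(* [Omega m n M] is the [n]-th syzygy of [M], a cosyzygy for negative [n]. *)
Definition Omega m (n : int) M : lmodType A :=
  match n with
  | Posz i => iter i (syz m) M
  | Negz i => iter i.+1 (cosyz m) M
  end.

Definition betti m M i : nat := mu m (iter i (syz m) M).

(* The differential [A^(b (i+1)) -> A^(b i)], which acts as [v |-> v *m D]. *)
Definition resolution_map m M i (v : 'rV[A]_(betti m M i.+1)) :
    'rV[A]_(betti m M i) :=
  val (cover m (iter i.+1 (syz m) M) v).

Definition differential m M i : 'M[A]_(betti m M i.+1, betti m M i) :=
  lin1_mx (@resolution_map m M i).

(* [L^p -> L^q]: the map [(v |-> v *m D) (x) L], with [A^p (x) L = L^p]. *)
Definition mx_act p q (D : 'M[A]_(p, q)) L (x : {ffun 'I_p -> L}) :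
    {ffun 'I_q -> L} :=
  [ffun j => \sum_i D i j *: x i].

Fact mx_act_linear p q (D : 'M[A]_(p, q)) L : linear (@mx_act p q D L).
Proof.
move=> a x y; apply/ffunP=> j; rewrite !ffunE scaler_sumr -big_split /=.
by apply: eq_bigr => i _; rewrite !ffunE scalerDr !scalerA mulrC.
Qed.
HB.instance Definition _ p q (D : 'M[A]_(p, q)) L :=
  GRing.isLinear.Build A {ffun 'I_p -> L} {ffun 'I_q -> L} *:%R
    (@mx_act p q D L) (@mx_act_linear p q D L).

Definition Tor1 m M L : lmodType A :=
  homology (@mx_act _ _ (differential m M 1) L)
           (@mx_act _ _ (differential m M 0) L).

(* Under [Hom(A^q, L) = L^q], [f |-> (f e_j)_j], precomposition with
   [v |-> v *m D] is the action of the transpose of [D]. *)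
Definition Ext1 m M L : lmodType A :=
  homology (@mx_act _ _ (differential m M 0)^T L)
           (@mx_act _ _ (differential m M 1)^T L).

(* [p] gives the length of [X j] for all large [j]. *)
Definition length_poly (X : nat -> lmodType A) (p : {poly rat}) :=
  exists j0, forall j, (j0 <= j)%N ->
    exists2 l, has_length (X j) l & p.[j%:R] = l%:R.

Definition deg (p : {poly rat}) : int := (size p)%:Z - 1.

(* The degree of the polynomial function [j |-> length (X j)], [j >> 0]; such a
   polynomial is unique, and [-2] is a junk value when there is none. *)
Definition length_degree (X : nat -> lmodType A) : int :=
  match pselect (exists p, length_poly X p) with
  | left h => deg (projT1 (cid h))
  | right _ => -2
  end.

Definition r1 m I N M : int := length_degree (fun j => Tor1 m M (quo_pow I j N)).

Definition s1 m I N M : int := length_degree (fun j => Ext1 m M (quo_pow I j N)).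

End Notions.

(* Main.v *)
(** For totally reflexive [M] and any [L], [Tor_1(M, L)] is
    [Ext^1((Omega^3 M)^*, L)]: dualize a free resolution of [M].  So both parts
    concern lengths of [Ext^1(T, L)] with [L = N / I^j N], and [Ext^1(-, L)] is
    subadditive on short exact sequences and blind to free summands.

    Let [J] be generated by a maximal regular sequence of [A].  Since [A] has
    finite injective dimension, Bass' argument shows that [Ext^r(X, A) = 0] for
    [r] above the length of the sequence, so that [R = A / J] has finite length
    and [Omega^d X] is totally reflexive for every [X].  As [R] has finite
    projective dimension, the sequences [0 -> m/J -> R -> k -> 0] and
    [0 -> k -> R -> R/soc -> 0] identify [Omega^(n+1) Omega^d k] with
    [Omega^n Omega^d (m/J)] and [Omega^n Omega^d k] with
    [Omega^(n+1) Omega^d (R/soc)] up to free summands.  Filtering [m/J] and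
    [R/soc] by copies of [k] bounds the lengths for [n] and [n + 1] by constant
    multiples of each other, independently of [j].  Hence the degrees agree,
    once both lengths are known to be polynomial in [j >> 0]; this holds for the
    homology of any complex [N^p -> N^q -> N^r] modulo [I^j], by the Hilbert
    basis theorem and the Hilbert-Serre theorem for the Rees algebra of [I]. *)
Require Import Defs.
From HB Require Import structures.
From mathcomp Require Import all_boot all_order all_algebra.
From mathcomp Require Import boolp classical_sets functions.
Set Implicit Arguments.
Unset Strict Implicit.
Unset Printing Implicit Defensive.

Import Order.TTheory GRing.Theory Num.Theory.
Local Open Scope ring_scope.

(** * Submodules and linear maps *)

Section LinearMaps.
Variable A : comNzRingType.
Implicit Types U V W X Y : lmodType A.

(** The Gorenstein hypothesis supplies only an injective resolution of the ring, whereas syzygies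
    and duals live on free resolutions. Vanishing of Ext is therefore tested on cocycles with values
    in the injective resolution, and [van_ext1] turns it into extension of functionals, which is all
    that duality uses.

    Tor and Ext enter only through upper bounds for lengths of chains of submodules. For these,
    subadditivity along short exact sequences suffices, and no connecting map of Ext(-, L) is
    needed. Covers are arbitrary choices, so exact sequences of modules give exact sequences of
    syzygies only after adding free summands; hence the relations [sim] and [tri].

    The filtration by copies of k requires m to be nilpotent modulo J, and this is obtained from Ext
    as well. Suppose a prime p = (J : w) associated to A/J misses an element of m. Nakayama's lemma
    then makes Ext^k(A/p, A) vanish, where k is here the length of the regular sequence. Pulling
    back a generator of Ext^k(A/J, A), whose annihilator is J, along A/p -> A/J shows that w kills
    this generator, so w lies in J: a contradiction. *)

Definition mklin U V (f : U -> V) (fP : linear f) : {linear U -> V} :=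
  HB.pack f (GRing.isLinear.Build A U V *:%R f fP).

Lemma mklinE U V (f : U -> V) (fP : linear f) x : mklin fP x = f x.
Proof. by []. Qed.

Definition pclosed V (P : V -> Prop) :=
  P 0 /\ forall a x y, P x -> P y -> P (a *: x + y).

Definition psubp V (P : V -> Prop) (hP : pclosed P) : V -> bool :=
  fun x => `[< P x >].

Fact psubp_closed V (P : V -> Prop) (hP : pclosed P) : submod_closed (psubp hP).
Proof.
case: (hP) => h0 h; split=> [|a x y /asboolP hx /asboolP hy]; apply/asboolP=> //.
exact: h.
Qed.
HB.instance Definition _ V (P : V -> Prop) (hP : pclosed P) :=
  GRing.isSubmodClosed.Build A V (psubp hP) (psubp_closed hP).

Definition psub V (P : V -> Prop) (hP : pclosed P) : submodClosed V :=
  GRing.SubmodClosed.clone A V (psubp hP) _.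

Lemma psubP V (P : V -> Prop) (hP : pclosed P) x : reflect (P x) (x \in psub hP).
Proof. exact: asboolP. Qed.

Lemma sub_closed V (S : submodClosed V) : pclosed (fun x => x \in S).
Proof. by split=> [|a x y xS yS]; rewrite ?rpred0 // rpredD // rpredZ. Qed.

Lemma kerP U V (f : {linear U -> V}) x : reflect (f x = 0) (x \in ker f).
Proof. exact: eqP. Qed.

Definition onto U V (f : U -> V) := forall y, exists x, f x = y.

Lemma im_closed U V (f : {linear U -> V}) (S : submodClosed U) :
  pclosed (fun y => exists2 x, x \in S & f x = y).
Proof.
split=> [|a _ _ [x xS <-] [y yS <-]]; first by exists 0; rewrite ?rpred0 ?linear0.
by exists (a *: x + y); rewrite ?linearP // rpredD ?rpredZ.
Qed.
Definition im U V (f : {linear U -> V}) (S : submodClosed U) := psub (im_closed f S).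

Lemma imP U V (f : {linear U -> V}) (S : submodClosed U) y :
  reflect (exists2 x, x \in S & f x = y) (y \in im f S).
Proof. exact: psubP. Qed.

Lemma pre_closed U V (f : {linear U -> V}) (S : submodClosed V) :
  pclosed (fun x => f x \in S).
Proof.
split=> [|a x y xS yS]; first by rewrite linear0 rpred0.
by rewrite linearP rpredD ?rpredZ.
Qed.
Definition pre U V (f : {linear U -> V}) (S : submodClosed V) := psub (pre_closed f S).

Lemma preE U V (f : {linear U -> V}) (S : submodClosed V) x : (x \in pre f S) = (f x \in S).
Proof. by apply/psubP/idP. Qed.

Lemma cap_closed V (S T : submodClosed V) :
  pclosed (fun x => x \in S /\ x \in T).
Proof.
split=> [|a x y [xS xT] [yS yT]]; first by rewrite !rpred0.
by rewrite !rpredD ?rpredZ.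
Qed.
Definition cap V (S T : submodClosed V) := psub (cap_closed S T).

Lemma capP V (S T : submodClosed V) x :
  reflect (x \in S /\ x \in T) (x \in cap S T).
Proof. exact: psubP. Qed.

Lemma add_closed V (S T : submodClosed V) :
  pclosed (fun x => exists s t, [/\ s \in S, t \in T & x = s + t]).
Proof.
split=> [|a _ _ [s [t [sS tT ->]]] [s' [t' [sS' tT' ->]]]].
  by exists 0, 0; rewrite !rpred0 addr0.
exists (a *: s + s'), (a *: t + t'); rewrite !rpredD ?rpredZ //.
by rewrite scalerDr addrACA.
Qed.
Definition addS V (S T : submodClosed V) := psub (add_closed S T).

Lemma addSP V (S T : submodClosed V) x :
  reflect (exists s t, [/\ s \in S, t \in T & x = s + t]) (x \in addS S T).
Proof. exact: psubP. Qed.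

Lemma addSl V (S T : submodClosed V) : {subset S <= addS S T}.
Proof. by move=> x xS; apply/addSP; exists x, 0; rewrite rpred0 addr0. Qed.

Lemma addSr V (S T : submodClosed V) : {subset T <= addS S T}.
Proof. by move=> x xS; apply/addSP; exists 0, x; rewrite rpred0 add0r. Qed.

Lemma zero_closed V : pclosed (fun x : V => x = 0).
Proof. by split=> // a x y -> ->; rewrite scaler0 addr0. Qed.
Definition zeroS V : submodClosed V := psub (@zero_closed V).

Lemma zeroSP V (x : V) : reflect (x = 0) (x \in zeroS V).
Proof. exact: psubP. Qed.

Lemma submodB V (S : submodClosed V) x y : x \in S -> y \in S -> x - y \in S.
Proof. by move=> xS yS; rewrite -scaleN1r addrC rpredD // rpredZ. Qed.

Lemma lin_inj U V (f : {linear U -> V}) : (forall x, f x = 0 -> x = 0) -> injective f.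
Proof.
move=> h x y e; apply/eqP; rewrite -subr_eq0; apply/eqP/h.
by rewrite linearB e subrr.
Qed.

Lemma linM U V (f : {linear U -> V}) a x : f (a *: x) = a *: f x.
Proof. exact: linearZ. Qed.

Lemma factor_surj U V W (p : {linear U -> V}) (f : {linear U -> W}) :
    onto p -> (forall x, p x = 0 -> f x = 0) ->
  exists g : {linear V -> W}, forall x, g (p x) = f x.
Proof.
move=> ps pf; pose s y := sval (cid (ps y)).
have sK y : p (s y) = y by exact: (svalP (cid (ps y))).
have key x y : p x = p y -> f x = f y.
  move=> e; apply/eqP; rewrite -subr_eq0 -linearB; apply/eqP/pf.
  by rewrite linearB e subrr.
have gP : linear (f \o s).
  by move=> a x y; rewrite /= -linearP; apply: key; rewrite linearP !sK.
by exists (mklin gP) => x; apply: key; rewrite sK.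
Qed.

Lemma factor_inj U V W (i : {linear U -> V}) (f : {linear W -> V}) :
    injective i -> (forall x, exists y, i y = f x) ->
  exists g : {linear W -> U}, forall x, i (g x) = f x.
Proof.
move=> ii h; pose g x := sval (cid (h x)).
have gK x : i (g x) = f x by exact: (svalP (cid (h x))).
have gP : linear g by move=> a x y; apply: ii; rewrite linearP !gK linearP.
by exists (mklin gP).
Qed.

Definition row_comb n V (e : 'I_n -> V) (v : 'rV[A]_n) : V :=
  \sum_j v ord0 j *: e j.

Fact row_comb_linear n V (e : 'I_n -> V) : linear (row_comb e).
Proof.
move=> a u v; rewrite /row_comb scaler_sumr -big_split; apply: eq_bigr => j _ /=.
by rewrite !mxE scalerDl scalerA.
Qed.
Definition row_map n V (e : 'I_n -> V) : {linear 'rV[A]_n -> V} :=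
  mklin (row_comb_linear e).

Lemma row_mapE n V (f : {linear 'rV[A]_n -> V}) v :
  f v = \sum_j v ord0 j *: f (delta_mx ord0 j).
Proof.
rewrite {1}[v]row_sum_delta linear_sum; apply: eq_bigr => j _.
exact: linearZ.
Qed.

Lemma row_map_delta n V (e : 'I_n -> V) j : row_map e (delta_mx ord0 j) = e j.
Proof.
rewrite mklinE /row_comb (bigD1 j) //= mxE !eqxx scale1r big1 ?addr0 // => i ij.
by rewrite mxE eqxx (negPf ij) scale0r.
Qed.

Lemma row_map_ext n V (f g : {linear 'rV[A]_n -> V}) :
  (forall j, f (delta_mx ord0 j) = g (delta_mx ord0 j)) -> f =1 g.
Proof. by move=> h v; rewrite row_mapE [RHS]row_mapE; apply: eq_bigr => j _; rewrite h. Qed.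

Lemma row_lift n V W (p : {linear V -> W}) (f : {linear 'rV[A]_n -> W}) :
    (forall v, exists x, p x = f v) ->
  exists g : {linear 'rV[A]_n -> V}, forall v, p (g v) = f v.
Proof.
move=> h; pose e j := sval (cid (h (delta_mx ord0 j))).
have eP j : p (e j) = f (delta_mx ord0 j) by exact: (svalP (cid (h _))).
exists (row_map e) => v.
apply: (@row_map_ext _ _ (p \o row_map e)%FUN f) => j.
by rewrite -[LHS]/(p (row_map e (delta_mx ord0 j))) row_map_delta.
Qed.

Definition sval_lin V (S : submodClosed V) : {linear smod S -> V} :=
  GRing.Linear.clone A (smod S) V *:%R val _.

Lemma qproj_linear V (S : submodClosed V) : linear (qproj S).
Proof. by move=> a x y; rewrite qprojD -qscale_proj. Qed.
Definition qlin V (S : submodClosed V) : {linear V -> qmod S} :=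
  mklin (qproj_linear S).

Lemma qlin_surj V (S : submodClosed V) : onto (qlin S).
Proof. by move=> y; have [x ->] := qproj_surj y; exists x. Qed.

Lemma qlin0 V (S : submodClosed V) x : qlin S x = 0 <-> x \in S.
Proof.
have -> : (qlin S x = 0) = (qproj S x = qproj S 0).
  by rewrite -[qproj S 0]/(qlin S 0) linear0.
split; first by move/eqP; rewrite qproj_eq subr0.
by move=> xS; apply/eqP; rewrite qproj_eq subr0.
Qed.

End LinearMaps.

(** * Strict chains in an interval of submodules *)

Section Chains.
Variable A : comNzRingType.
Implicit Types U V W : lmodType A.

(** Chains for the subquotient P/Q, kept inside the ambient module. Homology is a subquotient, so
    its length can be computed without forming quotients. A chain need not reach the ends [Q] and
    [P]. *)
Definition ilchain V (Q P : submodClosed V) l :=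
  exists c : nat -> submodClosed V, strict_chain l (fun i => c i : {pred V}) /\
    forall i, (i <= l)%N -> {subset Q <= c i} /\ {subset c i <= P}.

Definition ilen V (Q P : submodClosed V) := is_max (ilchain Q P).

Lemma ilchain_full V l :
  ilchain (zeroS V) (full V) l <->
  exists c : nat -> submodClosed V, strict_chain l (fun i => c i : {pred V}).
Proof.
split=> [[c [cs _]]|[c cs]]; first by exists c.
by exists c; split=> // i _; split=> [x /zeroSP->|//]; rewrite rpred0.
Qed.

Lemma is_max_ext (P Q : nat -> Prop) l : (forall l, P l <-> Q l) -> is_max P l -> is_max Q l.
Proof. by move=> h [Pl m]; split=> [|l' Ql]; [apply/h|apply/m/h]. Qed.

Lemma has_length_ilen V l : has_length V l <-> ilen (zeroS V) (full V) l.
Proof. by split; apply: is_max_ext => ?; rewrite ilchain_full. Qed.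

(** Preserving inclusions keeps a chain a chain, and reflecting them along nested pairs keeps it
    strict; [F] need not be a bijection between the two intervals. *)
Lemma ilchain_map V W (Q P : submodClosed V) (Q' P' : submodClosed W)
    (F : submodClosed V -> submodClosed W) l :
    (forall S : submodClosed V, {subset Q <= S} -> {subset S <= P} ->
       {subset Q' <= F S} /\ {subset F S <= P'}) ->
    (forall S T : submodClosed V, {subset Q <= S} -> {subset S <= T} -> {subset T <= P} ->
       {subset F S <= F T} /\ ({subset F T <= F S} -> {subset T <= S})) ->
  ilchain Q P l -> ilchain Q' P' l.
Proof.
move=> h1 h2 [c [cs cb]]; exists (fun i => F (c i)); split=> [i il|i il]; last first.
  by have [] := cb i il; apply: h1.
have [cc [x xc xn]] := cs i il.
have [] := h2 (c i) (c i.+1) (cb i (ltnW il)).1 cc (cb i.+1 il).2.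
split=> //; apply: contrapT => no; apply/negP: xn; rewrite negbK; apply: b _ xc => y yF.
by apply: contrapT => /negP yn; apply: no; exists y.
Qed.

(** The hypotheses say that [f] induces an isomorphism of P/Q onto P'/Q'; image and preimage then
    match the intermediate submodules. *)
Lemma ilchain_lin V W (f : {linear V -> W}) (Q P : submodClosed V)
    (Q' P' : submodClosed W) :
    {subset Q <= P} -> {subset Q' <= P'} ->
    (forall x, x \in P -> f x \in P') ->
    (forall y, y \in P' -> exists2 x, x \in P & y - f x \in Q') ->
    (forall x, x \in P -> (f x \in Q') = (x \in Q)) ->
  forall l, ilchain Q P l <-> ilchain Q' P' l.
Proof.
move=> QP QP' fP fs fQ l; split; [apply: (@ilchain_map _ _ _ _ _ _ (fun S => addS Q' (im f S)))|
  apply: (@ilchain_map _ _ _ _ _ _ (fun S => cap P (pre f S)))].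
- move=> S QS SP; split=> y; first exact: addSl.
  case/addSP=> q [_ [qQ /imP[x xS <-] ->]]; apply: rpredD; first exact: QP'.
  by apply/fP/SP.
- move=> S T QS ST TP; split=> [y|h x xT].
    case/addSP=> q [_ [qQ /imP[x xS <-] ->]]; apply/addSP; exists q, (f x); split=> //.
    by apply/imP; exists x => //; apply: ST.
  have /h/addSP[q [_ [qQ /imP[x' xS <-] e]]] : f x \in addS Q' (im f T).
    by apply/addSr/imP; exists x.
  rewrite -(subrK x' x) rpredD //; apply: QS.
  have xP : x - x' \in P by apply: submodB; apply: TP => //; apply: ST.
  by rewrite -(fQ _ xP) linearB e addrK.
- move=> S QS SP; split=> y.
    by move=> yQ; apply/capP; split; [apply: QP|rewrite preE; apply: QS; rewrite fQ ?QP].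
  by case/capP.
- move=> S T QS ST TP; split=> [y /capP[yP]|h y yT].
    by rewrite preE => yS; apply/capP; rewrite preE ST.
  have [x xP e] := fs y (TP y yT).
  suff /h/capP[_] : x \in cap P (pre f T).
    by rewrite preE => fS; rewrite -[y](subrK (f x)); apply: rpredD => //; apply: QS.
  apply/capP; rewrite preE; split=> //.
  by rewrite -[f x](subKr y (f x)); apply: submodB => //; apply/ST/QS.
Qed.

Lemma ilen_ext V W (Q P : submodClosed V) (Q' P' : submodClosed W) :
    (forall l, ilchain Q P l <-> ilchain Q' P' l) ->
  forall l, ilen Q P l <-> ilen Q' P' l.
Proof. by move=> h l; split; apply: is_max_ext => ?; rewrite h. Qed.

Lemma ilchain_eq V (Q P Q' P' : submodClosed V) : Q =i Q' -> P =i P' ->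
  forall l, ilchain Q P l <-> ilchain Q' P' l.
Proof.
move=> eQ eP l; split=> -[c [cs cb]]; exists c; split=> // i il;
have [h1 h2] := cb i il; split=> x.
- by rewrite -eQ; apply: h1.
- by rewrite -eP; apply: h2.
- by rewrite eQ; apply: h1.
- by rewrite eP; apply: h2.
Qed.

Lemma homology_ilchain (U V W : lmodType A) (f : {linear U -> V}) (g : {linear V -> W}) :
    (forall x, g (f x) = 0) ->
  forall l, (exists c : nat -> submodClosed (homology f g),
     strict_chain l (fun i => c i : {pred (homology f g)})) <-> ilchain (im f (full U)) (ker g) l.
Proof.
move=> gf l; rewrite -ilchain_full.
set B := GRing.SubmodClosed.clone A (smod (ker g)) (@boundaryp A U V W f g) _.
have hB x : (x \in B) = (val x \in im f (full U)).
  by apply/asboolP/imP=> [[u e]|[u _ e]]; exists u.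
have -> : ilchain (zeroS (homology f g)) (full (homology f g)) l <-> ilchain B (full _) l.
  apply: iff_sym; apply: (@ilchain_lin _ _ (qlin B)) => //.
  - by move=> y _; have [x <-] := qlin_surj y; exists x; rewrite // subrr rpred0.
  - by move=> x _; apply/zeroSP/idP => /qlin0.
apply: (@ilchain_lin _ _ (sval_lin (ker g))) => //.
- by move=> _ /imP[x _ <-]; apply/kerP.
- by move=> x _; apply: (valP x).
- by move=> y yk; exists (Sub y yk); rewrite //= subrr rpred0.
Qed.

End Chains.

(** * Lengths of intervals of submodules *)

Section Lengths.
Variable A : comNzRingType.
Implicit Types U V W : lmodType A.

Lemma is_max_uniq P a b : is_max P a -> is_max P b -> a = b.
Proof. by move=> [Pa ha] [Pb hb]; apply/eqP; rewrite eqn_leq hb // ha. Qed.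

Lemma is_max_exists (P : nat -> Prop) n0 n : P n0 -> (forall l, P l -> (l <= n)%N) ->
  exists l, is_max P l.
Proof.
move=> P0 hn.
have ex : exists i, `[< P i >] by exists n0; apply/asboolP.
have ub i : `[< P i >] -> (i <= n)%N by move/asboolP/hn.
case: (ex_maxnP ex ub) => l /asboolP Pl ml; exists l; split=> // l' Pl'.
by apply/ml/asboolP.
Qed.

(** Repetitions are deleted from a weakly increasing chain. The exact number of strict steps is
    recorded because [ilchain_split] adds two such numbers. *)
Lemma chain_extract V l (u : nat -> submodClosed V) :
    (forall i, (i < l)%N -> {subset u i <= u i.+1}) ->
  exists k (c : nat -> submodClosed V),
    [/\ strict_chain k (fun i => c i : {pred V}),
        forall i, (i <= k)%N -> exists2 j, (j <= l)%N & c i = u j,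
        {subset u l <= c k} /\ {subset c k <= u l} &
        k = (\sum_(i < l) ~~ `[< {subset u i.+1 <= u i} >])%N].
Proof.
elim: l => [_|l IH um].
  exists 0%N, u; split=> //; [|by split|by rewrite big_ord0].
  by move=> i; rewrite leqn0 => /eqP->; exists 0%N.
have [|k [c [cs cu [uc cu'] ek]]] := IH; first by move=> i il; apply: um; apply: leqW.
rewrite big_ord_recr /= -ek; case: asboolP => [lu|nlu] /=.
  exists k, c; rewrite addn0; split=> //.
    by move=> i /cu[j jl ->]; exists j => //; apply: leqW.
  by split=> x; [move/lu/uc|move/cu' => xu; apply: (um l (ltnSn l) x)].
exists k.+1, (fun i => if (i <= k)%N then c i else u l.+1); rewrite addn1; split=> //.
- move=> i; rewrite ltnS => ik; rewrite ik; case: ltnP => ik'; first exact: cs.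
  have -> : i = k by apply/eqP; rewrite eqn_leq ik.
  split=> [x /cu' xu|]; first exact: (um l (ltnSn l) x).
  apply: contrapT => no; apply: nlu => x xu; apply: contrapT => xn; apply: no.
  by exists x => //; apply/negP => /cu'.
- move=> i; case: (leqP i k) => [ik _|_ _]; last by exists l.+1.
  by have [j jl ->] := cu i ik; exists j => //; apply: leqW.
- by rewrite ltnn; split.
Qed.

(** If [F1] and [F2] together detect inclusions, each strict step of a chain stays strict under at
    least one of them. This is the common source of subadditivity, for intermediate submodules and
    for Ext. *)
Lemma ilchain_split V V1 V2 (Q P : submodClosed V) (Q1 P1 : submodClosed V1)
    (Q2 P2 : submodClosed V2) (F1 : submodClosed V -> submodClosed V1)
    (F2 : submodClosed V -> submodClosed V2) l :
    (forall S : submodClosed V, {subset Q <= S} -> {subset S <= P} ->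
      [/\ {subset Q1 <= F1 S}, {subset F1 S <= P1},
          {subset Q2 <= F2 S} & {subset F2 S <= P2}]) ->
    (forall S T : submodClosed V, {subset Q <= S} -> {subset S <= T} ->
      {subset T <= P} -> [/\ {subset F1 S <= F1 T}, {subset F2 S <= F2 T} &
        {subset F1 T <= F1 S} -> {subset F2 T <= F2 S} -> {subset T <= S}]) ->
  ilchain Q P l ->
  exists l1 l2, [/\ ilchain Q1 P1 l1, ilchain Q2 P2 l2 & (l <= l1 + l2)%N].
Proof.
move=> h1 h2 [c [cs cb]].
have m i : (i < l)%N -> [/\ {subset F1 (c i) <= F1 (c i.+1)},
    {subset F2 (c i) <= F2 (c i.+1)} & {subset F1 (c i.+1) <= F1 (c i)} ->
      {subset F2 (c i.+1) <= F2 (c i)} -> {subset c i.+1 <= c i}].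
  move=> il; apply: h2; [exact: (cb i (ltnW il)).1|exact: (cs i il).1|].
  exact: (cb i.+1 il).2.
have [|l1 [c1 [c1s c1u _ e1]]] := @chain_extract _ l (fun i => F1 (c i)).
  by move=> i /m[].
have [|l2 [c2 [c2s c2u _ e2]]] := @chain_extract _ l (fun i => F2 (c i)).
  by move=> i /m[].
exists l1, l2; split.
- exists c1; split=> // i /c1u[j /cb[cj1 cj2] ->].
  by case: (h1 _ cj1 cj2).
- exists c2; split=> // i /c2u[j /cb[cj1 cj2] ->].
  by case: (h1 _ cj1 cj2).
rewrite e1 e2 -big_split /= -[X in (X <= _)%N]card_ord -sum1_card.
apply: leq_sum => i _; have [_ _ h] := m i (ltn_ord i).
case: asboolP => //= h1'; case: asboolP => //= h2'.
have [_ [x xT /negP xS]] := cs i (ltn_ord i).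
by case: xS; apply: h.
Qed.

(** The modular law: a submodule in a nested pair is determined by its intersection with [R] and its
    sum with [R]. *)
Lemma ilchain_cut V (Q R P : submodClosed V) l :
    {subset Q <= R} -> {subset R <= P} -> ilchain Q P l ->
  exists l1 l2, [/\ ilchain Q R l1, ilchain R P l2 & (l <= l1 + l2)%N].
Proof.
move=> QR RP; apply: (@ilchain_split _ _ _ _ _ _ _ _ _ (cap R) (addS R)).
- move=> S QS SP; split=> x.
  + by move=> xQ; apply/capP; split; [apply: QR|apply: QS].
  + by case/capP.
  + exact: addSl.
  + by case/addSP=> [r [s [rR sS ->]]]; apply: rpredD; [apply: RP|apply: SP].
move=> S T QS ST TP; split=> [x /capP[xR xS]|x /addSP[r [s [rR sS ->]]]|h1 h2 x xT].
- by apply/capP; split=> //; apply: ST.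
- by apply/addSP; exists r, s; split=> //; apply: ST.
have /h2/addSP[r [s [rR sS e]]] : x \in addS R T by apply: addSr.
have /h1/capP[_ rS] : r \in cap R T.
  by apply/capP; split=> //; rewrite -(addrK s r) -e; apply: submodB => //; apply: ST.
by rewrite e rpredD.
Qed.

Lemma ilchain0 V (Q P : submodClosed V) : {subset Q <= P} -> ilchain Q P 0.
Proof. by move=> QP; exists (fun _ => Q); split=> // i _; split. Qed.

Lemma ilchain_le V (Q P Q' P' : submodClosed V) l :
  {subset Q <= Q'} -> {subset P' <= P} -> ilchain Q' P' l -> ilchain Q P l.
Proof.
move=> QQ PP [c [cs cb]]; exists c; split=> // i il; have [h1 h2] := cb i il.
by split=> x; [move/QQ/h1|move/h2/PP].
Qed.

Lemma ilchain_add V (Q R P : submodClosed V) a b :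
  ilchain Q R a -> ilchain R P b -> ilchain Q P (a + b).
Proof.
move=> [c [cs cb]] [e [es eb]].
have aR : {subset c a <= R} := (cb a (leqnn a)).2.
have QR : {subset Q <= R} by move=> x /(cb 0%N (leq0n _)).1/(cb 0%N (leq0n _)).2.
have RP : {subset R <= P} by move=> x /(eb 0%N (leq0n _)).1/(eb 0%N (leq0n _)).2.
exists (fun i => if (i < a)%N then c i else e (i - a)%N); split=> i il.
  case: (ltnP i.+1 a) => ia; first by rewrite (ltnW ia); apply/cs/ltnW.
  case: (ltnP i a) => ia'.
    have ei : i.+1 = a by apply/eqP; rewrite eqn_leq ia ia'.
    have [ci [x xc xn]] := cs i ia'.
    rewrite ei subnn; have Re := (eb 0%N (leq0n _)).1; split=> [y|].
      by move/ci; rewrite ei => /aR/Re.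
    by exists x => //; apply/Re/aR; rewrite -ei.
  by rewrite subSn //; apply: es; rewrite ltn_subLR.
case: ltnP => ia.
  have [h1 h2] := cb i (ltnW ia); split=> // x /h2; exact: RP.
have [|h1 h2] := eb (i - a)%N; first by rewrite leq_subLR.
by split=> // x /QR; apply: h1.
Qed.

Lemma ilchain_sub V (Q P : submodClosed V) l : ilchain Q P l -> {subset Q <= P}.
Proof. by case=> c [_ cb] x /(cb 0%N (leq0n _)).1/(cb 0%N (leq0n _)).2. Qed.

Lemma ilen_add V (Q R P : submodClosed V) a b :
  ilen Q R a -> ilen R P b -> ilen Q P (a + b).
Proof.
move=> [ca ma] [cb mb]; split; first exact: ilchain_add ca cb.
move=> l /(ilchain_cut (ilchain_sub ca) (ilchain_sub cb))[l1 [l2 [c1 c2 h]]].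
by apply: leq_trans h _; apply: leq_add; [apply: ma|apply: mb].
Qed.

Lemma ilen_within V (Q P Q' P' : submodClosed V) n :
    {subset Q <= Q'} -> {subset Q' <= P'} -> {subset P' <= P} ->
  ilen Q P n -> exists l, ilen Q' P' l.
Proof.
move=> h1 h2 h3 [_ m]; apply: (@is_max_exists _ 0%N n); first exact: ilchain0.
by move=> l /(ilchain_le h1 h3)/m.
Qed.

Lemma ilen_refl V (Q P : submodClosed V) l :
  ilen Q P l -> {subset P <= Q} -> l = 0%N.
Proof.
move=> [[c [cs cb]] _] PQ; case: l cs cb => // l cs cb.
have [_ [x xc /negP[]]] := cs 0%N (ltn0Sn _).
by apply: (cb 0%N (leq0n _)).1; apply: PQ; apply: (cb 1%N (ltn0Sn _)).2.
Qed.

Lemma ilen_sub V (Q P : submodClosed V) l : ilen Q P l -> {subset Q <= P}.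
Proof. by case=> /ilchain_sub. Qed.

End Lengths.

(** * Eventually polynomial functions and finite differences *)

Section EventualPolynomials.

Definition evp (f : nat -> rat) :=
  exists (p : {poly rat}) j0, forall j, (j0 <= j)%N -> f j = p.[j%:R].

Lemma evp_add f g : evp f -> evp g -> evp (fun j => f j + g j).
Proof.
move=> [p [a hp]] [q [b hq]]; exists (p + q), (maxn a b) => j.
by rewrite geq_max => /andP[/hp-> /hq->]; rewrite hornerD.
Qed.

Lemma evp_opp f : evp f -> evp (fun j => - f j).
Proof. by move=> [p [a hp]]; exists (- p), a => j /hp->; rewrite hornerN. Qed.

Lemma evp_ext f g : (forall j, f j = g j) -> evp f -> evp g.
Proof. by move=> fg [p [a hp]]; exists p, a => j /hp <-. Qed.

Lemma coef_X1 n i : (('X + 1 : {poly rat}) ^+ n)`_i = 'C(n, i)%:R.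
Proof.
elim: n i => [|n IH] i; first by rewrite expr0 coef1 bin0n.
by rewrite exprS mulrDl mul1r coefD coefXM !IH; case: i => [|i];
  rewrite ?bin0 ?add0r // binS natrD addrC.
Qed.

(** Induction on the size: the difference of X^(k+1) has leading term (k+1) X^k, which after
    division by k+1 cancels the leading term of [p]. *)
Lemma antidiff (p : {poly rat}) : exists q : {poly rat}, q \Po ('X + 1) - q = p.
Proof.
have [n] := ubnP (size p); elim: n p => // n IH p; rewrite ltnS => sp.
have [->|pn0] := eqVneq p 0; first by exists 0; rewrite comp_poly0 subrr.
pose k := (size p).-1; have sk : size p = k.+1 by rewrite prednK // lt0n size_poly_eq0.
pose c := p`_k / k.+1%:R; pose r := p - c *: (('X + 1) ^+ k.+1 - 'X^(k.+1)).
have [|q hq] := IH r.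
  apply: leq_trans sp; rewrite sk ltnS; apply/leq_sizeP => i ki.
  rewrite coefB coefZ coefB coef_X1 coefXn.
  case: ltngtP ki => // [ki _|<- _]; last first.
    by rewrite ltn_eqF // subr0 binSn divfK ?subrr // pnatr_eq0.
  rewrite [p`_i]nth_default ?sk //; case: (ltngtP k.+1 i) ki => // [ki|<-] _.
    by rewrite bin_small // !subr0 mulr0.
  by rewrite binn subrr mulr0 subrr.
exists (q + c *: 'X^(k.+1)); rewrite comp_polyD comp_polyZ comp_Xn_poly opprD addrACA hq.
by rewrite -scalerBr /r subrK.
Qed.

(** From the index [a] on, [f] and an antidifference of [p] have equal increments, so they differ by
    a constant. *)
Lemma evp_antidiff f : evp (fun j => f j.+1 - f j) -> evp f.
Proof.
move=> [p [a hp]]; have [q hq] := antidiff p.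
exists (q + (f a - q.[a%:R])%:P), a => j /subnK <-.
elim: (j - a)%N => [|n IH]; first by rewrite add0n hornerD hornerC addrC subrK.
rewrite addSn -[LHS](subrK (f (n + a)%N)) hp ?leq_addl // -hq IH.
have -> x : (q \Po ('X + 1) - q).[x] = q.[x + 1] - q.[x].
  by rewrite hornerD hornerN horner_comp hornerD hornerX hornerC.
by rewrite !hornerD !hornerC addrA subrK natr1.
Qed.

End EventualPolynomials.

(** * Hilbert functions *)

Section Graded.
Variable A : comNzRingType.
Implicit Types (V W : lmodType A) (s : seq A).

Lemma scale_linear V (a : A) : linear (fun x : V => a *: x).
Proof. by move=> b x y; rewrite scalerDr !scalerA mulrC. Qed.
Definition scaleL V (a : A) : {linear V -> V} := mklin (scale_linear a).

(* A sequence [P] stands for the graded module [\bigoplus_j P j], on which the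
   polynomial ring in variables indexed by [s] acts. *)
Definition sseq V s (P : nat -> submodClosed V) :=
  forall a, a \in s -> forall j x, x \in P j -> a *: x \in P j.+1.

(** The ascending chain condition for graded submodules of P/Q over the polynomial ring; the index
    [n0] is uniform in the degree. *)
Definition gnoeth V s (Q P : nat -> submodClosed V) :=
  forall Y : nat -> nat -> submodClosed V,
    (forall n, sseq s (Y n)) ->
    (forall n j, {subset Q j <= Y n j} /\ {subset Y n j <= P j}) ->
    (forall n j, {subset Y n j <= Y n.+1 j}) ->
  exists n0, forall n, (n0 <= n)%N -> forall j, {subset Y n j <= Y n0 j}.

(** Multiplication by a variable [a] is a map of degree one on P/Q. Its kernel K/Q and cokernel P/C
    are killed by [a], so induction on [s] applies to both, and the increment of the length is the
    length of the cokernel minus that of the kernel. *)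
Lemma hilbert_serre V s (Q P : nat -> submodClosed V) (l : nat -> nat) :
    sseq s Q -> sseq s P -> gnoeth s Q P ->
    (forall j, ilen (Q j) (P j) (l j)) ->
  evp (fun j => (l j)%:R).
Proof.
elim: s Q P l => [|a s IH] Q P l sQ sP nQP lQP.
  have QP j := ilen_sub (lQP j).
  (* Without variables, putting [P] in the degrees below [n] and [Q] elsewhere is an admissible
     chain; that it stops forces [P j] and [Q j] to agree from [n0] on. *)
  have [|||n0 h] := nQP (fun n j => if (j < n)%N then P j else Q j).
  - by move=> n b; rewrite in_nil.
  - by move=> n j; case: ifP => _; split=> // x; apply: QP.
  - move=> n j x; case: (ltnP j n) => jn; first by rewrite ltnW.
    by case: ifP => // _; apply: QP.
  exists 0, n0 => j jn; rewrite horner0.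
  rewrite (ilen_refl (lQP j)) // => x xP.
  by have := h j.+1 (leqW jn) j x; rewrite ltnSn ltnNge jn /=; apply.
have aQ j x : x \in Q j -> a *: x \in Q j.+1 by apply: sQ; rewrite inE eqxx.
have aP j x : x \in P j -> a *: x \in P j.+1 by apply: sP; rewrite inE eqxx.
have sQ' : sseq s Q by move=> b bs; apply: sQ; rewrite inE bs orbT.
have sP' : sseq s P by move=> b bs; apply: sP; rewrite inE bs orbT.
have QP j := ilen_sub (lQP j).
pose K j := cap (P j) (pre (scaleL V a) (Q j.+1)).
pose C j := addS (Q j.+1) (im (scaleL V a) (P j)).
have KP j x : x \in K j -> x \in P j by case/capP.
have KQ j x : x \in K j -> a *: x \in Q j.+1 by case/capP => _; rewrite preE.
have QK j x : x \in Q j -> x \in K j.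
  by move=> xQ; apply/capP; rewrite preE; split; [apply: QP|apply: aQ].
have CP j x : x \in C j -> x \in P j.+1.
  case/addSP=> q [_ [qQ /imP[y yP <-] ->]]; apply: rpredD; first exact: QP.
  exact: aP.
have QC j x : x \in Q j.+1 -> x \in C j by move=> xQ; apply: addSl.
have aC j x : x \in P j -> a *: x \in C j.
  by move=> xP; apply/addSr/imP; exists x.
have lK j : exists k, ilen (Q j) (K j) k.
  by apply: ilen_within (lQP j) => // x; [apply: QK|apply: KP].
have lC j : exists c, ilen (C j) (P j.+1) c.
  by apply: ilen_within (lQP j.+1) => // x; [apply: QC|apply: CP].
pose k j := sval (cid (lK j)); pose c j := sval (cid (lC j)).
have kP j : ilen (Q j) (K j) (k j) := svalP (cid (lK j)).
have cP j : ilen (C j) (P j.+1) (c j) := svalP (cid (lC j)).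
have evk : evp (fun j => (k j)%:R).
  apply: IH kP => //.
    move=> b bs j x xK; apply/capP; rewrite preE; split; first exact/sP'/KP.
    by rewrite mklinE scalerA mulrC -scalerA; apply/sQ'/KQ.
  move=> Y sY bY mY; apply: nQP => // [n b|n j]; last first.
    by have [h1 h2] := bY n j; split=> // x /h2/KP.
  rewrite inE => /orP[/eqP-> j x xY|bs]; last exact: sY.
  by apply: (bY n j.+1).1; apply/KQ/(bY n j).2.
have evc : evp (fun j => (c j)%:R).
  apply: IH cP.
  - move=> b bs j x /addSP[q [_ [qQ /imP[y yP <-] ->]]]; rewrite scalerDr.
    apply: rpredD; first exact/QC/sQ'.
    by rewrite mklinE scalerA mulrC -scalerA; apply/aC/sP'.
  - by move=> b bs j; apply: sP'.
  move=> Y sY bY mY.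
  (* [C j] lives in degree j+1. Shifting [Y] by one and putting [Q 0] in degree 0 gives a chain
     between [Q] and [P]. *)
  pose Z n j := if j is j'.+1 then Y n j' else Q 0%N.
  have QY n j x : x \in Q j.+1 -> x \in Y n j by move/QC/(bY n j).1.
  have aY n j x : x \in P j -> a *: x \in Y n j by move/aC/(bY n j).1.
  have [n b||n j|n0 h] := nQP Z.
  - rewrite inE => /orP[/eqP->|bs] [|j] x /= xY.
    + by apply/QY/aQ.
    + by apply: aY; apply: (bY n j).2.
    + by apply/QY/sQ'.
    + exact: sY.
  - move=> n [|j]; split=> // x; [exact: QP|exact: QY|exact: (bY n j).2].
  - by case: j => // j; apply: mY.
  by exists n0 => n nn j; apply: (h n nn j.+1).
apply: evp_antidiff.
apply: (@evp_ext (fun j => (c j)%:R + - (k j)%:R)); last first.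
  exact: evp_add evc (evp_opp evk).
move=> j.
have [e eP] : exists e, ilen (K j) (P j) e.
  by apply: ilen_within (lQP j) => // x; [apply: QK|apply: KP].
(* Multiplication by [a] identifies P/K in degree j with C/Q in degree j+1. *)
have eP' : ilen (Q j.+1) (C j) e.
  apply: (ilen_ext _ e).1 eP; apply: (@ilchain_lin _ _ _ (scaleL V a)).
  - by move=> x; apply: KP.
  - by move=> x; apply: QC.
  - by move=> x; apply: aC.
  - move=> _ /addSP[q [_ [qQ /imP[y yP <-] ->]]]; exists y => //.
    by rewrite addrK.
  - by move=> x xP; apply/idP/idP => [h|/KQ//]; apply/capP; rewrite preE.
rewrite (is_max_uniq (lQP j.+1) (ilen_add eP' (cP j))).
rewrite (is_max_uniq (lQP j) (ilen_add (kP j) eP)) !natrD.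
by rewrite opprD [e%:R + _]addrC -addrA [e%:R + _]addrC subrK.
Qed.

Definition accV V := forall Y : nat -> submodClosed V,
  (forall n, {subset Y n <= Y n.+1}) ->
  exists n0, forall n, (n0 <= n)%N -> {subset Y n <= Y n0}.

Lemma mono_subset V (Y : nat -> submodClosed V) :
  (forall n, {subset Y n <= Y n.+1}) -> forall m n, (m <= n)%N -> {subset Y m <= Y n}.
Proof.
move=> h m n /subnK <-; elim: (n - m)%N => // k IH x /IH; exact: h.
Qed.

(** * The Hilbert basis theorem *)

Section Plus.
Variables (V : lmodType A) (a : A) (s : seq A) (P : nat -> submodClosed V).

(** The terms of degree below [i] in the new variable, evaluated at [a]. The test guards the
    truncated subtraction [j - i']. *)
Fixpoint low i j : submodClosed V :=
  if i is i'.+1 then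
    if (i' <= j)%N then addS (low i' j) (im (scaleL V (a ^+ i')) (P (j - i')))
    else low i' j
  else zeroS V.

(* [plus j] is the sum of the [a^i P_(j-i)]: the image of the degree-[j] part
   of [P[x]] under [x |-> a]. *)
Definition plus j := low j.+1 j.

Hypothesis sP : sseq s P.

Lemma low_add i j p x : (i <= j)%N -> p \in P (j - i) -> x \in low i j ->
  x + a ^+ i *: p \in low i.+1 j.
Proof.
move=> ij pP xl; rewrite /= ij; apply/addSP; exists x, (a ^+ i *: p); split=> //.
by apply/imP; exists p.
Qed.

Lemma lowS i j : {subset low i j <= low i.+1 j}.
Proof. by move=> x xl /=; case: ifP => // _; apply: addSl. Qed.

Lemma low_a i j x : x \in low i j -> a *: x \in low i.+1 j.+1.
Proof.
elim: i x => [|i IH] x; first by move/zeroSP->; rewrite scaler0 rpred0.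
rewrite [low i.+1 j]/=; case: (leqP i j) => ij xl; last first.
  by apply/lowS/IH.
case/addSP: xl => y [_ [/IH yl /imP[p pP <-] ->]]; rewrite scalerDr.
by rewrite mklinE scalerA -exprS; apply: low_add => //.
Qed.

Lemma low_s i j b x : b \in s -> x \in low i j -> b *: x \in low i j.+1.
Proof.
move=> bs; elim: i x => [|i IH] x; first by move/zeroSP->; rewrite scaler0 rpred0.
rewrite [low i.+1 j]/=; case: (leqP i j) => ij xl; last first.
  by apply/lowS/IH.
case/addSP: xl => y [_ [/IH yl /imP[p pP <-] ->]]; rewrite scalerDr.
rewrite mklinE scalerA mulrC -scalerA; apply: low_add => //; first exact: leqW.
by rewrite subSn //; apply: sP.
Qed.

Lemma plus_sseq : sseq (a :: s) plus.
Proof.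
move=> b; rewrite inE => /orP[/eqP-> j x|bs j x xl]; first exact: low_a.
exact/lowS/low_s.
Qed.

Lemma plus0 : {subset P 0%N <= plus 0%N}.
Proof.
move=> x xP; rewrite -[x]add0r -[x]scale1r -(expr0 a); apply: low_add => //.
exact: rpred0.
Qed.

(** Leading coefficients in x-degree [i]. An element of [plus] does not determine a polynomial, so
    terms of lower degree are replaced by a congruence modulo [low i]. *)
Lemma lead_closed (Y : nat -> submodClosed V) i j : pclosed (fun p =>
  p \in P j /\ exists2 y, y \in Y (i + j)%N & a ^+ i *: p - y \in low i (i + j)).
Proof.
split; first by rewrite rpred0; split=> //; exists 0; rewrite ?rpred0 // scaler0 subr0 rpred0.
move=> b p q [pP [y yY hy]] [qP [z zY hz]]; split.
  by rewrite rpredD ?rpredZ.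
exists (b *: y + z); first by rewrite rpredD ?rpredZ.
rewrite scalerDr opprD addrACA rpredD // scalerA mulrC -scalerA -scalerBr.
by rewrite rpredZ.
Qed.
Definition lead Y i j := psub (lead_closed Y i j).

Lemma lead_sub Y i j : {subset lead Y i j <= P j}.
Proof. by move=> x /psubP[]. Qed.

Lemma lead_mono (Y Z : nat -> submodClosed V) i j :
  (forall j, {subset Y j <= Z j}) -> {subset lead Y i j <= lead Z i j}.
Proof.
by move=> YZ x /psubP[xP [y yY h]]; apply/psubP; split=> //; exists y => //; apply: YZ.
Qed.

Lemma lead_S Y i j : sseq (a :: s) Y -> {subset lead Y i j <= lead Y i.+1 j}.
Proof.
move=> sY x /psubP[xP [y yY h]]; apply/psubP; split=> //; exists (a *: y).
  by apply: sY; rewrite // inE eqxx.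
by rewrite exprS -scalerA -scalerBr; apply: low_a.
Qed.

Lemma lead_sseq Y i : sseq (a :: s) Y -> sseq s (lead Y i).
Proof.
move=> sY b bs j x /psubP[xP [y yY h]]; apply/psubP; split; first exact: sP.
exists (b *: y); first by rewrite addnS; apply: sY => //; rewrite inE bs orbT.
by rewrite scalerA mulrC -scalerA -scalerBr addnS; apply: low_s.
Qed.

(** Induction on the degree in x: an element of [Z] is corrected by an element of [Y] with the same
    leading coefficient, and the remainder has lower degree. *)
Lemma lead_eq (Y Z : nat -> submodClosed V) :
    (forall j, {subset Y j <= Z j}) -> (forall j, {subset Z j <= plus j}) ->
    (forall i j, {subset lead Z i j <= lead Y i j}) ->
  forall j, {subset Z j <= Y j}.
Proof.
move=> YZ ZP h.
suff H i j x : x \in low i j -> x \in Z j -> x \in Y j.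
  by move=> j x xZ; apply: (H j.+1) => //; apply: ZP.
elim: i x => [|i IH] x; first by move/zeroSP->; rewrite !rpred0.
rewrite [low _ _]/=; case: leqP => [ij|_]; last exact: IH.
case/addSP=> y [_ [yl /imP[p pP <-] ->]]; rewrite mklinE => xZ.
have ej : (i + (j - i))%N = j by rewrite subnKC.
have /h/psubP[_ [z zY]] : p \in lead Z i (j - i).
  apply/psubP; split=> //; exists (y + a ^+ i *: p); rewrite ej //.
  by rewrite opprD addrCA subrr addr0 -scaleN1r rpredZ.
rewrite ej in zY *; move=> zl.
rewrite -[y + _](subrK z); apply: rpredD => //; apply: IH.
  by rewrite -addrA; apply: rpredD.
by apply: submodB => //; apply: YZ.
Qed.

Lemma fin_stab (f : nat -> nat -> Prop) n0 :
  (forall i, exists m, forall n, (m <= n)%N -> f i n) ->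
  exists N, forall i n, (i < n0)%N -> (N <= n)%N -> f i n.
Proof.
move=> h; elim: n0 => [|k [N hN]]; first by exists 0%N.
have [m hm] := h k; exists (maxn N m) => i n; rewrite ltnS geq_max leq_eqVlt.
by move=> /orP[/eqP->|ik] /andP[Nn mn]; [apply: hm|apply: hN].
Qed.

Lemma hilbert_basis :
  gnoeth s (fun _ => zeroS V) P -> gnoeth (a :: s) (fun _ => zeroS V) plus.
Proof.
move=> nP Y sY bY mY.
have mono m n : (m <= n)%N -> forall j, {subset Y m j <= Y n j}.
  by move=> mn j; apply: (mono_subset (fun n => mY n j)).
have bL (Z : nat -> submodClosed V) i j :
    {subset zeroS V <= lead Z i j} /\ {subset lead Z i j <= P j}.
  by split=> x; [move/zeroSP->; rewrite rpred0|apply: lead_sub].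
(* The diagonal chain settles all x-degrees [i >= n0] at once; the degrees below [n0] give finitely
   many chains, handled by [fin_stab]. *)
have [n|n j||n0 hn0] := nP (fun n => lead (Y n) n).
- exact: lead_sseq.
- exact: bL.
- by move=> n j x xl; apply: lead_S => //; apply: lead_mono xl; apply: mY.
have [i|N hN] := @fin_stab (fun i n => forall m, (n <= m)%N -> forall j,
    {subset lead (Y m) i j <= lead (Y n) i j}) n0.
  have [n|n j|n j|m hm] := nP (fun n => lead (Y n) i).
  - exact: lead_sseq.
  - exact: bL.
  - by apply: lead_mono; apply: mY.
  exists m => n mn k nk j x /(hm k (leq_trans mn nk)).
  by apply: lead_mono; apply: mono.
exists (maxn N n0) => n hn; move: (hn); rewrite geq_max => /andP[Nn nn].
apply: lead_eq => [j|j|i j]; [exact: mono|exact: (bY n j).2|].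
case: (ltnP i n0) => [i0|i0]; first exact: hN (leq_maxl _ _) _ hn j.
have Lmono (Z : nat -> submodClosed V) k i' j' : sseq (a :: s) Z -> (k <= i')%N ->
    {subset lead Z k j' <= lead Z i' j'}.
  by move=> sZ; apply: (mono_subset (fun i => @lead_S Z i j' sZ)).
move=> x xl.
have {xl} : x \in lead (Y (maxn i n)) (maxn i n) j.
  apply: Lmono (leq_maxl i n) _ _; first exact: sY.
  by apply: lead_mono xl; apply: mono; apply: leq_maxr.
move/(hn0 _ (leq_trans i0 (leq_maxl i n)))/(Lmono _ _ _ _ (sY _) i0).
by apply: lead_mono; apply: mono; apply: leq_maxr.
Qed.

End Plus.

(** The Rees module: in degree [j], the sum of the w V for monomials w of degree [j] in [s].
    Adjoining one generator at a time makes [hilbert_basis] applicable. *)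
Fixpoint rees V s : nat -> submodClosed V :=
  if s is a :: s' then plus a (rees V s')
  else fun j => if j == 0%N then full V else zeroS V.

Lemma rees_sseq V s : sseq s (rees V s).
Proof. by elim: s => [|a s IH]; [move=> a|apply: plus_sseq]. Qed.

Lemma rees0 V s x : x \in rees V s 0%N.
Proof. by elim: s x => [|a s IH] x //; apply: plus0; apply: IH. Qed.

Lemma rees_noeth V s : accV V -> gnoeth s (fun _ => zeroS V) (rees V s).
Proof.
move=> acc; elim: s => [|a s IH]; last by apply: hilbert_basis => //; apply: rees_sseq.
move=> Y _ bY mY; have [n0 h] := acc (fun n => Y n 0%N) (fun n => mY n 0%N).
exists n0 => n nn [|j]; first exact: h.
by move=> x /(bY n j.+1).2 /zeroSP->; rewrite rpred0.
Qed.

Lemma gnoeth_sub V s (Q P P' Q' : nat -> submodClosed V) :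
  (forall j, {subset Q j <= Q' j}) -> (forall j, {subset P' j <= P j}) ->
  gnoeth s Q P -> gnoeth s Q' P'.
Proof.
move=> QQ PP h Y sY bY mY; apply: h => // n j; have [h1 h2] := bY n j.
by split=> x; [move/QQ/h1|move/h2/PP].
Qed.

End Graded.

(** * Homology modulo powers of an ideal *)

Section HomologyPolynomial.
Variables (A : comNzRingType) (N : lmodType A) (I : ideal A) (s : seq A).
Hypothesis sI : {subset s <= I}.
Hypothesis Is : forall (V : lmodType A) (x : V) (S : submodClosed V),
  (forall b, b \in s -> b *: x \in S) -> forall a, a \in I -> a *: x \in S.
Hypothesis accN : forall q, accV {ffun 'I_q -> N}.

Local Notation Ipow j := (iter j (@ideal_mul A I N) (full N)).

Lemma sgen_in (V : lmodType A) (P : set V) x : P x -> x \in submod_gen P.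
Proof. by move=> Px; apply/asboolP => S; apply. Qed.

Lemma Ipow_mul j a x : a \in I -> x \in Ipow j -> a *: x \in Ipow j.+1.
Proof. by move=> aI xI; rewrite iterS; apply: sgen_in; exists a, x. Qed.

Lemma Ipow_min j (S : submodClosed N) :
  (forall a x, a \in I -> x \in Ipow j -> a *: x \in S) -> {subset Ipow j.+1 <= S}.
Proof.
move=> h x; rewrite iterS => /asboolP; apply=> _ [a [y [aI yI ->]]]; exact: h.
Qed.

Lemma IpowS j : {subset Ipow j.+1 <= Ipow j}.
Proof. by apply: Ipow_min => a x _ xI; rewrite rpredZ. Qed.

Lemma Ipow_mins j (S : submodClosed N) :
  (forall a x, a \in s -> x \in Ipow j -> a *: x \in S) -> {subset Ipow j.+1 <= S}.
Proof. by move=> h; apply: Ipow_min => a x aI xI; apply: Is aI => b bs; apply: h. Qed.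

Lemma fin_add (V W : lmodType A) (f : {linear V -> W}) (Q P : submodClosed V) (S : submodClosed W) n :
    {subset Q <= P} -> (forall x, x \in Q -> f x \in S) -> ilen Q P n ->
  exists l, ilen S (addS S (im f P)) l.
Proof.
move=> QP QS lQP.
have [||//|l hl] := @ilen_within _ _ Q P (cap P (pre f S)) P n _ _ _ lQP.
- by move=> x xQ; apply/capP; rewrite preE; split; [apply: QP|apply: QS].
- by move=> x /capP[].
exists l; apply: (ilen_ext _ l).1 hl; apply: (@ilchain_lin _ _ _ f).
- by move=> x /capP[].
- exact: addSl.
- by move=> x xP; apply/addSr/imP; exists x.
- by move=> _ /addSP[q [_ [qQ /imP[y yP <-] ->]]]; exists y; rewrite // addrK.
- by move=> x xP; apply/idP/capP; rewrite preE // => -[].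
Qed.

(** The quotient of successive powers I^(j+1) N / I^(j+2) N is a finite sum of images of I^j N /
    I^(j+1) N under the generators of [I]. *)
Lemma Ipow_fin j : (exists l, ilen (Ipow 1) (full N) l) ->
  exists l, ilen (Ipow j) (full N) l.
Proof.
move=> h1.
suff [l hl] : exists l, ilen (Ipow j.+1) (full N) l.
  by apply: ilen_within hl => //; apply: IpowS.
elim: j => [//|j [l hl]].
have [l' hl'] : exists l, ilen (Ipow j.+1) (Ipow j) l.
  by apply: ilen_within hl => //; apply: IpowS.
(* The submodule [S] grows from I^(j+2) N by adding b I^j N for one generator [b] at a time, each
   addition having finite length by [fin_add]. *)
have H (t : seq A) : {subset t <= I} -> exists S : submodClosed N, exists l,
    [/\ {subset Ipow j.+2 <= S}, ilen (Ipow j.+2) S l &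
    forall b x, b \in t -> x \in Ipow j -> b *: x \in S].
  elim: t => [_|b t IH bt].
    exists (Ipow j.+2), 0%N; split=> //; split; first exact: ilchain0.
    by move=> l0 [c [cs cb]]; case: l0 cs cb => // l0 cs cb;
      have [_ [x xc /negP[]]] := cs 0%N (ltn0Sn _); apply: (cb 0%N (leq0n _)).1;
      apply: (cb 1%N (ltn0Sn _)).2.
  have [|S [m [IS lS hS]]] := IH; first by move=> c ct; apply: bt; rewrite inE ct orbT.
  have bI : b \in I by apply: bt; rewrite inE eqxx.
  have [|m' hm'] := @fin_add _ _ (scaleL N b) _ _ S _ (@IpowS j) _ hl'.
    by move=> x xI; apply/IS/Ipow_mul.
  exists (addS S (im (scaleL N b) (Ipow j))), (m + m')%N; split.
  - by move=> x /IS; apply: addSl.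
  - exact: ilen_add lS hm'.
  move=> c x; rewrite inE => /orP[/eqP-> xI|ct xI]; last exact/addSl/hS.
  by apply/addSr/imP; exists x.
have [S [m [IS lS hS]]] := H s sI.
have [//|||m' hm'] := @ilen_within _ _ _ _ (Ipow j.+2) (Ipow j.+1) m _ _ _ lS.
- exact: IpowS.
- exact: Ipow_mins.
by exists (m' + l)%N; apply: ilen_add hm' hl.
Qed.

Lemma G_closed q j : pclosed (fun x : {ffun 'I_q -> N} => forall i, x i \in Ipow j).
Proof.
split=> [i|a x y hx hy i]; first by rewrite ffunE rpred0.
by rewrite !ffunE rpredD // rpredZ.
Qed.
Definition Gj q j := psub (@G_closed q j).

Lemma GjP q j (x : {ffun 'I_q -> N}) : reflect (forall i, x i \in Ipow j) (x \in Gj q j).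
Proof. exact: psubP. Qed.

Definition ev q (i : 'I_q) : {linear {ffun 'I_q -> N} -> N} :=
  mklin ((fun a x y => etrans (ffunE _ _) (congr1 (+%R^~ (y i)) (ffunE _ _)))
    : linear (fun x : {ffun 'I_q -> N} => x i)).

Definition delta q (i : 'I_q) (x : N) : {ffun 'I_q -> N} :=
  [ffun k => if k == i then x else 0].

Lemma delta_linear q (i : 'I_q) : linear (@delta q i).
Proof.
by move=> a x y; apply/ffunP => k; rewrite !ffunE; case: eqP; rewrite ?scaler0 ?addr0.
Qed.

Lemma delta_sum q (x : {ffun 'I_q -> N}) : x = \sum_i delta i (x i).
Proof.
apply/ffunP => k; rewrite sum_ffunE (bigD1 k) //= ffunE eqxx big1 ?addr0 // => i ik.
by rewrite ffunE eq_sym (negPf ik).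
Qed.

(** Filter by the number of coordinates required to lie in I^j N; each step contributes one copy of
    N / I^j N. *)
Lemma Gj_fin q j : (exists l, ilen (Ipow 1) (full N) l) ->
  exists l, ilen (Gj q j) (full _) l.
Proof.
move=> /(Ipow_fin j)[n hn].
have pc k : pclosed (fun x : {ffun 'I_q -> N} => forall i : 'I_q, (i < k)%N -> x i \in Ipow j).
  split=> [i ik|a x y hx hy i ik]; first by rewrite ffunE rpred0.
  by rewrite !ffunE rpredD // ?rpredZ ?hx ?hy.
have H k : (k <= q)%N -> exists l, ilen (psub (pc k)) (full _) l.
  elim: k => [_|k IH kq].
    exists 0%N; split; first by apply: ilchain0.
    move=> [|l0] // [c [cs cb]]; have [_ [x xc /negP[]]] := cs 0%N (ltn0Sn _).
    by apply: (cb 0%N (leq0n _)).1; apply/psubP.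
  have [l hl] := IH (ltnW kq); exists (n + l)%N; apply: ilen_add hl.
  apply: (ilen_ext _ n).2 hn; apply: (@ilchain_lin _ _ _ (ev (Ordinal kq))) => //.
  - by move=> x /psubP h; apply/psubP => i ik; apply/h/ltnW.
  - move=> y _; exists (delta (Ordinal kq) y); last by rewrite mklinE ffunE eqxx subrr rpred0.
    apply/psubP => i ik; rewrite ffunE; case: eqP => [e|_]; last exact: rpred0.
    by rewrite e ltnn in ik.
  move=> x /psubP h; rewrite mklinE; apply/idP/psubP => [xk i|]; last by apply.
  rewrite ltnS leq_eqVlt => /orP[/eqP ik|]; last exact: h.
  by have -> : i = Ordinal kq by apply: val_inj.
have [l hl] := H q (leqnn q); exists l; apply: (ilen_ext _ l).1 hl.
by apply: ilchain_eq => // x; apply/psubP/GjP => h i; [apply: h|move=> _; apply: h].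
Qed.

Lemma Gj_sseq q : sseq s (Gj q).
Proof.
move=> a aS j x /GjP h; apply/GjP => i; rewrite ffunE.
exact: Ipow_mul (sI aS) (h i).
Qed.

Lemma Gj_rees q j : {subset Gj q j <= rees _ s j}.
Proof.
have H i x : x \in Ipow j -> @delta q i x \in rees _ s j.
  elim: j x => [|j IH] x xI; first exact: rees0.
  have : x \in pre (mklin (@delta_linear q i)) (rees _ s j.+1).
    apply: Ipow_mins xI => a y aS yI; rewrite preE linearZ.
    exact: (rees_sseq aS (IH _ yI)).
  by rewrite preE.
by move=> x /GjP h; rewrite [x]delta_sum; apply: rpred_sum => i _; apply: H.
Qed.

Lemma Gj_noeth q : gnoeth s (fun _ => zeroS _) (Gj q).
Proof. apply: (gnoeth_sub _ _ (@rees_noeth _ _ s (@accN q))) => [j|j x xG]; [by []|exact: Gj_rees].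
Qed.

Variables (p q r : nat) (D1 : 'M[A]_(p, q)) (D0 : 'M[A]_(q, r)).

Lemma mx_act_mul (L : lmodType A) (x : {ffun 'I_p -> L}) :
  mx_act D0 (mx_act D1 x) = mx_act (D1 *m D0) x.
Proof.
apply/ffunP => k; rewrite !ffunE.
under eq_bigr => j _ do rewrite ffunE scaler_sumr.
rewrite exchange_big; apply: eq_bigr => i _ /=; rewrite mxE scaler_suml.
by apply: eq_bigr => j _; rewrite scalerA mulrC.
Qed.

Hypothesis D10 : D1 *m D0 = 0.
Hypothesis finN : exists l, ilen (Ipow 1) (full N) l.

Local Notation d1 := (@mx_act _ _ _ D1 N : {linear _ -> _}).
Local Notation d0 := (@mx_act _ _ _ D0 N : {linear _ -> _}).

Lemma mx_act0 (L : lmodType A) (x : {ffun 'I_p -> L}) : mx_act D0 (mx_act D1 x) = 0.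
Proof.
rewrite mx_act_mul D10; apply/ffunP => k; rewrite !ffunE big1 // => i _.
by rewrite mxE scale0r.
Qed.

(** [B j] and [Z j] are the preimages in N^q of the boundaries and the cycles of the complex modulo
    I^j. *)
Let B j := addS (im d1 (full _)) (Gj q j).
Let Z j := pre d0 (Gj r j).

Lemma mx_act_Gj a b (D : 'M[A]_(a, b)) j x : x \in Gj a j -> mx_act D x \in Gj b j.
Proof.
move=> /GjP h; apply/GjP => k; rewrite ffunE; apply: rpred_sum => i _.
by rewrite rpredZ.
Qed.

Lemma BZ j : {subset B j <= Z j}.
Proof.
move=> x /addSP[_ [y [/imP[u _ <-] yG ->]]]; rewrite preE linearD /=.
by rewrite mx_act0 add0r; apply: mx_act_Gj.
Qed.

Lemma GjS a j : {subset Gj a j.+1 <= Gj a j}.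
Proof. by move=> x /GjP h; apply/GjP => i; apply/IpowS/h. Qed.

Lemma BS j : {subset B j.+1 <= B j}.
Proof.
by move=> x /addSP[u [y [uB yG ->]]]; apply/addSP; exists u, y; split=> //; apply: GjS.
Qed.

Lemma ZS j : {subset Z j.+1 <= Z j}.
Proof. by move=> x; rewrite !preE; apply: GjS. Qed.

Lemma B_sseq : sseq s B.
Proof.
move=> a aS j x /addSP[u [y [uB yG ->]]]; apply/addSP; exists (a *: u), (a *: y).
by rewrite rpredZ // scalerDr; split=> //; apply: Gj_sseq.
Qed.

Lemma Z_sseq : sseq s Z.
Proof. by move=> a aS j x; rewrite !preE linearZ => h; apply: Gj_sseq. Qed.

(** A submodule between [B j.+1] and [B j] contains the image of [d1], hence is determined by its
    intersection with I^j N^q. *)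
Lemma B_noeth : gnoeth s (fun j => B j.+1) B.
Proof.
move=> Y sY bY mY.
have [n a aS j x|n j|n j|n0 h] := @Gj_noeth q (fun n j => cap (Y n j) (Gj q j)).
- by case/capP=> xY xG; apply/capP; split; [apply: sY|apply: Gj_sseq].
- by split=> x; [move/zeroSP->; rewrite rpred0|case/capP].
- by move=> x /capP[xY xG]; apply/capP; split=> //; apply: mY.
exists n0 => n nn j x xY.
have /addSP[u [y [uB yG e]]] := (bY n j).2 x xY.
have uY m : u \in Y m j by apply: (bY m j).1; apply: addSl.
have /(h n nn)/capP[yY _] : y \in cap (Y n j) (Gj q j).
  by apply/capP; split=> //; rewrite -[y](addKr u) -e addrC submodB.
by rewrite e rpredD ?uY.
Qed.

(** A submodule between [Z j.+1] and [Z j] contains the kernel of [d0], hence is determined by its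
    image in I^j N^r. *)
Lemma Z_noeth : gnoeth s (fun j => Z j.+1) Z.
Proof.
move=> Y sY bY mY.
have [n a aS j x|n j|n j|n0 h] := @Gj_noeth r (fun n j => im d0 (Y n j)).
- by case/imP=> y yY <-; apply/imP; exists (a *: y); [apply: sY|rewrite linearZ].
- split=> x; first by move/zeroSP->; rewrite rpred0.
  by case/imP=> y /(bY n j).2; rewrite preE => yG <-.
- by move=> x /imP[y yY <-]; apply/imP; exists y => //; apply: mY.
exists n0 => n nn j x xY.
have /(h n nn)/imP[y yY e] : d0 x \in im d0 (Y n j) by apply/imP; exists x.
rewrite -(subrK y x) rpredD //; apply: (bY n0 j).1.
by rewrite preE linearB e subrr rpred0.
Qed.

Lemma homology_quo_ilchain j l :
  (exists c : nat -> submodClosed (homology (@mx_act _ _ _ D1 (quo_pow I j N))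
                                      (@mx_act _ _ _ D0 (quo_pow I j N))),
     strict_chain l (fun i => c i : {pred _})) <-> ilchain (B j) (Z j) l.
Proof.
have L0 := @mx_act0 (quo_pow I j N).
rewrite (homology_ilchain L0); apply: iff_sym.
have pl k : linear (fun x : {ffun 'I_k -> N} =>
    [ffun i => qlin (Ipow j) (x i)] : {ffun 'I_k -> quo_pow I j N}).
  by move=> a x y; apply/ffunP => i; rewrite !ffunE linearP.
pose pi k := mklin (pl k).
have pi_act a b (D : 'M[A]_(a, b)) x : mx_act D (pi a x) = pi b (mx_act D x).
  apply/ffunP => i; rewrite !ffunE linear_sum; apply: eq_bigr => k _.
  by rewrite ffunE linearZ.
have pi_surj k : onto (pi k).
  move=> y; have h i := qlin_surj (y i).
  exists [ffun i => sval (cid (h i))]; apply/ffunP => i; rewrite !ffunE.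
  exact: (svalP (cid (h i))).
have pi0 k x : (pi k x = 0) <-> x \in Gj k j.
  split=> [/ffunP e|/GjP h]; last by apply/ffunP => i; rewrite !ffunE; exact/qlin0/h.
  by apply/GjP => i; apply/qlin0; have := e i; rewrite !ffunE.
apply: (@ilchain_lin _ _ _ (pi q)).
- exact: BZ.
- move=> _ /imP[x _ <-]; apply/kerP; exact: L0.
- move=> x; rewrite preE => h; apply/kerP.
  by rewrite [LHS]pi_act; apply/pi0.
- move=> y /kerP y0; have [x e] := pi_surj _ y; exists x; last by rewrite e subrr rpred0.
  by rewrite preE; apply/pi0; rewrite -pi_act e.
move=> x xZ; apply/imP/addSP.
  case=> u _; have [v <-] := pi_surj _ u => e0.
  have e : pi q (d1 v) = pi q x := etrans (esym (pi_act _ _ D1 v)) e0.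
  exists (d1 v), (x - d1 v); split; first by apply/imP; exists v.
    by apply/pi0; rewrite linearB e subrr.
  by rewrite addrC subrK.
case=> _ [y [/imP[u _ <-] /pi0 y0 ->]]; exists (pi p u) => //.
by rewrite linearD y0 addr0; apply: pi_act.
Qed.

(** Hilbert-Serre applies not to Z_j/B_j but to the graded pieces B_j/B_(j+1) and Z_j/Z_(j+1).
    Measuring Z_j/B_(j+1) in two ways shows that the difference of their lengths is the increment of
    the length of Z_j/B_j. *)
Lemma homology_evp : exists l : nat -> nat,
  (forall j, has_length (homology (@mx_act _ _ _ D1 (quo_pow I j N))
                                  (@mx_act _ _ _ D0 (quo_pow I j N))) (l j)) /\
  evp (fun j => (l j)%:R).
Proof.
have GB j : {subset Gj q j <= B j} by move=> x; apply: addSr.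
have h1 j : exists l, ilen (B j) (Z j) l.
  have [n hn] := Gj_fin q j finN.
  by apply: ilen_within hn => // x; apply: BZ.
have h2 j : exists l, ilen (B j.+1) (B j) l.
  have [n hn] := Gj_fin q j.+1 finN.
  by apply: ilen_within hn => // x; apply: BS.
have h3 j : exists l, ilen (Z j.+1) (Z j) l.
  have [n hn] := Gj_fin q j.+1 finN.
  by apply: ilen_within hn => // x; [move=> /GB/BZ|apply: ZS].
pose l j := sval (cid (h1 j)); pose b j := sval (cid (h2 j)); pose z j := sval (cid (h3 j)).
have lP j : ilen (B j) (Z j) (l j) := svalP (cid (h1 j)).
have bP j : ilen (B j.+1) (B j) (b j) := svalP (cid (h2 j)).
have zP j : ilen (Z j.+1) (Z j) (z j) := svalP (cid (h3 j)).
exists l; split=> [j|]; first by apply: is_max_ext (lP j) => n; rewrite homology_quo_ilchain.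
have sBS : sseq s (fun j => B j.+1) by move=> a aS j; apply: B_sseq.
have sZS : sseq s (fun j => Z j.+1) by move=> a aS j; apply: Z_sseq.
have eb := hilbert_serre sBS B_sseq B_noeth bP.
have ez := hilbert_serre sZS Z_sseq Z_noeth zP.
apply/evp_antidiff/(evp_ext _ (evp_add eb (evp_opp ez))) => j.
have := is_max_uniq (ilen_add (bP j) (lP j)) (ilen_add (lP j.+1) (zP j)).
move/(congr1 (fun n : nat => n%:R : rat)); rewrite !natrD => e.
have -> : (b j)%:R = (l j.+1)%:R + (z j)%:R - (l j)%:R :> rat by rewrite -e addrK.
by rewrite addrAC addrK.
Qed.

End HomologyPolynomial.

(** * Short exact sequences and finite generation *)

Section Sequences.
Variable A : comNzRingType.
Implicit Types U V W X Y : lmodType A.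

Definition iso U V := exists f : {linear U -> V}, injective f /\ onto f.

Lemma iso_refl U : iso U U.
Proof.
have idP : linear (fun x : U => x) by [].
by exists (mklin idP); split=> // x; exists x.
Qed.

Lemma iso_inv U V (f : {linear U -> V}) : injective f -> onto f ->
  exists g : {linear V -> U}, cancel f g /\ cancel g f.
Proof.
move=> fi fs; have idP : linear (fun x : V => x) by [].
have [y|g gP] := @factor_inj _ _ _ _ f (mklin idP) fi; first exact: fs.
by exists g; split=> // x; apply: fi; rewrite gP.
Qed.

Lemma iso_sym U V : iso U V -> iso V U.
Proof.
move=> [f [fi fs]]; have [g [gf fg]] := iso_inv fi fs; exists g.
by split=> [|x]; [apply: can_inj fg|exists (f x)].
Qed.

Lemma iso_trans V U W : iso U V -> iso V W -> iso U W.
Proof.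
move=> [f [fi fs]] [g [gi gs]]; exists (g \o f)%FUN; split; first exact: inj_comp.
by move=> z; have [y <-] := gs z; have [x <-] := fs y; exists x.
Qed.

Section Products.
Variables U V W : lmodType A.

Lemma fst_linear : linear (fun x : (U * V)%type => x.1). Proof. by []. Qed.
Definition fstL : {linear (U * V)%type -> U} := mklin fst_linear.
Lemma snd_linear : linear (fun x : (U * V)%type => x.2). Proof. by []. Qed.
Definition sndL : {linear (U * V)%type -> V} := mklin snd_linear.

Lemma pair_linear (f : {linear W -> U}) (g : {linear W -> V}) :
  linear (fun x => (f x, g x)).
Proof. by move=> a x y; rewrite !linearP. Qed.
Definition pairL f g : {linear W -> (U * V)%type} := mklin (pair_linear f g).

Lemma copair_linear (f : {linear U -> W}) (g : {linear V -> W}) :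
  linear (fun x : (U * V)%type => f x.1 + g x.2).
Proof. by move=> a x y; rewrite !linearP scalerDr addrACA. Qed.
Definition copairL f g : {linear (U * V)%type -> W} := mklin (copair_linear f g).

End Products.

Lemma id_linear U : linear (fun x : U => x). Proof. by []. Qed.
Definition idL U : {linear U -> U} := mklin (@id_linear U).
Definition zeroL U V : {linear U -> V} := \0.

Definition inlL U V : {linear U -> (U * V)%type} := pairL (idL U) (zeroL U V).
Definition inrL U V : {linear V -> (U * V)%type} := pairL (zeroL V U) (idL V).

Lemma iso_prod U V U' V' : iso U U' -> iso V V' -> iso (U * V)%type (U' * V')%type.
Proof.
move=> [f [fi fs]] [g [gi gs]].
exists (pairL (f \o fstL U V)%FUN (g \o sndL U V)%FUN); split.
  by move=> [x y] [x' y'] [/fi-> /gi->].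
by move=> [x y]; have [x' <-] := fs x; have [y' <-] := gs y; exists (x', y').
Qed.

Lemma iso_prodA U V W : iso (U * V * W)%type (U * (V * W))%type.
Proof.
exists (pairL (fstL U V \o fstL _ W)%FUN (pairL (sndL U V \o fstL _ W)%FUN (sndL _ W))).
split; first by move=> [[x y] z] [[x' y'] z'] [-> -> ->].
by move=> [x [y z]]; exists (x, y, z).
Qed.

Lemma iso_prodC U V : iso (U * V)%type (V * U)%type.
Proof.
exists (pairL (sndL U V) (fstL U V)); split; first by move=> [x y] [x' y'] [-> ->].
by move=> [x y]; exists (y, x).
Qed.

Definition ses U V W (f : {linear U -> V}) (g : {linear V -> W}) :=
  [/\ injective f, onto g & exact_at f g].

Lemma ses0 U V W (f : {linear U -> V}) (g : {linear V -> W}) x : ses f g -> g (f x) = 0.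
Proof. by case=> _ _ e; apply/e; exists x. Qed.

Lemma ses_iso_r U V W W' (f : {linear U -> V}) (g : {linear V -> W}) (h : {linear W -> W'}) :
  ses f g -> injective h -> onto h -> ses f (h \o g)%FUN.
Proof.
move=> [fi gs e] hi hs; split=> //.
  by move=> y; have [x <-] := hs y; have [z <-] := gs x; exists z.
move=> y; split=> [/= hg|[x <-] /=]; last by rewrite (ses0 x (And3 fi gs e)) linear0.
by apply/e/hi; rewrite hg linear0.
Qed.

Lemma sval_inj V (S : submodClosed V) : injective (sval_lin S).
Proof. by move=> x y e; apply: val_inj. Qed.

Lemma ses_ker U V (f : {linear U -> V}) : onto f -> ses (sval_lin (ker f)) f.
Proof.
move=> fs; split=> //.
move=> y; split=> [/kerP h|[x <-]]; first by exists (Sub y h).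
by apply/kerP; apply: (valP x).
Qed.

Lemma ses_quo V (S : submodClosed V) : ses (sval_lin S) (qlin S).
Proof.
split; [exact: sval_inj|exact: qlin_surj|].
move=> y; split=> [/qlin0 h|[x <-]]; first by exists (Sub y h).
by apply/qlin0; apply: (valP x).
Qed.

Definition fgen V := exists n (f : {linear 'rV[A]_n -> V}), onto f.

Lemma fgen_onto V W (f : {linear V -> W}) : onto f -> fgen V -> fgen W.
Proof.
move=> fs [n [p ps]]; exists n, (f \o p)%FUN => y.
by have [x <-] := fs y; have [v <-] := ps x; exists v.
Qed.

Lemma fgen_iso V W : iso V W -> fgen V -> fgen W.
Proof. by move=> [f [_ fs]]; apply: fgen_onto fs. Qed.

Lemma fgen_rV n : fgen 'rV[A]_n.
Proof. by exists n, (idL _) => x; exists x. Qed.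

Lemma fgen_fam (T : finType) V (e : T -> V) :
  (forall x, exists c : T -> A, x = \sum_t c t *: e t) -> fgen V.
Proof.
move=> h; exists #|T|, (row_map (fun j => e (enum_val j))) => x.
have [c ->] := h x; exists (\row_j c (enum_val j)).
rewrite mklinE /row_comb (reindex _ (onW_bij _ (enum_val_bij T))) /=.
by apply: eq_bigr => j _; rewrite mxE.
Qed.

Lemma fin_genP V : fin_gen V <-> fgen V.
Proof.
split=> [[n [e he]]|[n [f fs]]]; first exact: fgen_fam he.
exists n, (fun j => f (delta_mx ord0 j)) => x; have [v <-] := fs x.
by exists (v ord0); apply: row_mapE.
Qed.

Lemma row_split a b : iso 'rV[A]_(a + b) ('rV[A]_a * 'rV[A]_b)%type.
Proof.
have lP : linear (@lsubmx A 1 a b) by move=> c x y; apply/matrixP => i j; rewrite !mxE.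
have rP : linear (@rsubmx A 1 a b) by move=> c x y; apply/matrixP => i j; rewrite !mxE.
exists (pairL (mklin lP) (mklin rP)); split.
  by move=> x y [hl hr]; rewrite -(hsubmxK x) -(hsubmxK y) hl hr.
by move=> [x y]; exists (row_mx x y); congr pair; rewrite /= ?row_mxKl ?row_mxKr.
Qed.

Lemma fgen_prod V W : fgen V -> fgen W -> fgen (V * W)%type.
Proof.
move=> [a [p ps]] [b [q qs]]; have [h [_ hs]] := row_split a b.
exists (a + b)%N, (pairL (p \o fstL _ _)%FUN (q \o sndL _ _)%FUN \o h)%FUN.
move=> [x y]; have [u eu] := ps x; have [v ev] := qs y.
by have [w ew] := hs (u, v); exists w; rewrite /= ew /= eu ev.
Qed.

Lemma fgen_ext U V W (f : {linear U -> V}) (g : {linear V -> W}) :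
  ses f g -> fgen U -> fgen W -> fgen V.
Proof.
move=> [fi gs e] fU [b [q qs]]; have [w|q' hq] := row_lift (p := g) (f := q); first exact: gs.
apply: (@fgen_onto (U * 'rV[A]_b)%type _ (copairL f q')); last exact/fgen_prod/fgen_rV.
move=> y; have [v ev] := qs (g y).
have /e[x ex] : g (y - q' v) = 0 by rewrite linearB hq ev subrr.
by exists (x, v); rewrite mklinE /= ex subrK.
Qed.

Definition nmod V := forall S : submodClosed V, fgen (smod S).

Lemma nmod_onto V W (f : {linear V -> W}) : onto f -> nmod V -> nmod W.
Proof.
move=> fs nV S;
  have [x|g hg] := @factor_inj _ _ _ _ (sval_lin S) (f \o sval_lin (pre f S))%FUN (@sval_inj _ _).
  by have := valP x; rewrite preE => xS; exists (Sub (f (val x)) xS).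
apply: (@fgen_onto _ _ g) (nV (pre f S)) => y.
have [x ex] := fs (val y); have xS : x \in pre f S by rewrite preE ex; apply: (valP y).
by exists (Sub x xS); apply: val_inj; rewrite [LHS]hg.
Qed.

Lemma nmod_ext U V W (f : {linear U -> V}) (g : {linear V -> W}) :
  ses f g -> nmod U -> nmod W -> nmod V.
Proof.
move=> [fi gs e] nU nW S.
have [x|f' hf'] := @factor_inj _ _ _ _ (sval_lin S) (f \o sval_lin (pre f S))%FUN (@sval_inj _ _).
  by have := valP x; rewrite preE => xS; exists (Sub (f (val x)) xS).
have [x|g' hg'] := @factor_inj _ _ _ _ (sval_lin (im g S)) (g \o sval_lin S)%FUN (@sval_inj _ _).
  have gx : g (val x) \in im g S by apply/imP; exists (val x) => //; apply: (valP x).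
  by exists (Sub (g (val x)) gx).
apply: (@fgen_ext _ _ _ f' g') (nU _) (nW _); split.
- by move=> x y exy; apply/val_inj/fi; have := hf' x; rewrite exy hf' => /= ->.
- move=> y; have /imP[x xS ex] := valP y; exists (Sub x xS).
  by apply: val_inj; rewrite [LHS]hg' -ex.
move=> y; split.
  move=> gy; have /e[x ex] : g (val y) = 0 by have /= <- := hg' y; rewrite gy.
  have xS : x \in pre f S by rewrite preE ex; apply: (valP y).
  by exists (Sub x xS); apply: val_inj; rewrite [LHS]hf' /= ex.
move=> [x <-]; apply: val_inj; rewrite [LHS]hg' /=.
by have /= -> := hf' x; apply/e; exists (val x).
Qed.

Hypothesis noeA : noetherian A.

Lemma nmod_rV n : nmod 'rV[A]_n.
Proof.
elim: n => [|n IH].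
  move=> S; exists 0%N, (zeroL _ _) => y; exists 0; apply: val_inj.
  by apply/matrixP => i [].
have nA : nmod A^o by move=> S; apply/fin_genP/noeA.
have cP : linear (fun v : 'rV[A]_n.+1 => v ord0 ord0 : A^o) by move=> a x y; rewrite !mxE.
have rP : linear (fun v : 'rV[A]_n => row_mx (0 : 'M_(1, 1)) v : 'rV[A]_(1 + n)).
  by move=> a x y; rewrite scale_row_mx add_row_mx scaler0 addr0.
apply: (@nmod_ext _ _ _ (mklin rP) (mklin cP)) => //; split.
- by move=> x y /eq_row_mx[].
- by move=> a; exists (\row_j a); rewrite mklinE mxE.
move=> y; split=> [y0|[x <-]].
  exists (rsubmx (y : 'rV_(1 + n))); rewrite mklinE -[RHS](@hsubmxK _ 1 1 n); congr row_mx.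
  by apply/matrixP => i j; rewrite !mxE !ord1 -[LHS]y0; congr (y _ _); apply: val_inj.
have e : ord0 = lshift n (ord0 : 'I_1) by apply: val_inj.
rewrite mklinE -[LHS]/((row_mx 0 x : 'rV_(1 + n)) ord0 ord0).
by rewrite [X in _ ord0 X]e row_mxEl mxE.
Qed.

Lemma fgen_nmod V : fgen V -> nmod V.
Proof. by move=> [n [f fs]]; apply: nmod_onto fs (@nmod_rV n). Qed.

Lemma fgen_sub U V (f : {linear U -> V}) : injective f -> fgen V -> fgen U.
Proof.
move=> fi /fgen_nmod/(_ (im f (full U))).
have [x|g hg] := @factor_inj _ _ _ _ f (sval_lin (im f (full U))) fi.
  by have /imP[y _ e] := valP x; exists y.
apply: (@fgen_onto _ _ g) => x.
have xi : f x \in im f (full U) by apply/imP; exists x.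
by exists (Sub (f x) xi); apply: fi; rewrite hg.
Qed.

Lemma fgen_accV V : fgen V -> accV V.
Proof.
move=> /fgen_nmod nV Y mY.
have UC : pclosed (fun x => exists n, x \in Y n).
  split=> [|a x y [n xn] [k yk]]; first by exists 0%N; rewrite rpred0.
  exists (maxn n k); rewrite rpredD ?rpredZ //.
    exact: mono_subset mY _ _ (leq_maxl n k) _ xn.
  exact: mono_subset mY _ _ (leq_maxr n k) _ yk.
have [k [f fs]] := nV (psub UC).
have [n0 hn0] : exists n0, forall j, val (f (delta_mx ord0 j)) \in Y n0.
  have [|N hN] := @fin_stab (fun i n => forall j : 'I_k, val j = i ->
    val (f (delta_mx ord0 j)) \in Y n) k; last first.
    by exists N => j; apply: (hN _ N (ltn_ord j)).
  move=> i; case: (ltnP i k) => ik; last first.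
    by exists 0%N => n _ j ji; have := ltn_ord j; rewrite ji ltnNge ik.
  have /psubP[n hn] := valP (f (delta_mx ord0 (Ordinal ik))).
  exists n => m nm j ji; have -> : j = Ordinal ik by apply: val_inj.
  exact: mono_subset mY _ _ nm _ hn.
exists n0 => n _ x xn; have xU : x \in psub UC by apply/psubP; exists n.
have [v ev] := fs (Sub x xU); have -> : x = val (f v) by rewrite ev.
rewrite row_mapE -[val _]/(sval_lin (psub UC) _) linear_sum; apply: rpred_sum => j _.
by rewrite linearZ; apply: rpredZ; exact: hn0.
Qed.

Lemma fgen_ffun q V : fgen V -> fgen {ffun 'I_q -> V}.
Proof.
move=> [n [p ps]].
apply: (@fgen_fam ('I_q * 'I_n)%type _ (fun t => delta t.1 (p (delta_mx ord0 t.2)))) => x.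
pose v i := sval (cid (ps (x i))).
have vP i : p (v i) = x i := svalP (cid (ps (x i))).
exists (fun t => v t.1 ord0 t.2);
  rewrite -(pair_bigA _ (fun i j => v i ord0 j *: delta i (p (delta_mx ord0 j)))) /=.
rewrite {1}[x]delta_sum; apply: eq_bigr => i _.
rewrite -vP row_mapE -[delta i _]/(mklin (@delta_linear A V q i) _) linear_sum.
by apply: eq_bigr => j _; rewrite linearZ.
Qed.

(** * Minimal covers over a local ring *)

Section Local.
Variable m : ideal A.
Hypothesis lm : is_local m.

Lemma local_unit a : a \notin m -> exists b, b * a = 1.
Proof.
move=> am; have pc : pclosed (fun x : A^o => exists b : A, x = b * a).
  split=> [|c _ _ [b ->] [b' ->]]; first by exists 0; rewrite mul0r.
  by exists (c * b + b'); rewrite mulrDl -mulrA.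
case: (boolP (1 \in psub pc)) => [/psubP[b e]|n1]; first by exists b.
case/negP: am; apply: (lm.2 _ n1 a).
by apply/psubP; exists 1; rewrite mul1r.
Qed.

Lemma min_coverP V : fgen V -> is_min_cover m (min_cover m V).
Proof.
move=> fV; rewrite /min_cover; case: pselect => [h|[]]; first exact: svalP (cid h).
have ex : exists n, `[< exists f : {linear 'rV[A]_n -> V}, onto f >].
  by have [n h] := fV; exists n; apply/asboolP.
case: (ex_minnP ex) => n /asboolP[f fs] hn.
exists (existT _ n f); split=> // v /= fv j; apply: contrapT => /negP vj.
have [b bv] := local_unit vj.
case: n f fs hn v fv j vj bv => [|n] f fs hn v fv j vj bv; first by case: j vj bv.
suff : (n.+1 <= n)%N by rewrite ltnn.
apply: hn; apply/asboolP; exists (row_map (fun k => f (delta_mx ord0 (lift j k)))) => y.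
have [w ew] := fs y; pose w' := w - (w ord0 j * b) *: v.
have w'j : w' ord0 j = 0 by rewrite !mxE -mulrA bv mulr1 subrr.
have fw' : f w' = y by rewrite linearB linM fv scaler0 subr0.
exists (\row_k w' ord0 (lift j k)); rewrite -fw' [RHS]row_mapE (bigD1_ord j) //= w'j scale0r add0r.
by apply: eq_bigr => k _; rewrite mxE.
Qed.

Lemma cover_ses V : fgen V -> ses (sval_lin (ker (Defs.cover m V))) (Defs.cover m V).
Proof. by move=> fV; apply: ses_ker => x; apply: (min_coverP fV).1. Qed.

Lemma fgen_syz V : fgen V -> fgen (syz m V).
Proof. by move=> fV; apply: fgen_nmod; apply: fgen_rV. Qed.

(** In a minimal cover, divisibility by [y] puts e_0 - y w into the kernel, so its coordinate 1 - y
    w_0 would lie in [m]. *)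
Lemma nakayama V y : fgen V -> y \in m -> (forall x : V, exists z, x = y *: z) ->
  forall x : V, x = 0.
Proof.
move=> fV ym h x; have [cs ck] := min_coverP fV.
case: (min_cover m V) cs ck => n c /= cs ck.
have [v <-] := cs x; case: n c cs ck v => [|n] c cs ck v.
  suff -> : v = 0 by rewrite linear0.
  by apply/matrixP => i [].
have [z ez] := h (c (delta_mx ord0 ord0)); have [w ew] := cs z.
have e0 : c (delta_mx ord0 ord0 - y *: w) = 0 by rewrite linearB linM ew -ez subrr.
have := ck _ e0 ord0.
rewrite !mxE !eqxx /= => h1; case/negP: lm.1.
by rewrite -[1](subrK (y * w ord0 ord0)) rpredD // mulrC rpredZ.
Qed.

End Local.

End Sequences.

(** * Stable equivalence and duality *)

Section Stable.
Variable A : comNzRingType.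
Implicit Types F G K L U V W X Y Z : lmodType A.

Definition mksmod V (S : submodClosed V) x (xS : x \in S) : smod S :=
  exist (fun x => x \in S) x xS.

Definition isfree F := exists n, iso F 'rV[A]_n.

Lemma free_rV n : isfree 'rV[A]_n. Proof. by exists n; apply: iso_refl. Qed.

Lemma free_prod F G : isfree F -> isfree G -> isfree (F * G)%type.
Proof.
move=> [a fa] [b fb]; exists (a + b)%N; apply: iso_trans (iso_prod fa fb) _.
exact/iso_sym/row_split.
Qed.

Lemma free_fgen F : isfree F -> fgen F.
Proof. by move=> [n /iso_sym h]; apply: fgen_iso h (fgen_rV _ _). Qed.

Lemma free_lift F V W (p : {linear V -> W}) (f : {linear F -> W}) : isfree F ->
  (forall x, exists y, p y = f x) -> exists g : {linear F -> V}, forall x, p (g x) = f x.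
Proof.
move=> [n [h [hi hs]]] pf; have [k [hk kh]] := iso_inv hi hs.
have [v|g hg] := @row_lift _ _ _ _ p (f \o k)%FUN; first exact: pf.
by exists (g \o h)%FUN => x /=; rewrite hg /= hk.
Qed.

(** Stable isomorphism. Syzygies taken from different covers agree only up to free summands, and
    [extle] does not see these. *)
Definition sim X Y := exists F G, [/\ isfree F, isfree G & iso (X * F)%type (Y * G)%type].

Lemma iso_sim X Y : iso X Y -> sim X Y.
Proof.
move=> h; exists 'rV[A]_0, 'rV[A]_0; split; try exact: free_rV.
exact: iso_prod h (iso_refl _).
Qed.

Lemma sim_refl X : sim X X. Proof. exact/iso_sim/iso_refl. Qed.

Lemma sim_sym X Y : sim X Y -> sim Y X.
Proof. by move=> [F [G [fF fG /iso_sym h]]]; exists G, F. Qed.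

Lemma sim_trans Y X Z : sim X Y -> sim Y Z -> sim X Z.
Proof.
move=> [F [G [fF fG h]]] [F' [G' [fF' fG' h']]].
exists (F * F')%type, (G' * G)%type; split; try exact: free_prod.
apply: iso_trans (iso_sym (iso_prodA _ _ _)) _.
apply: iso_trans (iso_prod h (iso_refl _)) _.
apply: iso_trans (iso_prodA _ _ _) _.
apply: iso_trans (iso_prod (iso_refl _) (iso_prodC _ _)) _.
apply: iso_trans (iso_sym (iso_prodA _ _ _)) _.
apply: iso_trans (iso_prod h' (iso_refl _)) _.
exact: iso_prodA.
Qed.

Lemma sim_prodF X F : isfree F -> sim X (X * F)%type.
Proof.
move=> fF; exists F, 'rV[A]_0; split=> //; first exact: free_rV.
have zP : linear (fun x : (X * F)%type => (x, 0 : 'rV[A]_0)).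
  move=> a x y; congr pair; rewrite -[LHS]addr0 -[X in X + _ = _](scaler0 _ a) //.
exists (mklin zP); split; first by move=> x y [->].
by move=> [x y]; exists x; congr pair; apply/matrixP => i [].
Qed.

Lemma sim_free X Y F G : isfree F -> isfree G -> iso (X * F)%type (Y * G)%type -> sim X Y.
Proof. by move=> fF fG h; exists F, G. Qed.

Lemma free_sim F G : isfree F -> isfree G -> sim F G.
Proof. by move=> fF fG; exists G, F; split=> //; apply: iso_prodC. Qed.

Lemma sim_fgen X Y : sim X Y -> fgen X -> fgen Y.
Proof.
move=> [F [G [fF fG h]]] fX.
have := fgen_iso h (fgen_prod fX (free_fgen fF)).
by apply: (@fgen_onto _ _ _ (fstL Y G)) => y; exists (y, 0).
Qed.

(** Both sides are isomorphic to the pullback [P] of [g] and [g'], whose projections onto the free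
    modules split. *)
Lemma schanuel_iso K F K' F' X (f : {linear K -> F}) (g : {linear F -> X})
    (f' : {linear K' -> F'}) (g' : {linear F' -> X}) :
  isfree F -> isfree F' -> ses f g -> ses f' g' -> iso (K * F')%type (K' * F)%type.
Proof.
move=> fF fF' [fi gs e] [fi' gs' e'].
have [x|a ha] := @free_lift _ _ _ g' g fF; first exact: gs'.
have [x|b hb] := @free_lift _ _ _ g g' fF'; first exact: gs.
have dP : linear (fun x : (F * F')%type => g x.1 - g' x.2).
  move=> c x y; rewrite [g _](linearP g c x.1 y.1) [g' _](linearP g' c x.2 y.2).
  by rewrite opprD addrACA scalerBr.
pose P := ker (mklin dP).
have PP x : reflect (g x.1 = g' x.2) (x \in P).
  apply: (iffP (kerP _ _)) => [h|h].
    by apply/eqP; rewrite -subr_eq0; apply/eqP.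
  by rewrite mklinE h subrr.
have gf x : g (f x) = 0 by apply/e; exists x.
have gf' x : g' (f' x) = 0 by apply/e'; exists x.
pose u1 := pairL (copairL f b) (sndL K F').
pose u2 := pairL (sndL K' F) (copairL f' a).
have [x|h1 H1] := @factor_inj _ _ _ _ (sval_lin P) u1 (@sval_inj _ _ _).
  have xP : u1 x \in P by apply/PP; rewrite /= linearD gf hb add0r.
  by exists (mksmod xP).
have [x|h2 H2] := @factor_inj _ _ _ _ (sval_lin P) u2 (@sval_inj _ _ _).
  have xP : u2 x \in P by apply/PP; rewrite /= linearD gf' ha add0r.
  by exists (mksmod xP).
apply: (@iso_trans _ (smod P)); last apply: iso_sym.
  exists h1; split=> [[x y] [x' y'] exy|[[u v] h]].
    have := H1 (x, y); rewrite exy H1 => -[/= + ey]; rewrite ey => /addIr/fi.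
    by move->.
  have /PP /= guv := h; have /e[k ek] : g (u - b v) = 0 by rewrite linearB hb guv subrr.
  by exists (k, v); apply: val_inj; rewrite [LHS]H1 /= ek subrK.
exists h2; split=> [[x y] [x' y'] exy|[[u v] h]].
  have := H2 (x, y); rewrite exy H2 => -[/= ey]; rewrite ey => /addIr/fi'.
  by move->.
have /PP /= guv := h; have /e'[k ek] : g' (v - a u) = 0 by rewrite linearB ha guv subrr.
by exists (k, u); apply: val_inj; rewrite [LHS]H2 /= ek subrK.
Qed.

Lemma ses_addF K F X G (f : {linear K -> F}) (g : {linear F -> X}) : ses f g ->
  ses (pairL f (zeroL K G)) (pairL (g \o fstL F G)%FUN (sndL F G)).
Proof.
move=> [fi gs e]; split.
- by move=> x y [/fi].
- by move=> [x y]; have [z <-] := gs x; exists (z, y).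
move=> [x y]; split=> [[/e[z <-] y0]|[z [<- <-]]]; first by exists z; congr pair.
by congr pair => /=; apply/e; exists z.
Qed.

Lemma schanuel K F K' F' X X' (f : {linear K -> F}) (g : {linear F -> X})
    (f' : {linear K' -> F'}) (g' : {linear F' -> X'}) :
  isfree F -> isfree F' -> ses f g -> ses f' g' -> sim X X' -> sim K K'.
Proof.
move=> fF fF' s s' [G [G' [fG fG' [h [hi hs]]]]].
have s1 := ses_iso_r (ses_addF G s) hi hs; have s2 := ses_addF G' s'.
have := schanuel_iso (free_prod fF fG) (free_prod fF' fG') s1 s2.
by apply: sim_free; apply: free_prod.
Qed.

(** The shape in which exact sequences survive syzygies, duals and cosyzygies. *)
Definition tri X Y Z := exists X' Y' Z' (f : {linear X' -> Y'}) (g : {linear Y' -> Z'}),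
  [/\ sim X X', sim Y Y', sim Z Z' & ses f g].

Lemma ses_tri X Y Z (f : {linear X -> Y}) (g : {linear Y -> Z}) : ses f g -> tri X Y Z.
Proof. by move=> s; exists X, Y, Z, f, g; split=> //; apply: sim_refl. Qed.

Lemma tri_sim X Y Z X' Y' Z' : sim X X' -> sim Y Y' -> sim Z Z' -> tri X Y Z -> tri X' Y' Z'.
Proof.
move=> sX sY sZ [X1 [Y1 [Z1 [f [g [s1 s2 s3 s]]]]]]; exists X1, Y1, Z1, f, g.
by split=> //; [apply: sim_trans (sim_sym sX) s1|apply: sim_trans (sim_sym sY) s2|
                apply: sim_trans (sim_sym sZ) s3].
Qed.

(** The formulas for [u] and [v] are recorded because [extle_ses] extends and restricts
    homomorphisms along them. *)
Lemma horseshoe X Y Z K F K' F' (i : {linear X -> Y}) (p : {linear Y -> Z})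
    (f : {linear K -> F}) (g : {linear F -> X}) (f' : {linear K' -> F'}) (g' : {linear F' -> Z}) :
    isfree F' -> ses i p -> ses f g -> ses f' g' ->
  exists (h : {linear (F * F')%type -> Y}) (u : {linear K -> smod (ker h)})
      (v : {linear smod (ker h) -> K'}),
    [/\ onto h, ses u v, forall x, val (u x) = (f x, 0) & forall x, f' (v x) = (val x).2].
Proof.
move=> fF' [ii ps e] [fi gs eg] [fi' gs' eg'].
have [x|l hl] := @free_lift _ _ _ p g' fF'; first exact: ps.
pose h := copairL (i \o g)%FUN l; exists h.
have pi x : p (i x) = 0 by apply/e; exists x.
have ho : onto h.
  move=> y; have [w ew] := gs' (p y).
  have /e[x ex] : p (y - l w) = 0 by rewrite linearB hl ew subrr.
  by have [t et] := gs x; exists (t, w); rewrite mklinE /= et ex subrK.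
have [x|u hu] := @factor_inj _ _ _ _ (sval_lin (ker h)) (pairL f (zeroL K F')) (@sval_inj _ _ _).
  have xk : pairL f (zeroL K F') x \in ker h.
    apply/kerP; have gf0 : g (f x) = 0 by apply/eg; exists x.
    by rewrite -[LHS]/(i (g (f x)) + l 0) gf0 !linear0 addr0.
  by exists (mksmod xk).
have [x|v hv] := @factor_inj _ _ _ _ f' (sndL F F' \o sval_lin (ker h))%FUN fi'.
  have /kerP := valP x; rewrite mklinE /= => e0; apply/eg'.
  by rewrite -hl -[RHS](linear0 p) -e0 linearD pi add0r.
exists u, v; split=> //; split.
- move=> x y exy; apply: fi; have := hu x; rewrite exy hu => -[->] //.
- move=> y; have /e[x ex] : p (l (f' y)) = 0 by rewrite hl; apply/eg'; exists y.
  have [t et] := gs (- x).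
  have xk : (t, f' y) \in ker h by apply/kerP; rewrite mklinE /= et linearN ex addNr.
  by exists (mksmod xk); apply: fi'; rewrite hv.
move=> y; split=> [vy|[x <-]]; last first.
  by apply: fi'; rewrite hv -[LHS]/((sval_lin (ker h) (u x)).2) hu linear0.
have y2 : (val y).2 = 0 by have /= <- := hv y; rewrite vy linear0.
have /kerP := valP y; rewrite mklinE /= y2 linear0 addr0 => igy.
have /eg[x ex] : g (val y).1 = 0 by apply: ii; rewrite igy linear0.
exists x; apply: val_inj; rewrite [LHS]hu -[LHS]/(f x, 0) ex -y2.
by case: (val y).
Qed.

(** * Duals and biduals *)

Section Dual.

Lemma dvalP V (phi : dual_mod V) : linear (val phi).
Proof. by have /asboolP := valP phi. Qed.
Definition dval V (phi : dual_mod V) : {linear V -> A^o} := mklin (dvalP phi).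

Fact dmk_proof V (f : {linear V -> A^o}) : (f : V -> A^o) \in @linp A V.
Proof. by apply/asboolP => a x y; rewrite linearP. Qed.
Definition dmk V (f : {linear V -> A^o}) : dual_mod V :=
  exist _ (f : V -> A^o) (dmk_proof f).

Lemma dual_ext V (phi psi : dual_mod V) : dval phi =1 dval psi -> phi = psi.
Proof. by move=> h; apply: val_inj; apply/funext => x; apply: h. Qed.

Lemma dvalD V a (phi psi : dual_mod V) x :
  dval (a *: phi + psi) x = a *: dval phi x + dval psi x.
Proof. by []. Qed.

Definition dmap_fun U V (f : {linear U -> V}) (phi : dual_mod V) : dual_mod U :=
  dmk (dval phi \o f)%FUN.
Lemma dmap_linear U V (f : {linear U -> V}) : linear (dmap_fun f).
Proof. by move=> a x y; apply: dual_ext. Qed.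
Definition dmap U V (f : {linear U -> V}) : {linear dual_mod V -> dual_mod U} :=
  mklin (dmap_linear f).

Lemma dmapE U V (f : {linear U -> V}) phi x : dval (dmap f phi) x = dval phi (f x).
Proof. by []. Qed.

(** The extension hypothesis makes [dmap f] onto; it will follow from the vanishing of Ext^1(W,
    A). *)
Lemma dual_ses U V W (f : {linear U -> V}) (g : {linear V -> W}) : ses f g ->
    (forall phi : {linear U -> A^o}, exists psi : {linear V -> A^o}, forall x, psi (f x) = phi x) ->
  ses (dmap g) (dmap f).
Proof.
move=> [fi gs e] h; split.
- move=> phi psi eq; apply: dual_ext => y; have [x <-] := gs y.
  by rewrite -!dmapE eq.
- by move=> phi; have [psi hp] := h (dval phi); exists (dmk psi); apply: dual_ext.
move=> psi; split=> [fp|[phi <-]]; last first.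
  by apply: dual_ext => x; rewrite !dmapE; have -> : g (f x) = 0 by [apply/e; exists x];
    rewrite linear0.
have [x /e[y <-]|phi hphi] := factor_surj (p := g) (f := dval psi) gs.
  by rewrite -dmapE fp.
by exists (dmk phi); apply: dual_ext.
Qed.

Lemma dual_iso U V : iso U V -> iso (dual_mod V) (dual_mod U).
Proof.
move=> [f [fi fs]]; have [g [gf fg]] := iso_inv fi fs; exists (dmap f); split.
  by move=> phi psi eq; apply: dual_ext => y; rewrite -[y]fg -!dmapE eq.
by move=> phi; exists (dmap g phi); apply: dual_ext => x; rewrite !dmapE gf.
Qed.

Lemma dual_prod U V : iso (dual_mod (U * V)%type) (dual_mod U * dual_mod V)%type.
Proof.
exists (pairL (dmap (inlL U V)) (dmap (inrL U V))); split.
  move=> phi psi e; apply: dual_ext => -[x y].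
  have e1 : dmap (inlL U V) phi = dmap (inlL U V) psi := congr1 fst e.
  have e2 : dmap (inrL U V) phi = dmap (inrL U V) psi := congr1 snd e.
  have -> : (x, y) = inlL U V x + inrL U V y by congr pair; rewrite /= ?addr0 ?add0r.
  rewrite !linearD; congr (_ + _); first exact: (congr1 (fun z => dval z x) e1).
  exact: (congr1 (fun z => dval z y) e2).
move=> [phi psi]; exists (dmk (copairL (dval phi) (dval psi))).
congr pair; apply: dual_ext => x; rewrite dmapE.
  by rewrite -[LHS]/(dval phi x + dval psi 0) linear0 addr0.
by rewrite -[LHS]/(dval phi 0 + dval psi x) linear0 add0r.
Qed.

Lemma dual_rV n : iso (dual_mod 'rV[A]_n) 'rV[A]_n.
Proof.
have lP : linear (fun phi : dual_mod 'rV[A]_n => \row_j (dval phi (delta_mx ord0 j) : A)).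
  by move=> a x y; apply/rowP => j; rewrite !mxE.
exists (mklin lP); split.
  move=> phi psi e; apply: dual_ext; apply: row_map_ext => j.
  by have /rowP/(_ j) := e; rewrite !mxE.
move=> v; exists (dmk (row_map (fun j => v ord0 j : A^o))); apply/rowP => j.
by rewrite mxE; exact: (row_map_delta (fun j => v ord0 j : A^o) j).
Qed.

Lemma free_dual F : isfree F -> isfree (dual_mod F).
Proof.
move=> [n h]; exists n; apply: iso_trans (dual_rV n).
exact/dual_iso/iso_sym.
Qed.

Lemma sim_dual X Y : sim X Y -> sim (dual_mod X) (dual_mod Y).
Proof.
move=> [F [G [fF fG h]]]; exists (dual_mod F), (dual_mod G).
split; try exact: free_dual.
apply: iso_trans (iso_sym (dual_prod _ _)) _.
apply: iso_trans (dual_prod _ _); exact/dual_iso/iso_sym.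
Qed.

Lemma dval_linear V (x : V) : linear (fun phi : dual_mod V => dval phi x).
Proof. by move=> a phi psi; rewrite dvalD. Qed.

Lemma dval_comb V k (c : 'I_k -> A) (phi : 'I_k -> dual_mod V) x :
  dval (\sum_i c i *: phi i) x = \sum_i c i *: (dval (phi i) x : A^o).
Proof.
apply: (big_ind2 (fun (f : dual_mod V) (a : A^o) => dval f x = a)) => // f a g b <- <-.
by rewrite -[f]scale1r dvalD !scale1r.
Qed.

Definition bidual_fun V (x : V) : dual_mod (dual_mod V) := dmk (mklin (dval_linear x)).
Lemma bidual_linear V : linear (@bidual_fun V).
Proof. by move=> a x y; apply: dual_ext => phi; rewrite [LHS]linearP. Qed.
Definition bidual V : {linear V -> dual_mod (dual_mod V)} := mklin (@bidual_linear V).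

Lemma bidual_nat U V (f : {linear U -> V}) x : dmap (dmap f) (bidual U x) = bidual V (f x).
Proof. by apply: dual_ext. Qed.

Lemma bidual_free F : isfree F -> injective (bidual F) /\ onto (bidual F).
Proof.
have rV n : injective (bidual 'rV[A]_n) /\ onto (bidual 'rV[A]_n).
  pose co j : dual_mod 'rV[A]_n := dmk (mklin ((fun a x y =>
    etrans (mxE _ _ _ _) (congr1 (+%R^~ (y ord0 j)) (mxE _ _ _ _))) :
      linear (fun v : 'rV[A]_n => v ord0 j : A^o))).
  split.
    by move=> v w e; apply/rowP => j; have := congr1 (fun z => dval z (co j)) e.
  move=> z; pose w : 'rV[A]_n := \row_j (dval z (co j) : A); exists w; apply: dual_ext => phi.
  have ephi : phi = \sum_j (dval phi (delta_mx ord0 j) : A) *: co j.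
    apply: dual_ext => v; rewrite row_mapE.
    rewrite (dval_comb (fun j => dval phi (delta_mx ord0 j))).
    by apply: eq_bigr => j _; apply: mulrC.
  rewrite [in RHS]ephi linear_sum -[LHS]/(dval phi w) [LHS]row_mapE.
  by apply: eq_bigr => j _; rewrite linM mxE; apply: mulrC.
move=> [n [h [hi hs]]]; have [k [hk kh]] := iso_inv hi hs; have [ri rs] := rV n.
split=> [x y e|z].
  by apply/hi/ri; rewrite -!bidual_nat e.
have [v ev] := rs (dmap (dmap h) z); exists (k v).
rewrite -bidual_nat ev; apply: dual_ext => phi; rewrite !dmapE.
have -> // : dmap h (dmap k phi) = phi.
by apply: dual_ext => x; rewrite !dmapE hk.
Qed.

End Dual.

End Stable.

(** * Lengths of Ext modules *)

Section ExtLength.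
Variable A : comNzRingType.
Implicit Types F G K L U V W X Y Z : lmodType A.

(** Homomorphisms are kept inside the module of all functions K -> L, so that Ext^1 is an interval
    between two of its submodules. *)
Lemma hom_closed K L : pclosed (fun f : K -> L => linear f).
Proof.
split=> [a x y|c f g lf lg a x y]; first by rewrite scaler0 addr0.
rewrite -[LHS]/(c *: f (a *: x + y) + g (a *: x + y)) lf lg scalerDr addrACA.
rewrite -[RHS]/(a *: (c *: f x + g x) + (c *: f y + g y)) scalerDr !scalerA.
by rewrite [c * a]mulrC.
Qed.
Definition homS K L := psub (@hom_closed K L).

Lemma res_closed K F L (f : {linear K -> F}) :
  pclosed (fun phi : K -> L => exists psi : {linear F -> L}, forall x, phi x = psi (f x)).
Proof.
split=> [|c phi phi' [psi h] [psi' h']]; first by exists (zeroL F L).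
have lP : linear (fun x => c *: psi x + psi' x).
  move=> a x y; rewrite (linearP psi) (linearP psi') scalerDr addrACA.
  by rewrite [in RHS]scalerDr !scalerA [c * a]mulrC.
by exists (mklin lP) => x; rewrite -[LHS]/(c *: phi x + phi' x) h h'.
Qed.
Definition resS K F L (f : {linear K -> F}) := psub (@res_closed K F L f).

Lemma res_hom K F L (f : {linear K -> F}) : {subset resS L f <= homS K L}.
Proof. by move=> phi /psubP[psi h]; apply/psubP => a x y; rewrite !h !linearP. Qed.

Lemma homS_mk K L (phi : {linear K -> L}) : (phi : K -> L) \in homS K L.
Proof. by apply/psubP => a x y; rewrite linearP. Qed.

Definition homS_lin K L (phi : K -> L) (h : phi \in homS K L) : {linear K -> L} :=
  mklin (elimT (psubP _ _) h).

Lemma comp_closed K K' L (h : K' -> K) (S : submodClosed (K' -> L)) :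
  pclosed (fun phi : K -> L => phi \in homS K L /\ (fun x => phi (h x)) \in S).
Proof.
split=> [|c f g [f1 f2] [g1 g2]]; first by split; [exact: rpred0|apply: (rpred0 S)].
split; first by rewrite rpredD ?rpredZ.
have -> : (fun x => (c *: f + g) (h x)) =
  c *: (fun x => f (h x) : L) + (fun x => g (h x)) by [].
by rewrite rpredD ?rpredZ.
Qed.
Definition compS K K' L (h : K' -> K) (S : submodClosed (K' -> L)) := psub (comp_closed h S).

Lemma compose_closed K K' L (h : K' -> K) (S : submodClosed (K -> L)) :
  pclosed (fun phi : K' -> L => exists2 psi, psi \in S & phi = (fun x => psi (h x))).
Proof.
split=> [|c _ _ [f fS ->] [g gS ->]]; first by exists 0; rewrite ?rpred0.
by exists (c *: f + g); rewrite ?rpredD ?rpredZ.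
Qed.
Definition composeS K K' L (h : K' -> K) (S : submodClosed (K -> L)) := psub (compose_closed h S).

(* [extle Y L n]: the length of [Ext^1(Y, L)], i.e. of [Hom(K, L)] modulo the
   restrictions of [Hom(F, L)] for a presentation [0 -> K -> F -> Y -> 0] with
   [F] free, is at most [n]. *)
Definition extle Y L n := exists K F (f : {linear K -> F}) (g : {linear F -> Y}),
  [/\ isfree F, ses f g & forall l, ilchain (resS L f) (homS K L) l -> (l <= n)%N].

(** Comparison maps [a0], [b0] between the two syzygies carry chains across, because their composite
    is homotopic to the identity. *)
Lemma ext_presentation K F K' F' Y Y' (f : {linear K -> F}) (g : {linear F -> Y})
    (f' : {linear K' -> F'}) (g' : {linear F' -> Y'}) L l :
    isfree F -> isfree F' -> ses f g -> ses f' g' -> iso Y Y' ->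
  ilchain (resS L f) (homS K L) l -> ilchain (resS L f') (homS K' L) l.
Proof.
move=> fF fF' s s' [h [hi hs]].
have [g2 s1] : exists g2 : {linear F -> Y'}, ses f g2 by exists (h \o g)%FUN; apply: ses_iso_r.
have [f1 g1 e1] := s1; have [f1' g1' e1'] := s'.
have [x|a ha] := @free_lift _ _ _ _ g' g2 fF; first exact: g1'.
have [x|b hb] := @free_lift _ _ _ _ g2 g' fF'; first exact: g1.
have [x|a0 ha0] := @factor_inj _ _ _ _ f' (a \o f)%FUN f1'.
  by apply/e1'; rewrite /= ha (ses0 x s1).
have [x|b0 hb0] := @factor_inj _ _ _ _ f (b \o f')%FUN f1.
  by apply/e1; rewrite /= hb (ses0 x s').
have dP : linear (fun x => x - b (a x)).
  by move=> c x y; rewrite (linearP a) (linearP b) opprD addrACA scalerBr.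
(* The homotopy: the identity of [K] and [b0 \o a0] differ by [t \o f], and [phi \o t \o f] is a
   restriction from [F], hence lies in every submodule of the chain. *)
have [x|t ht] := @factor_inj _ _ _ _ f (mklin dP) f1.
  by apply/e1; rewrite /= linearB [X in _ - X]hb ha subrr.
have tE x : t (f x) = x - b0 (a0 x).
  by apply: f1; rewrite ht linearB hb0 /= ha0.
apply: (@ilchain_map _ _ _ _ _ _ _ (compS a0)).
- move=> S RS SH; split=> phi; last by case/psubP.
  move=> /psubP[psi hpsi]; apply/psubP; split; first by apply: res_hom; apply/psubP; exists psi.
  by apply/RS/psubP; exists (psi \o a)%FUN => x; rewrite /= hpsi ha0.
move=> S T RS ST TH; split=> [phi /psubP[ph /ST pS]|H phi pT]; first exact/psubP.
have pH := TH _ pT; pose phi' := homS_lin pH.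
have eqm : (fun x => phi (b0 (a0 x))) = phi - (fun x => phi (t (f x))).
  apply/funext => x; rewrite -[RHS]/(phi x - phi (t (f x))).
  rewrite -[phi (b0 _)]/(phi' (b0 (a0 x))) -[phi x]/(phi' x) -[phi (t _)]/(phi' (t (f x))).
  by rewrite tE linearB subKr.
have rS : (fun x => phi (t (f x))) \in S.
  by apply/RS/psubP; exists (phi' \o t)%FUN.
have /H/psubP[_] : (fun x => phi (b0 x)) \in compS a0 T.
  apply/psubP; split; first exact: (homS_mk (phi' \o b0)%FUN).
  by rewrite eqm; apply: submodB => //; apply: ST.
by rewrite eqm => h1; rewrite -[phi](subrK (fun x => phi (t (f x)))) rpredD.
Qed.

Lemma extleP K F Y (f : {linear K -> F}) (g : {linear F -> Y}) L n : isfree F -> ses f g ->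
  extle Y L n <-> forall l, ilchain (resS L f) (homS K L) l -> (l <= n)%N.
Proof.
move=> fF s; split=> [[K' [F' [f' [g' [fF' s' h]]]]] l|h]; last by exists K, F, f, g.
by move/(ext_presentation fF fF' s s' (iso_refl _))/h.
Qed.

Lemma extle_iso Y Y' L n : iso Y Y' -> extle Y L n -> extle Y' L n.
Proof.
move=> [h [hi hs]] [K [F [f [g [fF s H]]]]]; exists K, F, f, (h \o g)%FUN; split=> //.
exact: ses_iso_r.
Qed.

Lemma resS_addF K F G L (f : {linear K -> F}) : resS L (pairL f (zeroL K G)) =i resS L f.
Proof.
move=> phi; apply/psubP/psubP => -[psi h].
  by exists (psi \o inlL F G)%FUN => x; rewrite h.
by exists (psi \o fstL F G)%FUN => x; rewrite h.
Qed.

Lemma extle_addF Y G L n : fgen Y -> isfree G -> extle Y L n <-> extle (Y * G)%type L n.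
Proof.
move=> [m [g0 g0s]] fG.
have H K F (f : {linear K -> F}) l :
    ilchain (resS L f) (homS K L) l <-> ilchain (resS L (pairL f (zeroL K G))) (homS K L) l.
  by apply: ilchain_eq => // x; rewrite resS_addF.
have s0 := ses_ker g0s; have fm := free_rV A m.
rewrite (extleP L n fm s0) (extleP L n (free_prod fm fG) (ses_addF G s0)).
by split=> h l hc; apply: h; [exact: (proj2 (H _ _ _ l))|exact: (proj1 (H _ _ _ l))].
Qed.

Lemma extle_sim Y Y' L n : fgen Y -> sim Y Y' -> extle Y L n -> extle Y' L n.
Proof.
move=> fY sY; have fY' := sim_fgen sY fY.
have [F [G [fF fG h]]] := sY.
by move=> /(extle_addF L n fY fF)/(extle_iso h)/(extle_addF L n fY' fG).
Qed.

(** By the horseshoe lemma the syzygy of [Y] is an extension of [K'] by [K]. A submodule of its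
    homomorphisms is detected by those that factor through [v] together with the restrictions along
    [u], so [ilchain_split] gives the bound. *)
Lemma extle_ses X Y Z (i : {linear X -> Y}) (p : {linear Y -> Z}) L a b :
  ses i p -> extle X L a -> extle Z L b -> extle Y L (a + b).
Proof.
move=> s [K [F [f [g [fF sf ha]]]]] [K' [F' [f' [g' [fF' sg hb]]]]].
have [h [u [v [ho suv hu hv]]]] := horseshoe fF' s sf sg.
exists (smod (ker h)), (F * F')%type, (sval_lin (ker h)), h.
split; [exact: free_prod|exact: ses_ker|] => l.
have [ui vs euv] := suv.
case/(@ilchain_split _ _ _ _ _ _ (resS L f') (homS K' L) (resS L f) (homS K L)
  (compS v) (composeS u)).
- move=> S RS SH; split=> phi.
  + move=> hphi; apply/psubP; split; first exact: res_hom hphi.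
    have /psubP[psi hpsi] := hphi; apply/RS/psubP; exists (psi \o sndL F F')%FUN => x.
    by rewrite hpsi hv.
  + by case/psubP.
  + move=> /psubP[psi hpsi]; apply/psubP.
    exists (fun x => psi (val x).1); last by apply/funext => x; rewrite hu hpsi.
    by apply/RS/psubP; exists (psi \o fstL F F')%FUN.
  + case/psubP => psi /SH/psubP lpsi ->; apply/psubP => c x y.
    by rewrite linearP lpsi.
- move=> S T RS ST TH; split=> [phi /psubP[h1 /ST h2]|phi /psubP[psi /ST pS ->]|H1 H2 phi pT].
  + exact/psubP.
  + by apply/psubP; exists psi.
  have /H2/psubP[psi pS epsi] : (fun x => phi (u x)) \in composeS u T.
    by apply/psubP; exists phi.
  have dT : phi - psi \in T by apply: submodB => //; apply: ST.
  pose d := homS_lin (TH _ dT).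
  have dE x : d x = phi x - psi x by [].
  have [x /euv[y <-]|e he] := factor_surj (p := v) (f := d) vs.
    have e0 : phi (u y) = psi (u y) := congr1 (fun k : K -> L => k y) epsi.
    by rewrite dE e0 subrr.
  have ed : (fun x => e (v x)) = phi - psi by apply/funext => x; rewrite he.
  have /H1/psubP[_] : (e : K' -> L) \in compS v T.
    by apply/psubP; split; [exact: homS_mk|rewrite ed].
  by rewrite ed => dS; rewrite -[phi](subrK psi) rpredD.
move=> l1 [l2 [/hb h1 /ha h2 hl]]; apply: leq_trans hl _.
by rewrite addnC leq_add.
Qed.

End ExtLength.

(** * Tor and Ext through minimal resolutions *)

Section Identification.
Variable A : comNzRingType.
Implicit Types K L V X Y Z : lmodType A.

Lemma row_map_mul p q (D : 'M[A]_(p, q)) L (y : {ffun 'I_q -> L}) v :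
  row_map y (v *m D) = row_map (mx_act D^T y) v.
Proof.
rewrite -[LHS]/(\sum_j (v *m D) ord0 j *: y j) -[RHS]/(\sum_j v ord0 j *: mx_act D^T y j).
under [RHS]eq_bigr => j _ do rewrite ffunE scaler_sumr.
rewrite exchange_big; apply: eq_bigr => k _ /=; rewrite mxE scaler_suml.
by apply: eq_bigr => j _; rewrite mxE scalerA.
Qed.

(** The matrices transpose to a presentation of the syzygy [K], and [phi] goes to the family of its
    values on the generators [w e_j]. Stated for arbitrary matrices, so that it serves for a
    resolution and for its dual. *)
Lemma matrix_homology p q r (T0 : 'M[A]_(r, q)) (T1 : 'M[A]_(q, p)) K Y
    (i : {linear K -> 'rV[A]_r}) (g : {linear 'rV[A]_r -> Y}) (w : {linear 'rV[A]_q -> K}) L :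
    ses i g -> onto w -> (forall v, i (w v) = v *m T0^T) ->
    (forall v, w v = 0 <-> exists u, v = u *m T1^T) ->
  forall l, (exists c : nat -> submodClosed (homology (@mx_act _ _ _ T0 L) (@mx_act _ _ _ T1 L)),
      strict_chain l (fun i => c i : {pred _})) <->
    ilchain (resS L i) (homS K L) l.
Proof.
move=> [ii gs e] ws iw w0 l.
have T01 : T0 *m T1 = 0.
  apply: trmx_inj; rewrite trmx_mul trmx0; apply/row_matrixP => k; rewrite row_mul row0 -iw.
  have -> : w (row k T1^T) = 0; last by rewrite linear0.
  by apply/w0; exists (delta_mx ord0 k); rewrite -rowE.
rewrite (homology_ilchain (@mx_act0 _ _ _ _ _ _ T01 L)); apply: iff_sym.
have PP : linear (fun phi : K -> L => [ffun j => phi (w (delta_mx ord0 j))] : {ffun 'I_q -> L}).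
  by move=> a x y; apply/ffunP => j; rewrite !ffunE.
have repr (phi : {linear K -> L}) v : phi (w v) = row_map (mklin PP phi) v.
  apply: (@row_map_ext _ _ _ (phi \o w)%FUN) => j.
  by rewrite row_map_delta ffunE.
apply: (@ilchain_lin _ _ _ (mklin PP)).
- exact: res_hom.
- by move=> _ /imP[x _ <-]; apply/kerP; apply: mx_act0.
- move=> phi hphi; apply/kerP; pose f := homS_lin hphi.
  apply/ffunP => k; rewrite -row_map_delta -[T1]trmxK.
  rewrite -[row_map _ _](row_map_mul T1^T (mklin PP phi)).
  rewrite -[row_map _ _](repr f) [w _](_ : _ = 0) ?linear0 ?ffunE //.
  by apply/w0; exists (delta_mx ord0 k).
- move=> y /kerP y0.
  have [v|phi hphi] := factor_surj (p := w) (f := row_map y) ws.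
    move=> /w0[u ->]; rewrite row_map_mul trmxK [mx_act _ _]y0.
    by rewrite -[LHS]/(\sum_j _) big1 // => j _; rewrite ffunE scaler0.
  exists (phi : K -> L); first exact: homS_mk.
  suff -> : mklin PP phi = y by rewrite subrr rpred0.
  by apply/ffunP => j; rewrite ffunE hphi row_map_delta.
move=> phi hphi; pose f := homS_lin hphi; apply/imP/psubP.
  move=> [z _ ez]; exists (row_map z) => x; have [v <-] := ws x.
  by rewrite -[phi _]/(f _) repr -[mklin PP _]ez -[in LHS](trmxK T0) -row_map_mul iw.
move=> [psi hpsi]; exists [ffun j => psi (delta_mx ord0 j)] => //.
apply/ffunP => j; rewrite [RHS]ffunE hpsi iw -[LHS]row_map_delta -[in LHS](trmxK T0).
rewrite -row_map_mul; apply: esym; apply: (@row_map_ext _ _ _ psi) => k.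
by rewrite row_map_delta ffunE.
Qed.

Hypothesis noeA : noetherian A.
Variable m : ideal A.
Hypothesis lm : is_local m.

Local Notation cov := (Defs.cover m).
Local Notation inc V := (sval_lin (ker (cov V))).

Lemma resolution_linear M i : linear (@resolution_map A m M i).
Proof. by move=> a x y; rewrite /resolution_map !linearP. Qed.

Lemma differentialE M i v :
  v *m differential m M i = val (cov (iter i.+1 (syz m) M) v).
Proof. exact: (mul_rV_lin1 (mklin (@resolution_linear M i)) v). Qed.

Lemma fgen_iter M i : fgen M -> fgen (iter i (syz m) M).
Proof. by move=> fM; elim: i => //= i IH; apply: fgen_syz. Qed.

Lemma cover_ker M v : fgen (syz m M) ->
  cov M v = 0 <-> exists u, v = val (cov (syz m M) u).
Proof.
move=> fM; split=> [h|[u ->]]; last by have /kerP := valP (cov (syz m M) u).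
have vk : v \in ker (cov M) by apply/kerP.
have [_ os _] := cover_ses lm fM.
by have [u eu] := os (mksmod vk); exists u; rewrite eu.
Qed.

Lemma Ext1_extle M L n : fgen M ->
  (forall l, (exists c : nat -> submodClosed (Ext1 m M L),
      strict_chain l (fun i => c i : {pred _})) -> (l <= n)%N) <-> extle M L n.
Proof.
move=> fM; have f1 := fgen_syz noeA m fM; have f2 := fgen_syz noeA m f1.
have s := cover_ses lm fM; rewrite (extleP L n (free_rV A _) s).
have [_ o1 _] := cover_ses lm f1.
have H := @matrix_homology _ _ _ (differential m M 0)^T (differential m M 1)^T
   _ _ _ _ (cov (syz m M)) L s o1 _ _.
have {}H l := H _ _ l; split=> h l hl; apply: h; move: hl; rewrite H // => v.
- by rewrite trmxK differentialE.
- rewrite trmxK (cover_ker _ f2); split=> -[u ->]; exists u; by rewrite differentialE.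
- by rewrite trmxK differentialE.
- rewrite trmxK (cover_ker _ f2); split=> -[u ->]; exists u; by rewrite differentialE.
Qed.

Lemma dot_linear n (w : 'rV[A]_n) : linear (fun x : 'rV[A]_n => (x *m w^T) ord0 ord0 : A^o).
Proof. by move=> a x y; rewrite mulmxDl -scalemxAl !mxE. Qed.
Definition dot n (w : 'rV[A]_n) : {linear 'rV[A]_n -> A^o} := mklin (dot_linear w).

Lemma dotE n (w x : 'rV[A]_n) : dot w x = (x *m w^T) ord0 ord0. Proof. by []. Qed.

Lemma dot_delta n (w : 'rV[A]_n) j : dot w (delta_mx ord0 j) = w ord0 j.
Proof. by rewrite dotE -rowE !mxE. Qed.

Lemma dot_mul p q (D : 'M[A]_(p, q)) w x : dot (w *m D^T) x = dot w (x *m D).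
Proof. by rewrite !dotE trmx_mul trmxK mulmxA. Qed.

Lemma dot_ext n (w w' : 'rV[A]_n) : dot w =1 dot w' -> w = w'.
Proof. by move=> h; apply/rowP => j; rewrite -!dot_delta h. Qed.

Lemma dot_repr n (phi : {linear 'rV[A]_n -> A^o}) : exists w, dot w =1 phi.
Proof.
exists (\row_j (phi (delta_mx ord0 j) : A)); apply: row_map_ext => j.
by rewrite dot_delta mxE.
Qed.

Lemma ddot_linear n : linear (fun w : 'rV[A]_n => dmk (dot w)).
Proof.
move=> a w w'; apply: dual_ext => x; rewrite dvalD -[LHS]/(dot _ x) !dotE.
by rewrite linearP mulmxDr -scalemxAr !mxE.
Qed.
Definition ddot n : {linear 'rV[A]_n -> dual_mod 'rV[A]_n} := mklin (@ddot_linear n).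

Lemma ddot_bij n : injective (ddot n) /\ onto (ddot n).
Proof.
split=> [w w' e|phi].
  by apply: dot_ext => x; exact: (congr1 (fun z => dval z x) e).
by have [w hw] := dot_repr (dval phi); exists w; apply: dual_ext.
Qed.

(* [Ext^1(X, A) = 0]. *)
Definition vext X := forall phi : {linear syz m X -> A^o},
  exists psi : {linear 'rV[A]_(mu m X) -> A^o}, forall x, psi (val x) = phi x.

(* Dualizing a minimal resolution of [X] turns it into a presentation of the
   dual of the third syzygy, with the roles of Tor and Ext exchanged. *)
Lemma Tor1_extle X L n : fgen X -> vext X -> vext (syz m X) -> vext (syz m (syz m X)) ->
  (forall l, (exists c : nat -> submodClosed (Tor1 m X L),
      strict_chain l (fun i => c i : {pred _})) -> (l <= n)%N) <->
  extle (dual_mod (iter 3 (syz m) X)) L n.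
Proof.
move=> fX v0 v1 v2; have f1 := fgen_syz noeA m fX; have f2 := fgen_syz noeA m f1.
pose X2 := syz m (syz m X); have s2 := cover_ses lm f2.
have ds := dual_ses s2 v2; have [di ds2] := ddot_bij (mu m X2).
have [g [gd dg]] := iso_inv di ds2.
have s : ses (g \o dmap (cov X2))%FUN (dmap (inc X2) \o ddot _)%FUN.
  have [a b c] := ds; split.
  - by move=> x y /(can_inj dg)/a.
  - by move=> y; have [x <-] := b y; have [z <-] := ds2 x; exists z.
  - move=> y; split=> [/c[x ex]|[x <-]]; first by exists x;
    rewrite -[LHS]/(g (dmap (cov X2) x)) ex gd.
    by apply/c; exists x; rewrite -[RHS]/(ddot _ (g (dmap (cov X2) x))) dg.
rewrite (extleP L n (free_rV A _) s).
(* Each vanishing hypothesis has its place: [v2] makes [s] exact, [v1] makes [w] onto, and [v0]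
   computes the kernel of [w]. *)
pose w := (dmap (inc (syz m X)) \o ddot _)%FUN : {linear 'rV[A]_(betti m X 1) -> dual_mod X2}.
have wE v x : dval (w v) x = dot v (val x) by [].
have ow : onto w.
  move=> phi; have [psi hpsi] := v1 (dval phi); have [v hv] := dot_repr psi.
  by exists v; apply: dual_ext => x; rewrite wE hv.
have iw v : g (dmap (cov X2) (w v)) = v *m (differential m X 1)^T.
  apply: di; rewrite dg; apply: dual_ext => x; rewrite dmapE wE.
  have -> : val (cov X2 x) = x *m differential m X 1 by apply: (esym (@differentialE X 1 x)).
  exact/esym/dot_mul.
have w0 v : w v = 0 <-> exists u, v = u *m (differential m X 0)^T.
  split=> [wv|[u ->]]; last first.
    apply: dual_ext => x; rewrite wE dot_mul differentialE.
    by have /kerP -> := valP x; rewrite !linear0.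
  have [_ o1 _] := cover_ses lm f1.
  have [x /kerP xk|phi hphi] := factor_surj (p := cov (syz m X)) (f := dot v) o1.
    by have := wE v (mksmod xk); rewrite wv => /esym.
  have [psi hpsi] := v0 phi; have [u hu] := dot_repr psi; exists u.
  by apply: dot_ext => x; rewrite dot_mul hu differentialE hpsi hphi.
have {}H := @matrix_homology _ _ _ (differential m X 1) (differential m X 0)
   _ _ _ _ w L s ow iw w0.
by split=> h l hl; apply: h; move: hl; rewrite H.
Qed.

End Identification.

(** * Ideals of a Noetherian local ring *)

Section Ideals.
Variable A : comNzRingType.
Implicit Types (J K p q m : ideal A) (a b x y s : A).

Lemma ideal0 J : (0 : A) \in J.
Proof. exact: (sub_closed J).1. Qed.

Lemma idealD J a b : a \in J -> b \in J -> a + b \in J.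
Proof. by move=> aJ bJ; have := (sub_closed J).2 1 a b aJ bJ; rewrite scale1r. Qed.

Lemma idealM J a x : x \in J -> a * x \in J.
Proof. by move=> xJ; have := (sub_closed J).2 a x 0 xJ (sub_closed J).1; rewrite addr0. Qed.

Lemma idealB J a b : a \in J -> b \in J -> a - b \in J.
Proof. by move=> aJ bJ; rewrite -mulN1r idealD // idealM. Qed.

Definition isprime p := 1 \notin p /\ forall a b, a * b \in p -> a \in p \/ b \in p.

Lemma colon_closed J b : @pclosed A A^o (fun x => x * b \in J).
Proof.
split=> [|a x y xJ yJ]; first by rewrite mul0r ideal0.
by rewrite mulrDl idealD // -mulrA idealM.
Qed.
Definition colon J b := psub (colon_closed J b).

Lemma colonE J b x : (x \in colon J b) = (x * b \in J).
Proof. by apply/idP/idP => [/(@psubP A A^o _ (colon_closed J b))|h] //;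
  apply/(@psubP A A^o _ (colon_closed J b)). Qed.

Lemma addI_closed J x : @pclosed A A^o (fun a => exists b c : A, b \in J /\ a = b + c * x).
Proof.
split=> [|a y z [b [c [bJ ->]]] [b' [c' [bJ' ->]]]].
  by exists 0, 0; rewrite ideal0 mul0r addr0.
exists (a * b + b'), (a * c + c'); split; first by rewrite idealD // idealM.
by rewrite -[LHS]/(a * (b + c * x) + (b' + c' * x)) mulrDr mulrDl addrACA mulrA.
Qed.
Definition addI J x := psub (addI_closed J x).

Lemma addIP J x a : reflect (exists b c : A, b \in J /\ a = b + c * x) (a \in addI J x).
Proof. exact: (@psubP A A^o _ (addI_closed J x) a). Qed.

Lemma addI_sub J x : {subset J <= addI J x}.
Proof. by move=> a aJ; apply/addIP; exists a, 0; rewrite mul0r addr0. Qed.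

Lemma addI_gen J x : x \in addI J x.
Proof. by apply/addIP; exists 0, 1; rewrite ideal0 mul1r add0r. Qed.

Lemma addI_min J x K : {subset J <= K} -> x \in K -> {subset addI J x <= K}.
Proof. by move=> JK xK a /addIP[b [c [bJ ->]]]; rewrite idealD ?idealM // JK. Qed.

Hypothesis noeA : noetherian A.

Lemma noeth_ind (P : ideal A -> Prop) :
  (forall J, (forall J', {subset J <= J'} -> (exists2 x, x \in J' & x \notin J) -> P J') -> P J) ->
  forall J, P J.
Proof.
move=> h J0; apply: contrapT => nJ0.
have st (J : {J : ideal A | ~ P J}) : exists J' : {J : ideal A | ~ P J},
    {subset sval J <= sval J'} /\ exists2 x, x \in sval J' & x \notin sval J.
  case: J => J nJ; apply: contrapT => no; apply/nJ/h => J' JJ' ex.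
  by apply: contrapT => nJ'; apply: no; exists (exist _ J' nJ').
pose f W := sval (cid (st W)); have fP W := svalP (cid (st W)).
pose c k := iter k f (exist _ J0 nJ0).
have [|k0 hk] := fgen_accV noeA (V := A^o) _ (Y := fun k => sval (c k)) (fun k => (fP (c k)).1).
  have oneP : linear (fun v : 'rV[A]_1 => v ord0 ord0 : A^o) by move=> a u v; rewrite !mxE.
  exists 1%N, (mklin oneP) => a; exists (\row_j a); exact: mxE.
have [_ [x xc /negP[]]] := fP (c k0); exact: (hk k0.+1 (leqnSn _)).
Qed.

Lemma max_ideal (Q : ideal A -> Prop) : (exists J, Q J) ->
  exists J, Q J /\ forall J', Q J' -> {subset J <= J'} -> {subset J' <= J}.
Proof.
move=> [J QJ]; elim/noeth_ind: J QJ => J IH QJ.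
have [[J' [QJ' JJ' ex]]|no] := EM (exists J', [/\ Q J', {subset J <= J'} & exists2 x, x \in J' & x \notin J]).
  exact: IH JJ' ex QJ'.
exists J; split=> // J' QJ' JJ' x xJ'; apply: contrapT => /negP xJ.
by apply: no; exists J'; split=> //; exists x.
Qed.

(** An ideal over [J] maximal among those avoiding all products x^k s with s outside [p] is prime.
    Thus a prime containing J and x lies strictly above a prime containing J, which bounds regular
    sequences by the Krull dimension. *)
Lemma prime_sep p J x : isprime p -> {subset J <= p} ->
    (forall a, a * x \in J -> a \in J) ->
  exists q, [/\ isprime q, {subset J <= q}, {subset q <= p} & x \notin q].
Proof.
move=> [p1 pp] Jp xJ.
pose Q K := {subset J <= K} /\ forall k s, s \notin p -> x ^+ k * s \notin K.
have [|q [[Jq hq] mq]] := @max_ideal Q.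
  exists J; split=> // k s sp; apply: contra sp => h; apply: Jp.
  elim: k h => [|k IH]; first by rewrite mul1r.
  by move=> h; apply: IH; apply: xJ; rewrite mulrC mulrA -exprS.
have nq a : a \notin q -> exists k s, s \notin p /\ x ^+ k * s \in addI q a.
  move=> aq; apply: contrapT => no.
  have Qa : Q (addI q a).
    split=> [z /Jq|k s sp]; first exact: addI_sub.
    by apply/negP => h; apply: no; exists k, s.
  by move/negP: aq; apply; apply: mq Qa (@addI_sub q a) _ (addI_gen q a).
have xn : x \notin q by have := hq 1%N 1 p1; rewrite mulr1.
exists q; split=> //.
  split=> [|a b ab]; first by have := hq 0%N 1 p1; rewrite mulr1.
  apply: contrapT => /not_orP[/negP/nq[k [s [sp /addIP[u [c [uq eu]]]]]]].
  move=> /negP/nq[k' [s' [sp' /addIP[u' [c' [uq' eu']]]]]].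
  have ss : s * s' \notin p by apply/negP => /pp[]; apply/negP.
  have /negP := hq (k + k')%N (s * s') ss; apply.
  rewrite exprD mulrACA eu eu' mulrDl; apply: idealD; first by rewrite mulrC idealM.
  rewrite mulrDr; apply: idealD; first exact: idealM.
  by rewrite mulrACA; apply: idealM.
move=> a aq; apply: contrapT => /negP/(hq 0%N); by rewrite mul1r aq.
Qed.

(** The ideals generated by a regular sequence of given length in [m]; the sequence itself is
    forgotten. *)
Inductive regideal m : nat -> ideal A -> Prop :=
| reg0 : regideal m 0 (zeroS A^o)
| regS k J x : regideal m k J -> x \in m -> (forall a, a * x \in J -> a \in J) ->
    regideal m k.+1 (addI J x).

Lemma reg_sub m k J : regideal m k J -> {subset J <= m}.
Proof.
elim=> [|{}k {}J x _ Jm xm _]; first by move=> x /zeroSP->; rewrite ideal0.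
exact: addI_min.
Qed.

Lemma prime_chain m k J : regideal m k J -> forall p, isprime p -> {subset J <= p} ->
  exists c : nat -> ideal A, [/\ forall i, (i <= k)%N -> isprime (c i),
    strict_chain k (fun i => c i : {pred A}) & c k = p].
Proof.
elim=> [p pp _|{}k {}J x _ IH xm xJ p pp Jp].
  by exists (fun _ => p).
have Jp' : {subset J <= p} by move=> z /(addI_sub x)/Jp.
have [q [qp Jq qp' xq]] := prime_sep pp Jp' xJ.
have [c [cp cs ck]] := IH q qp Jq.
exists (fun i => if (i <= k)%N then c i else p); split=> [i|i|]; last by rewrite ltnn.
  by case: ifP => ik _ //; apply: cp.
rewrite ltnS => ik; rewrite ik; case: ltnP => ik'; first exact: cs.
have -> : i = k by apply/eqP; rewrite eqn_leq ik.
rewrite ck; split=> //; exists x => //; exact/Jp/addI_gen.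
Qed.

(** Turns a prime submodule of A^o into a [prime_idealr], the type that occurs in [has_dim]. *)
Definition primep p (h : isprime p) : A -> bool := fun x => x \in p.

Fact primep_ideal p (h : isprime p) : idealr_closed (primep h).
Proof.
split=> [||a u v up vp]; [exact: ideal0|exact: h.1|].
by apply: idealD vp; apply: idealM up.
Qed.
HB.instance Definition _ p (h : isprime p) :=
  isIdealr.Build A (primep h) (@primep_ideal p h).

Fact primep_prime p (h : isprime p) : prime_idealr_closed (primep h).
Proof. by move=> u v /h.2 uv; apply/orP. Qed.
HB.instance Definition _ p (h : isprime p) :=
  isPrimeIdealrClosed.Build A (primep h) (@primep_prime p h).

Definition primeI p (h : isprime p) : prime_idealr A :=
  PrimeIdealr.clone A (primep h) _.

Lemma primeIE p (h : isprime p) x : (x \in primeI h) = (x \in p).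
Proof. by []. Qed.

Section Local.
Variable m : ideal A.
Hypothesis lm : is_local m.

Lemma local_prime : isprime m.
Proof.
split=> [|a b ab]; first exact: lm.1.
case: (boolP (a \in m)) => [|/(local_unit lm)[c ca]]; [by left|right].
by rewrite -[b]mul1r -ca -mulrA idealM.
Qed.

Lemma reg_dim k J d : has_dim A^o d -> regideal m k J -> (k <= d)%N.
Proof.
move=> [_ md] rJ; apply: md.
have [c [cp cs ck]] := prime_chain rJ local_prime (reg_sub rJ).
(* Beyond index [k] the ideals [c i] need not be prime; [m] serves as default there. *)
pose c' i := match pselect (isprime (c i)) with
  | left h => primeI h | right _ => primeI local_prime end.
have cE i : (i <= k)%N -> c' i =i c i.
  by move=> ik; rewrite /c'; case: pselect => [h|[]]; [exact: primeIE|exact: cp].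
exists c'; split=> [i ik|i ik a h]; last first.
  by have := h 1; rewrite -[_ *: _]/(a * 1) mulr1 => ->; rewrite cE // ideal0.
have [cc [x xc xn]] := cs i ik; have e1 := cE i (ltnW ik); have e2 := cE i.+1 ik.
split=> [y|].
  by move=> yi; have := cc y; rewrite -e1 -e2; apply.
by exists x; [have := xc; rewrite -e2|have := xn; rewrite -e1].
Qed.

(** * Associated primes and the socle of A/J *)

Section Socle.
Variable J : ideal A.

(** The annihilator of [w] in A/J is maximal among annihilators of nonzero elements, hence a maximal
    associated prime. *)
Definition maxann w := w \notin J /\ forall w', w' \notin J ->
  {subset colon J w <= colon J w'} -> {subset colon J w' <= colon J w}.

Lemma maxann_prime w : maxann w -> isprime (colon J w).
Proof.
move=> [wJ mw]; split=> [|a b]; first by rewrite colonE mul1r.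
rewrite !colonE => ab; case: (boolP (b * w \in J)) => bw; [by right|left].
rewrite -colonE; apply: (mw (b * w)) => //; last by rewrite colonE mulrA.
by move=> c; rewrite !colonE => cw; rewrite mulrCA idealM.
Qed.

Lemma maxann_above z : z \notin J -> exists w, maxann w /\ {subset colon J z <= colon J w}.
Proof.
move=> zJ; pose Q K := exists w, [/\ w \notin J, {subset colon J z <= colon J w} & K = colon J w].
have [|K [[w [wJ zw ->]] mK]] := @max_ideal Q; first by exists (colon J z), z; split.
exists w; split=> //; split=> // w' wJ' ww'; apply: mK => //.
by exists w'; split=> // x /zw/ww'.
Qed.

Definition inspan (s : seq A) w := forall K, {subset s <= K} -> w \in K.

(** Maximizing the generated ideal yields finitely many such elements; they stand in for the
    finiteness of the set of maximal associated primes. *)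
Lemma fin_maxann : exists s : seq A, (forall w, w \in s -> maxann w) /\
  forall w, maxann w -> inspan s w.
Proof.
pose Q K := exists s : seq A, (forall w, w \in s -> maxann w) /\
  K = submod_gen (fun w : A^o => w \in s).
have [|K [[s [hs ->]] mK]] := @max_ideal Q;
  first by exists (submod_gen (fun w : A^o => w \in [::])), [::].
exists s; split=> // w mw L sL.
have : w \in submod_gen (fun w : A^o => w \in s).
  apply: (mK (submod_gen (fun v : A^o => v \in w :: s))).
  - exists (w :: s); split=> // v; rewrite inE => /orP[/eqP->//|]; exact: hs.
  - move=> v /asboolP hv; apply/asboolP => S hS; apply: hv => y ys; apply: hS.
    by rewrite /= inE ys orbT.
  - by apply/asboolP => S; apply; rewrite /= inE eqxx.
by move/asboolP; apply => y; apply: sL.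
Qed.

Lemma prod_avoid (q : ideal A) (s : seq A) : isprime q ->
    (forall w, w \in s -> exists2 c, c \in colon J w & c \notin q) ->
  exists2 c, (forall w, w \in s -> c \in colon J w) & c \notin q.
Proof.
move=> [q1 qp]; elim: s => [|w s IH] h; first by exists 1.
have [|c cs cq] := IH; first by move=> v vs; apply: h; rewrite inE vs orbT.
have [|b bw bq] := h w; first by rewrite inE eqxx.
exists (b * c); last by apply/negP => /qp[]; apply/negP.
move=> v; rewrite inE => /orP[/eqP->|vs]; last exact/idealM/cs.
by rewrite mulrC idealM.
Qed.

(** Prime avoidance by induction on [s]: an element that avoids the earlier primes but lies in the
    new one is corrected by a multiple of some [c] lying in all the earlier ones. *)
Lemma avoid (s : seq A) : (forall w, w \in s -> maxann w) ->
    (forall w, w \in s -> exists2 y, y \in m & y \notin colon J w) ->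
  exists2 y, y \in m & forall w, w \in s -> y \notin colon J w.
Proof.
elim: s => [|w s IH] hs hm; first by exists 0; rewrite // ideal0.
have [||a am as_] := IH; [by move=> v vs; apply: hs; rewrite inE vs orbT|
  by move=> v vs; apply: hm; rewrite inE vs orbT|].
have mw : maxann w by apply: hs; rewrite inE eqxx.
case: (boolP (a \in colon J w)) => aw; last first.
  by exists a => // v; rewrite inE => /orP[/eqP->//|]; apply: as_.
have [c cs cw] : exists2 c, (forall v, v \in s -> c \in colon J v) & c \notin colon J w.
  apply: prod_avoid (maxann_prime mw) _ => v vs; apply: contrapT => no.
  have vw : {subset colon J v <= colon J w}.
    by move=> c cv; apply: contrapT => /negP cw; apply: no; exists c.
  have mv : maxann v by apply: hs; rewrite inE vs orbT.
  by move/negP: (as_ v vs); apply; apply: mv.2 _ mw.1 vw _ aw.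
have [|y0 ym yw] := hm w; first by rewrite inE eqxx.
exists (a + y0 * c); first by rewrite idealD // mulrC idealM.
move=> v; rewrite inE => /orP[/eqP->|vs].
  apply/negP => h; have : y0 * c \in colon J w by rewrite -[y0 * c](addKr a) addrC idealB.
  by case/(maxann_prime mw).2; apply/negP.
apply/negP => h; move/negP: (as_ v vs); apply.
by rewrite -[a](addrK (y0 * c)) idealB // idealM // cs.
Qed.

Lemma socle_or_regular :
  (exists2 x, x \in m & forall a, a * x \in J -> a \in J) \/
  (exists2 s, s \notin J & forall y, y \in m -> y * s \in J).
Proof.
have [s [hs sp]] := fin_maxann.
have [[w [ws hw]]|no] := EM (exists w, w \in s /\ {subset m <= colon J w}).
  right; exists w; first exact: (hs w ws).1.
  by move=> y /hw; rewrite colonE.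
have [//|w ws|y ym hy] := @avoid s.
  apply: contrapT => no'; apply: no; exists w; split=> // y ym.
  by apply: contrapT => /negP yw; apply: no'; exists y.
left; exists y => // a ay; apply: contrapT => /negP aJ.
have [w [mw aw]] := maxann_above aJ.
(* Otherwise some [c] outside the prime [colon J w] multiplies all of [s] into [J], hence also [w],
   which the elements of [s] span. *)
have [v vs vw] : exists2 v, v \in s & {subset colon J v <= colon J w}.
  apply: contrapT => nov.
  have [v vs|c cs /negP[]] := @prod_avoid (colon J w) s (maxann_prime mw).
    apply: contrapT => no'; apply: nov; exists v => // c cv.
    by apply: contrapT => /negP cw; apply: no'; exists c.
  rewrite colonE mulrC -colonE; apply: (sp w mw) => v vs.
  by rewrite colonE mulrC -colonE cs.
move/negP: (hy v vs); apply; apply: (hs v vs).2 mw.1 vw _ _.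
by apply: aw; rewrite colonE mulrC.
Qed.

(* The primes of the form [colon J w] are the associated primes of [A / J]. *)
Lemma nilpotent_mod : (forall w, w \notin J -> isprime (colon J w) -> {subset m <= colon J w}) ->
  forall y, y \in m -> exists c, y ^+ c \in J.
Proof.
move=> hass y ym; apply: contrapT => no.
have yJ c : y ^+ c \notin J by apply/negP => h; apply: no; exists c.
pose Q K := exists c, K = colon J (y ^+ c).
have [|_ [[c ->] mc]] := @max_ideal Q; first by exists (colon J (y ^+ 0)), 0%N.
have stab z : z * y ^+ c.+1 \in J -> z * y ^+ c \in J.
  rewrite -!colonE; apply: mc; first by exists c.+1.
  by move=> t; rewrite !colonE exprS mulrCA; apply: idealM.
pose Q' K := exists z, y ^+ c * z \notin J /\ K = colon J (y ^+ c * z).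
have [|_ [[z [zJ ->]] mz]] := @max_ideal Q'.
  by exists (colon J (y ^+ c * 1)), 1; rewrite mulr1.
have pq : isprime (colon J (y ^+ c * z)).
  split=> [|a b]; first by rewrite colonE mul1r.
  rewrite !colonE => ab; case: (boolP (b * (y ^+ c * z) \in J)) => bw; [by right|left].
  rewrite -colonE; apply: (mz (colon J (y ^+ c * (b * z)))).
  - by exists (b * z); split; rewrite // mulrCA.
  - by move=> t; rewrite !colonE [y ^+ c * (b * z)]mulrCA [t * (b * _)]mulrCA; apply: idealM.
  have e : a * (y ^+ c * (b * z)) = a * b * (y ^+ c * z) by rewrite -mulrA; congr (a * _);
    rewrite mulrCA.
  by rewrite colonE e.
have := hass _ zJ pq y ym; rewrite colonE mulrA -exprS mulrC => /stab.
by rewrite mulrC; apply/negP.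
Qed.

End Socle.
End Local.
End Ideals.

(** * Finite injective dimension and total reflexivity *)

Section Vanishing.
Variable A : comNzRingType.
Implicit Types F K U V W X Y Z : lmodType A.
Hypothesis noeA : noetherian A.
Variable m : ideal A.
Hypothesis lm : is_local m.

Variables (n : nat) (E : nat -> lmodType A) (e : {linear A^o -> E 0%N})
  (d : forall i, {linear E i -> E i.+1}).
Hypothesis Einj : forall i, injective_module (E i).
Hypothesis E0 : forall i, (n < i)%N -> zero_module (E i).
Hypothesis einj : injective e.
Hypothesis eexact : exact_at e (d 0).
Hypothesis dexact : forall i, exact_at (d i) (d i.+1).

(* [Ext^r(X, A)] is the module of cocycles [X -> E r] modulo the coboundaries [bd]. *)
Definition bd r X : (X -> E r) -> Prop :=
  match r with
  | 0 => fun f => forall x, f x = 0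
  | r'.+1 => fun f => exists g : {linear X -> E r'}, forall x, f x = d r' (g x)
  end.

Definition van r X := forall f : {linear X -> E r}, (forall x, d r (f x) = 0) -> bd f.

Lemma dd r x : d r.+1 (d r x) = 0.
Proof. by apply/dexact; exists x. Qed.

Lemma bd_ext r U V (i : {linear U -> V}) (f : {linear U -> E r}) :
  injective i -> bd f -> exists g : {linear V -> E r}, (forall x, g (i x) = f x) /\ bd g.
Proof.
case: r f => [|r] f ii /= => [f0|[g hg]].
  by exists (zeroL _ _); split=> // x; rewrite f0.
have [h hh] := Einj g ii; exists (d r \o h)%FUN; split; last by exists h.
by move=> x /=; rewrite hh hg.
Qed.

Lemma bd_cocycle r X (f : X -> E r) x : bd f -> d r (f x) = 0.
Proof.
by case: r f => [|r] f /= => [->|[g ->]]; rewrite ?linear0 ?dd.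
Qed.

Lemma bd_comp r X Y (h : {linear X -> Y}) (f : Y -> E r) : bd f -> bd (fun x => f (h x)).
Proof.
by case: r f => [|r] f /= => [f0 x|[g hg]]; [rewrite f0|exists (g \o h)%FUN => x; rewrite hg].
Qed.

Lemma bd_eq r X (f g : X -> E r) : f =1 g -> bd f -> bd g.
Proof. by move=> /funext ->. Qed.

Lemma bd_lin r X a (f g : X -> E r) : bd f -> bd g -> bd (fun x => a *: f x + g x).
Proof.
case: r f g => [|r] f g /= => [f0 g0 x|[u hu] [v hv]]; first by rewrite f0 g0 scaler0 addr0.
have lP : linear (fun x => a *: u x + v x).
  move=> c x y; rewrite (linearP u) (linearP v) scalerDr addrACA.
  by rewrite [in RHS]scalerDr !scalerA [c * a]mulrC.
by exists (mklin lP) => x; rewrite hu hv -linearP.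
Qed.

Lemma bd0 r X : bd (fun _ : X => 0 : E r).
Proof. by case: r => //= r; exists (zeroL _ _) => x; rewrite linear0. Qed.

Lemma linB X Y (f g : {linear X -> Y}) : exists h : {linear X -> Y}, forall x, h x = f x - g x.
Proof.
have lP : linear (fun x => f x - g x).
  by move=> a x y; rewrite (linearP f) (linearP g) opprD addrACA scalerBr.
by exists (mklin lP).
Qed.

(** This lemma and the next two replace the long exact sequence of Ext(-, A) at its three positions:
    cocycles and coboundaries are extended by injectivity and corrected until they descend to the
    quotient. *)
Lemma van_mid r X Y Z (i : {linear X -> Y}) (p : {linear Y -> Z}) :
  ses i p -> van r X -> van r Z -> van r Y.
Proof.
move=> s vX vZ f fc; have [ii ps ex] := s.
have bX : bd (f \o i)%FUN by apply: vX => x; apply: fc.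
have [g [hg bg]] := bd_ext (f := (f \o i)%FUN) ii bX.
have [h hh] := linB f g.
have [x /ex[y <-]|k hk] := factor_surj (p := p) (f := h) ps.
  by rewrite hh hg subrr.
have /(bd_comp p) bk : bd k.
  apply: vZ => z; have [y <-] := ps z; rewrite hk hh linearB fc.
  by rewrite (bd_cocycle _ bg) subr0.
apply: bd_eq (bd_lin 1 bk bg) => x.
by rewrite hk hh scale1r subrK.
Qed.

Lemma van_left r X Y Z (i : {linear X -> Y}) (p : {linear Y -> Z}) :
  ses i p -> van r.+1 Z -> van r Y -> van r X.
Proof.
move=> s vZ vY f fc; have [ii ps ex] := s.
have [u hu] := Einj f ii.
have [x /ex[y <-]|h hh] := factor_surj (p := p) (f := (d r \o u)%FUN) ps.
  by rewrite /= hu fc.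
have [z|w hw] := vZ h.
  by have [y <-] := ps z; rewrite hh; apply: dd.
have [g hg] := linB u (w \o p)%FUN.
have /(bd_comp i) : bd g.
  by apply: vY => y; rewrite hg linearB -[d r (u y)]/((d r \o u)%FUN y) -hh hw subrr.
apply: bd_eq => x.
by rewrite hg hu /= (ses0 x s) linear0 subr0.
Qed.

Lemma van_right r X Y Z (i : {linear X -> Y}) (p : {linear Y -> Z}) :
  ses i p -> van r X -> van r.+1 Y -> van r.+1 Z.
Proof.
move=> s vX vY h hc; have [ii ps ex] := s.
have [y|v hv] := vY (h \o p)%FUN; first exact: hc.
have bX : bd (v \o i)%FUN.
  by apply: vX => x; rewrite /= -hv /= (ses0 x s) linear0.
have [g [hg bg]] := bd_ext (f := (v \o i)%FUN) ii bX.
have [w hw] := linB v g.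
have [x /ex[y <-]|k hk] := factor_surj (p := p) (f := w) ps.
  by rewrite hw hg subrr.
exists k => z; have [y <-] := ps z.
by rewrite hk hw linearB (bd_cocycle _ bg) subr0 -hv.
Qed.

(** Extending [f] along multiplication by [y] divides it by [y]; vanishing on the cokernel [Z]
    allows the extension to be corrected to a cocycle. *)
Lemma van_scale r X Z (y : A) (p : {linear X -> Z}) :
    ses (scaleL X y) p -> van r.+1 Z ->
  forall f : {linear X -> E r}, (forall x, d r (f x) = 0) ->
  exists2 f' : {linear X -> E r}, forall x, d r (f' x) = 0 & forall x, f x = y *: f' x.
Proof.
move=> s vZ f fc; have [ii ps ex] := s; have [u hu] := Einj f ii.
have [x /ex[z <-]|h hh] := factor_surj (p := p) (f := (d r \o u)%FUN) ps.
  by rewrite /= hu fc.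
have [z|w hw] := vZ h.
  by have [x <-] := ps z; rewrite hh; apply: dd.
have [g hg] := linB u (w \o p)%FUN; exists g => x.
  by rewrite hg linearB -[d r (u x)]/((d r \o u)%FUN x) -hh hw subrr.
by rewrite -linM hg -[y *: x]/(scaleL X y x) hu /= (ses0 x s) linear0 subr0.
Qed.

Lemma van_free r F : isfree F -> van r.+1 F.
Proof.
move=> fF f fc; have [x|g hg] := free_lift (p := d r) (f := f) fF.
  by apply/dexact.
by exists g.
Qed.

Lemma van_retract r X Y (i : {linear X -> Y}) (p : {linear Y -> X}) :
  cancel i p -> van r Y -> van r X.
Proof.
move=> ip vY f fc; have /(bd_comp i) : bd (f \o p)%FUN by apply: vY => y; apply: fc.
by apply: bd_eq => x /=; rewrite ip.
Qed.

Lemma van_iso r X Y : iso X Y -> van r X -> van r Y.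
Proof.
move=> /iso_sym[f [fi fs]]; have [g [fg gf]] := iso_inv fi fs.
exact: van_retract fg.
Qed.

Lemma ses_prod_fst X Y : ses (inlL X Y) (sndL X Y).
Proof.
split; first by move=> x y [].
  by move=> y; exists (0, y).
move=> [x y]; split=> [/= h|[z [_ <-]] //]; first by exists x; congr pair.
Qed.

Lemma van_sim r X Y : sim X Y -> van r.+1 X -> van r.+1 Y.
Proof.
move=> [F [G [fF fG h]]] vX.
have /(van_iso h) v : van r.+1 (X * F)%type.
  by apply: van_mid (ses_prod_fst X F) vX _; apply: van_free.
apply: (van_retract (i := inlL Y G) (p := fstL Y G)) v => x //.
Qed.

(** Extend [phi] as a map into [E 0], then correct it by a map factoring through [Z] until its
    values are cocycles, that is, elements of the ring. *)
Lemma van_ext1 X Y Z (i : {linear X -> Y}) (p : {linear Y -> Z}) :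
    ses i p -> van 1 Z ->
  forall phi : {linear X -> A^o}, exists psi : {linear Y -> A^o}, forall x, psi (i x) = phi x.
Proof.
move=> s vZ phi; have [ii ps ex] := s.
have [u hu] := Einj (e \o phi)%FUN ii.
have de x : d 0 (e x) = 0 by apply/eexact; exists x.
have [x /ex[y <-]|h hh] := factor_surj (p := p) (f := (d 0 \o u)%FUN) ps.
  by rewrite /= hu /= de.
have [z|w hw] := vZ h.
  by have [y <-] := ps z; rewrite hh; apply: dd.
have [g hg] := linB u (w \o p)%FUN.
have [x|psi hpsi] := factor_inj (f := g) einj.
  by apply/eexact; rewrite hg linearB -[d 0 (u x)]/((d 0 \o u)%FUN x) -hh hw subrr.
exists psi => x; apply: einj; rewrite hpsi hg hu /= (ses0 x s) linear0 subr0 //.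
Qed.

Lemma van_big r X : (n < r)%N -> van r X.
Proof.
case: r => // r nr f _; exists (zeroL _ _) => x.
by rewrite linear0; apply: E0.
Qed.

Lemma fgen_dual X : fgen X -> fgen (dual_mod X).
Proof.
move=> [k [f fs]]; apply: (fgen_sub noeA (f := dmap f)).
  move=> phi psi eq; apply: dual_ext => x; have [v <-] := fs x.
  by rewrite -!dmapE eq.
by apply/free_fgen/free_dual/free_rV.
Qed.

Lemma lin_sum X Y k (h : 'I_k -> {linear X -> Y}) (c : 'I_k -> A) :
  exists g : {linear X -> Y}, forall x, g x = \sum_i c i *: h i x.
Proof.
have lP : linear (fun x => \sum_i c i *: h i x).
  move=> a x y; rewrite scaler_sumr -big_split; apply: eq_bigr => i _ /=.
  by rewrite linearP scalerDr !scalerA mulrC.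
by exists (mklin lP).
Qed.

Lemma fct_comb X Y k (c : 'I_k -> A) (f : 'I_k -> X -> Y) x :
  (\sum_i c i *: f i) x = \sum_i c i *: f i x.
Proof. by apply: (big_ind2 (fun (f : X -> Y) a => f x = a)) => // g a h b <- <-. Qed.

(* [Ext^r(X, A)] is finitely generated, by dimension shifting along a free
   resolution: the cocycle modules of the injective resolution are not. *)
Lemma ext_fgen r X : fgen X -> exists k (h : 'I_k -> {linear X -> E r}),
  (forall i x, d r (h i x) = 0) /\
  forall f : {linear X -> E r}, (forall x, d r (f x) = 0) ->
  exists c : 'I_k -> A, bd (fun x => f x - \sum_i c i *: h i x).
Proof.
elim: r X => [|r IH] X fX.
  have [k [p ps]] := fgen_dual fX.
  exists k, (fun i => (e \o dval (p (delta_mx ord0 i)))%FUN); split.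
    by move=> i x /=; apply/eexact; exists (dval (p (delta_mx ord0 i)) x).
  move=> f fc; have [x|phi hphi] := factor_inj (f := f) einj; first exact/eexact.
  have [v ev] := ps (dmk phi); exists (v ord0) => x.
  rewrite -hphi; have -> : phi x = \sum_i (v ord0 i : A) *: dval (p (delta_mx ord0 i)) x.
    rewrite -[phi x]/(dval (dmk phi) x) -ev row_mapE.
    exact: (dval_comb (fun i => v ord0 i)).
  rewrite linear_sum -sumrB big1 // => i _.
  by rewrite linM subrr.
have sX := cover_ses lm fX; have [ii ps ex] := sX.
have [k [h [hc hh]]] := IH _ (fgen_syz noeA m fX).
have H1 i := Einj (h i) ii; pose h1 i := sval (cid (H1 i)).
have h1E i x : h1 i (val x) = h i x := svalP (cid (H1 i)) x.
have H2 i : exists g : {linear X -> E r.+1}, forall v, g (Defs.cover m X v) = d r (h1 i v).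
  have [x /ex[y <-]|g hg] := factor_surj (f := (d r \o h1 i)%FUN) ps; last by exists g.
  by rewrite /= h1E hc.
pose h2 i := sval (cid (H2 i)).
have h2E i v : h2 i (Defs.cover m X v) = d r (h1 i v) := svalP (cid (H2 i)) v.
exists k, h2; split=> [i x|f fc].
  by have [v <-] := ps x; rewrite h2E dd.
have [v|g hg] := @free_lift _ _ _ _ (d r) (f \o Defs.cover m X)%FUN (free_rV A _).
  by apply/dexact; apply: fc.
have [x|c bc] := hh (g \o sval_lin _)%FUN.
  by rewrite /= hg /= (ses0 x sX) linear0.
have [s1 hs1] := lin_sum h c; have [s2 hs2] := lin_sum h1 c.
have [b hb] := linB (g \o sval_lin _)%FUN s1.
have bb : bd b by apply: bd_eq bc => x; rewrite hb hs1.
have [b1 [hb1 bb1]] := bd_ext ii bb.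
have [t1 ht1] := linB g s2; have [t ht] := linB t1 b1.
have [v /ex[x <-]|T hT] := factor_surj (f := t) ps.
  rewrite ht ht1 hb1 hb hs1 hs2 /=; under eq_bigr => i _ do rewrite h1E.
  by rewrite subrr.
exists c, T => x; have [v <-] := ps x.
rewrite hT ht ht1 linearB (bd_cocycle _ bb1) subr0 linearB hg hs2 [d r (\sum_i _)]linear_sum.
by congr (_ - _); apply: eq_bigr => i _; rewrite h2E linM.
Qed.

(** Nakayama's lemma for Ext^r(X, A), realized as the image of the cocycles in the functions X -> E
    r modulo coboundaries. *)
Lemma van_nakayama r X y : fgen X -> y \in m ->
    (forall f : {linear X -> E r}, (forall x, d r (f x) = 0) ->
     exists2 f' : {linear X -> E r}, forall x, d r (f' x) = 0 & forall x, f x = y *: f' x) ->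
  van r X.
Proof.
move=> fX ym hy.
have Zc : pclosed (fun f : X -> E r => f \in homS X (E r) /\ forall x, d r (f x) = 0).
  split=> [|a f g [fh fc] [gh gc]]; first by split=> [|x]; rewrite ?rpred0 // linear0.
  split=> [|x]; first by rewrite rpredD ?rpredZ.
  by rewrite -[(_ + _) x]/(a *: f x + g x) linearP fc gc scaler0 addr0.
have Bc : pclosed (fun f : X -> E r => bd f).
  by split=> [|a f g bf bg]; [apply: bd0|apply: bd_lin].
pose B := psub Bc; pose Z := psub Zc; pose Q : lmodType A := smod (im (qlin B) Z).
have Qmk f : f \in Z -> qlin B f \in im (qlin B) Z by move=> fZ; apply/imP; exists f.
have linZ (f : {linear X -> E r}) : (forall x, d r (f x) = 0) -> (f : X -> E r) \in Z.
  by move=> fc; apply/psubP; split=> //; apply: homS_mk.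
suff Q0 : forall x : Q, x = 0.
  move=> f fc; have fZ := linZ f fc.
  have /(congr1 val)/qlin0/psubP : mksmod (Qmk f fZ) = 0 by apply: Q0.
  by [].
have repr (q : Q) : exists f : {linear X -> E r}, (forall x, d r (f x) = 0) /\ val q = qlin B f.
  have /imP[f /psubP[fh fc] ef] := valP q; by exists (homS_lin fh); split.
apply: (nakayama lm _ ym) => [|q].
  have [k [h [hc hh]]] := ext_fgen r fX.
  apply: (@fgen_fam _ _ _ (fun i => mksmod (Qmk _ (linZ _ (hc i))))) => q.
  have [f [fc ef]] := repr q; have [c bc] := hh f fc; exists c; apply: val_inj.
  rewrite ef -[RHS]/(sval_lin _ _) linear_sum.
  under [RHS]eq_bigr => i _ do rewrite linM -[sval_lin _ _]/(qlin B (h i)) -linM.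
  rewrite -linear_sum; apply/eqP; rewrite -subr_eq0 -linearB; apply/eqP/qlin0/psubP.
  apply: bd_eq bc => x.
  rewrite -[RHS]/(f x - _ x); congr (_ - _).
  exact/esym/fct_comb.
have [f [fc ef]] := repr q; have [f' fc' hf'] := hy f fc.
exists (mksmod (Qmk _ (linZ _ fc'))); apply: val_inj; rewrite ef.
rewrite -[RHS]/(sval_lin _ (y *: (mksmod (Qmk _ (linZ _ fc')) : Q))) linM.
rewrite -[sval_lin _ _]/(qlin B (f' : X -> E r)) -linM; congr (qlin B _); apply/funext => x.
by rewrite hf'.
Qed.

(** * Syzygies up to free summands *)

Lemma syz_sim X Y : fgen X -> sim X Y -> sim (syz m X) (syz m Y).
Proof.
move=> fX sXY; have fY := sim_fgen sXY fX.
exact: schanuel (free_rV A _) (free_rV A _) (cover_ses lm fX) (cover_ses lm fY) sXY.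
Qed.

Lemma ses_syz_sim K F X (f : {linear K -> F}) (g : {linear F -> X}) :
  isfree F -> fgen X -> ses f g -> sim (syz m X) K.
Proof.
move=> fF fX s; exact: schanuel (free_rV A _) fF (cover_ses lm fX) s (sim_refl X).
Qed.

Definition sfree X := sim X 'rV[A]_0.

Lemma sfree_syz X : sfree X -> sfree (syz m X).
Proof.
move=> sX; have f0 := fgen_rV A 0.
apply: sim_trans (syz_sim (sim_fgen (sim_sym sX) f0) sX) _.
have zs : ses (zeroL 'rV[A]_0 'rV[A]_0) (idL _).
  split; first by move=> x y _; apply/matrixP => i [].
    by move=> x; exists x.
  move=> y; have -> : y = 0 by apply/matrixP => i [].
  by split=> // _; exists 0.
exact: ses_syz_sim (free_rV A 0) f0 zs.
Qed.

(** Over a stably free middle term, the left term is a syzygy of the right one. This is what shifts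
    [Omega] by one. *)
Lemma tri_free X Y Z : fgen Z -> tri X Y Z -> sfree Y -> sim X (syz m Z).
Proof.
move=> fZ [X' [Y' [Z' [f [g [sX sY sZ s]]]]]] Y0.
have [F [G [fF fG h]]] := sim_trans (sim_sym sY) Y0.
have fYF : isfree (Y' * F)%type.
  have [k hk] := free_prod (free_rV A 0) fG; exists k; exact: iso_trans h hk.
have sZF := sim_trans sZ (sim_prodF Z' fF).
apply: sim_trans sX _.
exact: schanuel fYF (free_rV A _) (ses_addF F s) (cover_ses lm fZ) (sim_sym sZF).
Qed.

Lemma tri_fgen X Y Z : fgen X -> fgen Z -> tri X Y Z -> fgen Y.
Proof.
move=> fX fZ [X' [Y' [Z' [f [g [sX sY sZ s]]]]]].
apply: sim_fgen (sim_sym sY) _.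
exact: fgen_ext s (sim_fgen sX fX) (sim_fgen sZ fZ).
Qed.

Lemma tri_syz X Y Z : fgen X -> fgen Z -> tri X Y Z -> tri (syz m X) (syz m Y) (syz m Z).
Proof.
move=> fX fZ t; have fY := tri_fgen fX fZ t.
have [X' [Y' [Z' [f [g [sX sY sZ s]]]]]] := t.
have fX' := sim_fgen sX fX; have fY' := sim_fgen sY fY; have fZ' := sim_fgen sZ fZ.
have [h [u [v [ho suv _ _]]]] := horseshoe (free_rV A _) s (cover_ses lm fX') (cover_ses lm fZ').
have sK := ses_syz_sim (free_prod (free_rV A _) (free_rV A _)) fY' (ses_ker ho).
apply: tri_sim (ses_tri suv).
- exact: syz_sim fX' (sim_sym sX).
- exact: sim_trans (sim_sym sK) (syz_sim fY' (sim_sym sY)).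
- exact: syz_sim fZ' (sim_sym sZ).
Qed.

(* Totally reflexive modules: the ring having finite injective dimension, the
   vanishing of all [Ext^i(X, A)] suffices. *)
Definition totref X := fgen X /\ forall r, van r.+1 X.

Lemma totref_sim X Y : sim X Y -> totref X -> totref Y.
Proof. by move=> s [fX vX]; split; [apply: sim_fgen s fX|move=> r; apply: van_sim s _]. Qed.

Lemma van_syz r X : fgen X -> van r.+2 X -> van r.+1 (syz m X).
Proof.
by move=> fX vX; apply: van_left (cover_ses lm fX) vX _; apply/van_free/free_rV.
Qed.

Lemma totref_syz X : totref X -> totref (syz m X).
Proof. by move=> [fX vX]; split=> [|r]; [apply: fgen_syz|apply: van_syz]. Qed.

Lemma totref_vext X : totref X -> vext m X.
Proof. by move=> [fX vX] phi; apply: (van_ext1 (cover_ses lm fX)). Qed.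

Lemma dual_cover X : totref X ->
  ses (dmap (Defs.cover m X)) (dmap (sval_lin (ker (Defs.cover m X)))).
Proof. by move=> gX; apply: dual_ses (cover_ses lm gX.1) (totref_vext gX). Qed.

(** By [dual_cover], vanishing of Ext^(r+1) on the dual of [Y] follows from vanishing of Ext^(r+2)
    on the dual of its syzygy. After enough steps the degree exceeds the injective dimension [n]. *)
Lemma totref_dual X : totref X -> totref (dual_mod X).
Proof.
move=> gX; split; first exact: fgen_dual gX.1.
suff H j r Y : totref Y -> (n <= r + j)%N -> van r.+1 (dual_mod Y).
  by move=> r; apply: (H n) => //; apply: leq_addl.
elim: j r Y => [|j IH] r Y gY nr; first by apply: van_big; rewrite ltnS -[r]addn0.
apply: van_left (dual_cover gY) _ _.
  by apply: IH (totref_syz gY) _; rewrite addSnnS.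
exact/van_free/free_dual/free_rV.
Qed.

(** Surjectivity is inherited from the free cover. Injectivity then follows from surjectivity for
    the syzygy of [X], so the first claim is proved for all totally reflexive modules. *)
Lemma bidual_iso X : totref X -> iso X (dual_mod (dual_mod X)).
Proof.
have S Y : totref Y -> onto (bidual Y).
  move=> gY z; have [_ ps _] := dual_ses (dual_cover gY)
    (van_ext1 (dual_cover gY) ((totref_dual (totref_syz gY)).2 0%N)).
  have [z' <-] := ps z.
  have [v <-] := (bidual_free (free_rV A _)).2 z'.
  by exists (Defs.cover m Y v); rewrite -bidual_nat.
move=> gX; exists (bidual X); split; last exact: S.
apply: lin_inj => x; have [_ ps ex] := cover_ses lm gX.1.
have [v <-] := ps x => e0.
have [_ _ ex2] := dual_ses (dual_cover gX)
  (van_ext1 (dual_cover gX) ((totref_dual (totref_syz gX)).2 0%N)).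
have /ex2[z ez] : dmap (dmap (Defs.cover m X)) (bidual _ v) = 0 by rewrite bidual_nat.
have [k ek] := S _ (totref_syz gX) z.
move: ez; rewrite -ek bidual_nat => /(bidual_free (free_rV A _)).1 <-.
by apply/ex; exists k.
Qed.

Lemma cosyz_sim X Y : totref X -> sim X Y -> sim (cosyz m X) (cosyz m Y).
Proof.
move=> gX s; apply/sim_dual/syz_sim/sim_dual => //; exact: (totref_dual gX).1.
Qed.

Lemma totref_cosyz X : totref X -> totref (cosyz m X).
Proof. by move=> gX; apply/totref_dual/totref_syz/totref_dual. Qed.

(** The dual of the cover of [X] is a free presentation of the dual of the syzygy, with kernel the
    dual of [X]; dualize once more. *)
Lemma cosyz_syz X : totref X -> sim (cosyz m (syz m X)) X.
Proof.
move=> gX; have gD := totref_dual (totref_syz gX).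
have s : sim (syz m (dual_mod (syz m X))) (dual_mod X).
  exact: ses_syz_sim (free_dual (free_rV A _)) gD.1 (dual_cover gX).
by apply: sim_trans (sim_dual s) _; apply/sim_sym/iso_sim/bidual_iso.
Qed.

Lemma tri_dual X Y Z : totref Z -> tri X Y Z -> tri (dual_mod Z) (dual_mod Y) (dual_mod X).
Proof.
move=> gZ [X' [Y' [Z' [f [g [sX sY sZ s]]]]]].
have ds := dual_ses s (van_ext1 s ((totref_sim sZ gZ).2 0%N)).
by apply: tri_sim (ses_tri ds); apply/sim_dual/sim_sym.
Qed.

Lemma iter_syz_sim i X Y : fgen X -> sim X Y -> sim (iter i (syz m) X) (iter i (syz m) Y).
Proof.
move=> fX s; elim: i => //= i IH; apply: syz_sim IH.
exact: fgen_iter.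
Qed.

Lemma iter_tri_syz i X Y Z : fgen X -> fgen Z -> tri X Y Z ->
  tri (iter i (syz m) X) (iter i (syz m) Y) (iter i (syz m) Z).
Proof. by move=> fX fZ t; elim: i => //= i IH; apply: tri_syz IH; apply: fgen_iter. Qed.

Lemma totref_Omega k X : totref X -> totref (Omega m k X).
Proof.
move=> gX; case: k => i; rewrite /Omega; first by elim: i => //= i; apply: totref_syz.
by elim: i.+1 => //= j; apply: totref_cosyz.
Qed.

Lemma totref_cosyz_iter i X : totref X -> totref (iter i (cosyz m) X).
Proof. by move=> gX; elim: i => //= i; apply: totref_cosyz. Qed.

Lemma Omega_sim k X Y : totref X -> sim X Y -> sim (Omega m k X) (Omega m k Y).
Proof.
move=> gX s; case: k => i; rewrite /Omega; first exact: iter_syz_sim gX.1 s.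
elim: i.+1 => //= j IH; apply: cosyz_sim IH; exact: totref_cosyz_iter.
Qed.

Lemma Omega_syz k X : totref X -> sim (Omega m k (syz m X)) (Omega m (k + 1) X).
Proof.
move=> gX; case: k => [i|[|i]].
- by rewrite -PoszD addn1 /Omega iterSr; apply: sim_refl.
- exact: cosyz_syz.
have -> : Negz i.+1 + 1 = Negz i by rewrite !NegzE -addn1 PoszD opprD subrK.
rewrite /Omega [iter i.+2 _ _]iterSr.
elim: i.+1 => [|j IH] /=; first exact: cosyz_syz.
by apply: cosyz_sim IH; apply/totref_cosyz_iter/totref_cosyz/totref_syz.
Qed.

Lemma tri_Omega k X Y Z : totref X -> totref Y -> totref Z ->
  tri X Y Z -> tri (Omega m k X) (Omega m k Y) (Omega m k Z).
Proof.
move=> gX gY gZ t; case: k => i; rewrite /Omega; first exact: iter_tri_syz gX.1 gZ.1 t.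
elim: i.+1 => //= j IH.
have [gX' gY' gZ'] : [/\ totref (iter j (cosyz m) X), totref (iter j (cosyz m) Y) &
  totref (iter j (cosyz m) Z)] by split; apply: totref_cosyz_iter.
apply: tri_dual; first exact/totref_syz/totref_dual.
by apply: tri_syz; [exact: (totref_dual gZ').1|exact: (totref_dual gX').1|apply: tri_dual].
Qed.

Lemma totref_iter_syz i X : fgen X -> (forall r, (i < r)%N -> van r X) ->
  totref (iter i (syz m) X).
Proof.
move=> fX vX; split; first exact: fgen_iter.
suff H j r : (i <= r + j)%N -> van r.+1 (iter j (syz m) X) by move=> r; apply/H/leq_addl.
elim: j r => [|j IH] r ir; first by apply: vX; rewrite ltnS -[r]addn0.
by apply: van_syz; [apply: fgen_iter|apply: IH; rewrite addSnnS].
Qed.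

(** * Cyclic modules and Bass' argument *)

Lemma qmod1 (J : ideal A) (x : qmod J) : exists a : A, x = qlin J a.
Proof. by have [a <-] := qlin_surj x; exists a. Qed.

Lemma qlinM (J : ideal A) (x a : A) : scaleL (qmod J) x (qlin J a) = qlin J (x * a : A).
Proof. by rewrite -[RHS]/(qlin J (x *: (a : A^o))) linM. Qed.

Lemma qmod_map (J K : ideal A) (b : A) : (forall x : A, x \in J -> x * b \in K) ->
  exists f : {linear qmod J -> qmod K}, forall a : A, f (qlin J a) = qlin K (a * b : A).
Proof.
move=> h; have bP : linear (fun a : A^o => (a * b : A^o)).
  by move=> c x y; rewrite -[LHS]/((c * x + y) * b) mulrDl -[RHS]/(c * (x * b) + y * b) mulrA.
have [x /qlin0 xJ|f hf] := @factor_surj _ _ _ _ (qlin J) (qlin K \o mklin bP)%FUN (@qlin_surj _ _ J).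
  by apply/qlin0/h.
by exists f => a; rewrite hf.
Qed.

Lemma qmod_iso (J K : ideal A) : J =i K -> iso (qmod J) (qmod K).
Proof.
move=> e'; have [x|f hf] := @qmod_map J K 1; first by rewrite mulr1 e'.
exists f; split.
  apply: lin_inj => x; have [a ->] := qmod1 x.
  by rewrite hf mulr1 => /qlin0; rewrite -e' => /qlin0.
by move=> y; have [a ->] := qmod1 y; exists (qlin J a); rewrite hf mulr1.
Qed.

Lemma qmod_quo (J K : ideal A) : {subset J <= K} ->
  exists g : {linear qmod J -> qmod K}, onto g /\ forall a : A, g (qlin J a) = qlin K a.
Proof.
move=> JK; have [x|f hf] := @qmod_map J K 1; first by rewrite mulr1; apply: JK.
exists f; split=> [y|a]; last by rewrite hf mulr1.
by have [a ->] := qmod1 y; exists (qlin J a); rewrite hf mulr1.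
Qed.

(** The device behind every filtration below: with [a * b] in [J] and [a], [b] outside, both outer
    terms are quotients by strictly larger ideals; with a socle element [b], the left term is the
    residue field. *)
Lemma qmod_ses (J : ideal A) (b : A) :
  exists (f : {linear qmod (colon J b) -> qmod J}) (g : {linear qmod J -> qmod (addI J b)}),
    [/\ ses f g, forall a : A, f (qlin (colon J b) a) = qlin J (a * b : A) & forall a : A, g (qlin J a) = qlin (addI J b) a].
Proof.
have [x|f hf] := @qmod_map (colon J b) J b; first by rewrite colonE.
have [g [gs hg]] := qmod_quo (@addI_sub _ J b).
exists f, g; split=> //; split=> //.
  apply: lin_inj => x; have [a ->] := qmod1 x.
  by rewrite hf => /qlin0; rewrite -[_ \in J]/(a * b \in J) -colonE => /qlin0.
move=> y; have [a ->] := qmod1 y; rewrite hg; split.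
  move=> /qlin0/addIP[u [c [uJ ->]]]; exists (qlin (colon J b) c); rewrite hf linearD.
  by have /qlin0 -> := uJ; rewrite add0r.
move=> [x]; have [c ->] := qmod1 x; rewrite hf => ec.
have /qlin0 : qlin J (a - c * b : A) = 0 by rewrite linearB ec subrr.
by move=> h; apply/qlin0/addIP; exists (a - c * b), c; rewrite subrK.
Qed.

Lemma qmod_scale (J : ideal A) (x : A) : (forall a, a * x \in J -> a \in J) ->
  exists g : {linear qmod J -> qmod (addI J x)}, ses (scaleL (qmod J) x) g.
Proof.
move=> xJ; have [f [g [[fi gs ex] hf hg]]] := qmod_ses J x; exists g; split=> //.
  apply: lin_inj => y; have [a ->] := qmod1 y.
  by rewrite qlinM mulrC => /qlin0/xJ/qlin0.
move=> y; rewrite ex; split=> -[z <-]; have [a ->] := qmod1 z.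
  by exists (qlin J a); rewrite hf qlinM mulrC.
by exists (qlin (colon J x) a); rewrite hf qlinM mulrC.
Qed.

Lemma fgen_qmod (J : ideal A) : fgen (qmod J).
Proof.
apply: (fgen_onto (@qlin_surj _ _ J)).
have oneP : linear (fun v : 'rV[A]_1 => v ord0 ord0 : A^o) by move=> a u v; rewrite !mxE.
by exists 1%N, (mklin oneP) => a; exists (\row_j a); exact: mxE.
Qed.

Lemma isfree_qmod0 : isfree (qmod (zeroS A^o)).
Proof.
exists 1%N; have oneP : linear (fun v : 'rV[A]_1 => v ord0 ord0 : A^o) by move=> a u v;
  rewrite !mxE.
apply/iso_sym; exists (qlin _ \o mklin oneP)%FUN; split.
  apply: lin_inj => v /qlin0/zeroSP; rewrite mklinE => v0.
  by apply/rowP => j; rewrite ord1 v0 mxE.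
move=> y; have [a ->] := qmod1 y; exists (\row_j a); congr (qlin _ _); exact: mxE.
Qed.

Lemma qmod_unit (J : ideal A) : (1 : A) \in J -> forall x : qmod J, x = 0.
Proof.
move=> J1 x; have [a ->] := qmod1 x; apply/qlin0.
by rewrite -[a]mulr1 idealM.
Qed.

Lemma van_zero r X : (forall x : X, x = 0) -> van r X.
Proof.
by move=> X0 f _; apply: bd_eq (bd0 r X) => x; rewrite [x]X0 linear0.
Qed.

Definition vancyc r := forall J : ideal A, van r (qmod J).

(** On the domain A/p the element [y] is a nonzerodivisor, so Ext^r(A/p, A) is divisible by [y]. *)
Lemma van_prime r (p : ideal A) y : vancyc r.+1 -> isprime p -> y \in m -> y \notin p ->
  van r (qmod p).
Proof.
move=> vr [p1 pp] ym yp.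
have [a /pp[]//|g s] := @qmod_scale p y; first by move=> h; rewrite h in yp.
apply: van_nakayama (fgen_qmod p) ym _; exact: van_scale s (vr _).
Qed.

(** Noetherian induction reduces to quotients by primes; there only the residue field escapes
    [van_prime]. *)
Lemma vancyc_step r : vancyc r.+1 -> van r (qmod m) -> vancyc r.
Proof.
move=> vr vm; apply: (noeth_ind noeA) => J IH.
case: (boolP ((1 : A) \in J)) => J1; first exact/van_zero/qmod_unit.
have Jm := lm.2 J J1.
have [pJ|npJ] := EM (isprime J).
  have [mJ|nmJ] := EM {subset m <= J}.
    by apply: van_iso vm; apply: qmod_iso => x; apply/idP/idP => [/mJ|/Jm].
  have [y ym yJ] : exists2 y, y \in m & y \notin J.
    apply: contrapT => no; apply: nmJ => y ym; apply: contrapT => /negP yJ.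
    by apply: no; exists y.
  exact: van_prime vr pJ ym yJ.
have [a [b [ab aJ bJ]]] : exists a b : A, [/\ a * b \in J, a \notin J & b \notin J].
  apply: contrapT => no; apply: npJ; split=> // a b ab;
    apply: contrapT => /not_orP[/negP aJ /negP bJ].
  by apply: no; exists a, b.
have [f [g [s _ _]]] := qmod_ses J b.
apply: van_mid s _ _; apply: IH.
- by move=> x xJ; rewrite colonE mulrC idealM.
- by exists a; rewrite ?colonE.
- exact: addI_sub.
- by exists b => //; apply: addI_gen.
Qed.

Lemma reg_van k J r : regideal m k J -> (k < r)%N -> van r (qmod J).
Proof.
move=> rJ; elim: rJ r => [r|{}k {}J x _ IH xm xJ [|r]] //.
  by case: r => // r _; apply/van_free/isfree_qmod0.
rewrite ltnS => kr; have [g s] := qmod_scale xJ.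
by apply: van_right s _ _; apply: IH => //; apply: ltnW.
Qed.

(** Downward induction from above the injective dimension [n]. The socle element embeds the residue
    field in A/J, so its Ext^r vanishes between Ext^r(A/J, A) = 0 and Ext^(r+1) of the cokernel. *)
Lemma bass k J s r : regideal m k J -> s \notin J -> (forall y, y \in m -> y * s \in J) ->
  (k < r)%N -> vancyc r.
Proof.
move=> rJ sJ ms.
suff H j : forall r, (k < r)%N -> (n < r + j)%N -> vancyc r.
  by move=> kr; apply: (H n.+1) => //; rewrite addnS ltnS leq_addl.
elim: j => [|j IH] {}r kr nr; first by move=> K; apply: van_big; rewrite -[r]addn0.
have vr : vancyc r.+1 by apply: IH; [apply: ltnW|rewrite addSnnS].
apply: vancyc_step => //.
have [f [g [sq _ _]]] := qmod_ses J s.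
apply: van_iso (van_left sq (vr _) (reg_van rJ kr)); apply: qmod_iso => x.
rewrite colonE; apply/idP/idP => [xs|/ms//].
apply: contrapT => /negP/(local_unit lm)[b bx].
by move/negP: sJ; apply; rewrite -[s]mul1r -bx -mulrA idealM.
Qed.

(* A generator of [Ext^k(A / J, A)], which is isomorphic to [A / J] when [J] is
   generated by a regular sequence of length [k]. *)
Lemma reg_zeta k J : regideal m k J -> exists z : {linear qmod J -> E k},
  [/\ forall x, d k (z x) = 0,
      forall f : {linear qmod J -> E k}, (forall x, d k (f x) = 0) ->
        exists a : A, bd (fun x => f x - a *: z x) &
      forall y : A, bd (fun x => y *: z x) -> y \in J].
Proof.
elim=> [|{}k {}J x rJ [z [zc zg zi]] xm xJ].
  have [x /qlin0/zeroSP//|h0 hh] := factor_surj (p := qlin (zeroS A^o)) (f := idL A^o) (@qlin_surj _ _ _).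
  have hE (c : A) : h0 (qlin (zeroS A^o) c) = c by apply: hh.
  have eM (c a : A) : e (c * a : A) = c *: e (a : A) by rewrite -[LHS]/(e (c *: (a : A^o))) linM.
  exists (e \o h0)%FUN; split.
  - by move=> x /=; apply/eexact; exists (h0 x).
  - move=> f fc; have /eexact[a ea] := fc (qlin (zeroS A^o) (1 : A)); exists a => x.
    have [c ->] := qmod1 x; rewrite -[X in _ - a *: X]/(e (h0 (qlin (zeroS A^o) c))) hE.
    have -> : f (qlin (zeroS A^o) c) = c *: f (qlin (zeroS A^o) (1 : A)).
      by rewrite -linM -[X in _ = f X]/(scaleL _ c _) qlinM mulr1.
    by rewrite -ea -!eM mulrC subrr.
  move=> y /(_ (qlin (zeroS A^o) (1 : A))).
  rewrite -[X in _ *: X]/(e (h0 (qlin (zeroS A^o) (1 : A)))) hE -eM mulr1 => h.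
  by apply/zeroSP/einj; rewrite linear0.
have [g s] := qmod_scale xJ; have [ii ps ex] := s.
(* The new generator is the image of [z] under the connecting map for multiplication by [x]: extend
   [z] along [x], apply the differential, and descend. *)
have [u hu] := Einj z ii.
have [t /ex[w <-]|z1 hz1] := factor_surj (p := g) (f := (d k \o u)%FUN) ps.
  by rewrite /= hu zc.
have z1c y : d k.+1 (z1 y) = 0 by have [t <-] := ps y; rewrite hz1; apply: dd.
exists z1; split=> // [f fc|y [w hw]].
  have vk := reg_van rJ (ltnSn k); have [t|v hv] := vk (f \o g)%FUN; first exact: fc.
  have [t|a ba] := zg (v \o scaleL _ x)%FUN.
    by rewrite /= -hv /= (ses0 t s) linear0.
  have [b hb] := linB (v \o scaleL _ x)%FUN (scaleL _ a \o z)%FUN.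
  have bb : bd b by apply: bd_eq ba => t; rewrite hb.
  have [b1 [hb1 bb1]] := bd_ext ii bb.
  have [c1 hc1] := linB v (scaleL _ a \o u)%FUN; have [c hc] := linB c1 b1.
  have [t /ex[w <-]|G hG] := factor_surj (p := g) (f := c) ps.
    by rewrite hc hc1 hb1 hb /= hu subrr.
  exists a, G => t; have [w <-] := ps t.
  rewrite hG hc hc1 !linearB (bd_cocycle _ bb1) subr0 -hv /= hz1.
  by rewrite [d k _]linM.
(* The cocycle [c] is [a *: z] up to a coboundary; restricting along [x] shows that [y - a * x]
   kills the class of [z], so it lies in [J]. *)
have [c hc] := linB (scaleL _ y \o u)%FUN (w \o g)%FUN.
have [t|a ba] := zg c.
  by rewrite hc linearB [d k (_ _)]linM -[d k (u t)]/((d k \o u)%FUN t) -hz1 /= -hw subrr.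
suff /zi h : bd (fun t => (y - a * x) *: z t).
  by rewrite -[y](subrK (a * x)) idealD ?(addI_sub _ h) // idealM // addI_gen.
apply: bd_eq (bd_comp (scaleL _ x) ba) => t.
rewrite hc /= hu (ses0 t s) linear0 subr0 scalerBl; congr (_ - _).
by rewrite -[z _]/(z (x *: t)) linM scalerA.
Qed.

(** For a prime p = (J : w) missing some [z] in [m], the class of [ze \o f] in Ext^k(A/p, A)
    vanishes. Composed with A/J -> A/p it becomes [w] times the generator, which forces [w] into
    [J]. *)
Lemma reg_nil k J s : regideal m k J -> s \notin J -> (forall y, y \in m -> y * s \in J) ->
  forall y, y \in m -> exists c, y ^+ c \in J.
Proof.
move=> rJ sJ ms; apply: (nilpotent_mod noeA) => w wJ pw z zm.
apply: contrapT => /negP zw.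
have vr : vancyc k.+1 := bass rJ sJ ms (ltnSn k).
have vp := van_prime vr pw zm zw.
have [f [_ [_ hf _]]] := qmod_ses J w.
have [rho [_ hr]] : exists g : {linear qmod J -> qmod (colon J w)}, onto g /\
   forall a : A, g (qlin J a) = qlin (colon J w) a.
  by apply: qmod_quo => x xJ; rewrite colonE mulrC idealM.
have [ze [zc _ zi]] := reg_zeta rJ.
have bz : bd (ze \o f)%FUN by apply: vp => x; apply: zc.
move/negP: wJ; apply; apply: zi; apply: bd_eq (bd_comp rho bz) => x.
have [a ->] := qmod1 x; rewrite /= hr hf -linM; congr (ze _).
by rewrite -[RHS]/(scaleL (qmod J) (w : A) (qlin J a)) qlinM mulrC.
Qed.

(** Each regular element costs one syzygy: the middle term of the multiplication sequence is already
    stably free. *)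
Lemma reg_sfree k J : regideal m k J -> sfree (iter k (syz m) (qmod J)).
Proof.
elim=> [|{}k {}J x _ IH xm xJ].
  exact: free_sim isfree_qmod0 (free_rV A 0).
have [g s] := qmod_scale xJ.
have t := iter_tri_syz k (fgen_qmod J) (fgen_qmod _) (ses_tri s).
have f1 := fgen_iter noeA m k (fgen_qmod (addI J x)).
exact: sim_trans (sim_sym (tri_free f1 t IH)) IH.
Qed.

(** Induction on the number of generators, splitting off the quotient generated by the first one. *)
Lemma fgen_ind (P : lmodType A -> Prop) :
    (forall X Y, fgen X -> iso X Y -> P X -> P Y) ->
    (forall X Y Z (f : {linear X -> Y}) (g : {linear Y -> Z}), ses f g -> fgen Y -> P X -> P Z -> P Y) ->
    (forall J : ideal A, P (qmod J)) ->
  forall X, fgen X -> P X.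
Proof.
move=> Piso Pext Pcyc X [k [f fs]].
have cyc Y (g : {linear A^o -> Y}) : onto g -> P Y.
  move=> gs; apply: Piso (fgen_qmod _) _ (Pcyc (ker g)).
  have [x /qlin0/kerP//|h hh] := factor_surj (f := g) (@qlin_surj _ _ (ker g)).
  exists h; split; last by move=> y; have [a <-] := gs y; exists (qlin _ a).
  by apply: lin_inj => x; have [a ->] := qmod1 x; rewrite hh => ga; apply/qlin0/kerP.
elim: k X f fs => [|k IH] X f fs.
  apply: (cyc _ (zeroL _ _)) => x; exists 0; have [v <-] := fs x.
  suff -> : v = 0 by rewrite !linear0.
  by apply/matrixP => i [].
have rP : linear (fun v : 'rV[A]_k => row_mx (0 : 'M_(1, 1)) v : 'rV[A]_(1 + k)).
  by move=> a x y; rewrite scale_row_mx add_row_mx scaler0 addr0.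
pose S := im (f \o mklin rP)%FUN (full _).
have fX : fgen X by exists k.+1, f.
apply: (Pext _ _ _ _ _ (ses_quo S) fX).
  have [x|h hh] := @factor_inj _ _ _ _ (sval_lin S) (f \o mklin rP)%FUN (@sval_inj _ _ S).
    have xS : (f \o mklin rP)%FUN x \in S by apply/imP; exists x.
    by exists (mksmod xS).
  apply: (IH _ h) => y; have /imP[x _ ex] := valP y; exists x.
  by apply: val_inj; rewrite -ex; exact: hh.
have dP : linear (fun a : A^o => f (a *: delta_mx ord0 ord0)).
  by move=> c x y; rewrite -linearP scalerDl scalerA.
apply: (cyc _ (qlin S \o mklin dP)%FUN) => y; have [x <-] := qlin_surj y.
have [v <-] := fs x; exists (v ord0 ord0); apply/eqP; rewrite -subr_eq0.
rewrite -[X in X - _]/(qlin S (f (v ord0 ord0 *: delta_mx ord0 ord0))) -linearB -linearB.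
apply/eqP/qlin0/imP; exists (- rsubmx (v : 'rV_(1 + k))) => //.
rewrite -[LHS]/(f (row_mx (0 : 'M_(1,1)) (- rsubmx (v : 'rV_(1 + k))))); congr (f _).
apply/rowP => j; case: (@splitP 1 k j) => i ji.
  have -> : j = lshift k i by apply: val_inj.
  rewrite [LHS](@row_mxEl _ 1 1 k) !mxE ord1; have -> : lshift k i = ord0 by apply: val_inj;
    rewrite /= ord1.
  by rewrite eqxx mulr1 subrr.
have -> : j = rshift 1 i by apply: val_inj.
rewrite [LHS](@row_mxEr _ 1 1 k) !mxE; have -> : (rshift 1 i == ord0 :> 'I_k.+1) = false by [].
by rewrite andbF mulr0 sub0r.
Qed.

Lemma van_fgen r X : vancyc r -> fgen X -> van r X.
Proof.
move=> vr; apply: fgen_ind => // [X' Y' _ h|X' Y' Z' f g s _]; first exact: van_iso.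
exact: van_mid s.
Qed.

Lemma gorenstein_structure dd : has_dim A^o dd -> exists J : ideal A,
  [/\ forall X, fgen X -> totref (iter dd (syz m) X),
      sfree (iter dd (syz m) (qmod J)),
      {subset J <= m} /\ (forall y, y \in m -> exists c, y ^+ c \in J) &
      exists2 s, s \notin J & forall y, y \in m -> y * s \in J].
Proof.
move=> hd.
have [k [[J rJ] mk]] : exists k, is_max (fun k => exists J, regideal m k J) k.
  apply: (@is_max_exists _ 0%N dd); first by exists (zeroS A^o); apply: reg0.
  by move=> l [J]; apply: (reg_dim noeA lm hd).
have kd := reg_dim noeA lm hd rJ.
have [[x xm xJ]|[s sJ ms]] := socle_or_regular noeA m J.
  (* A nonzerodivisor modulo [J] in [m] would lengthen the maximal regular sequence, so A/J has a
     nonzero socle. *)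
  by have := mk k.+1 (ex_intro _ _ (regS rJ xm xJ)); rewrite ltnn.
exists J; split; [|..|by exists s].
- move=> X fX; apply: totref_iter_syz => // r dr; apply: van_fgen => //.
  by apply: bass rJ sJ ms _; apply: leq_ltn_trans dr.
- rewrite -(subnK kd) iterD; elim: (dd - k)%N => [|i IH] /=; first exact: reg_sfree.
  exact: sfree_syz.
by split; [apply: reg_sub rJ|apply: reg_nil rJ sJ ms].
Qed.

(** * Filtrations by copies of the residue field *)

Definition nil_mod X := forall y, y \in m -> exists c, forall x : X, y ^+ c *: x = 0.

(** The only prime quotient on which all elements of [m] act nilpotently is the residue field, so
    Noetherian induction over ideals ends there or at zero. *)
Lemma nil_ind (P : lmodType A -> Prop) :
    (forall X Y, fgen X -> iso X Y -> P X -> P Y) ->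
    (forall X Y Z (f : {linear X -> Y}) (g : {linear Y -> Z}),
       ses f g -> fgen Y -> P X -> P Z -> P Y) ->
    (forall X, fgen X -> (forall x : X, x = 0) -> P X) -> P (qmod m) ->
  forall X, fgen X -> nil_mod X -> P X.
Proof.
move=> Piso Pext P0 Pm; apply: (fgen_ind (P := fun X => nil_mod X -> P X)).
- move=> X Y fX h PX nY; have [f [fi fs]] := h; apply: Piso fX h (PX _) => y ym.
  have [c hc] := nY y ym; exists c => x.
  by apply: fi; rewrite linM hc linear0.
- move=> X Y Z f g s fY PX PZ nY; have [fi gs ex] := s.
  apply: Pext s fY (PX _) (PZ _) => y ym; have [c hc] := nY y ym; exists c => x.
    by apply: fi; rewrite linM hc linear0.
  by have [z <-] := gs x; rewrite -linM hc linear0.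
move=> J nJ.
have {nJ} : forall y, y \in m -> exists c, y ^+ c \in J.
  move=> y ym; have [c hc] := nJ y ym; exists c.
  have := hc (qlin J (1 : A)); rewrite -[LHS]/(scaleL (qmod J) (y ^+ c) (qlin J (1 : A))).
  by rewrite qlinM mulr1 => /qlin0.
elim/(noeth_ind noeA): J => J IH nJ.
case: (boolP ((1 : A) \in J)) => J1.
  by apply: P0; [apply: fgen_qmod|apply: qmod_unit].
have Jm := lm.2 J J1.
have [[_ pJ]|npJ] := EM (isprime J).
  apply: Piso (fgen_qmod m) _ Pm; apply: qmod_iso => x; apply/idP/idP => [xm|/Jm//].
  have [c] := nJ x xm; elim: c => [|c IHc]; first by move=> h; rewrite h in J1.
  by rewrite exprS => /pJ[].
have [a [b [ab aJ bJ]]] : exists a b : A, [/\ a * b \in J, a \notin J & b \notin J].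
  apply: contrapT => no; apply: npJ; split=> // a b ab;
    apply: contrapT => /not_orP[/negP aJ /negP bJ].
  by apply: no; exists a, b.
have [f [g [s _ _]]] := qmod_ses J b.
apply: Pext s (fgen_qmod J) _ _; apply: IH.
- by move=> x xJ; rewrite colonE mulrC idealM.
- by exists a; rewrite ?colonE.
- by move=> y /nJ[c hc]; exists c; rewrite colonE mulrC idealM.
- exact: addI_sub.
- by exists b => //; apply: addI_gen.
- by move=> y /nJ[c hc]; exists c; apply: addI_sub.
Qed.

Lemma sfree_dual X : sfree X -> sfree (dual_mod X).
Proof.
move=> sX; apply: sim_trans (sim_dual sX) _.
exact: free_sim (free_dual (free_rV A 0)) (free_rV A 0).
Qed.

Lemma iter_sfree i X : sfree X -> sfree (iter i (syz m) X).
Proof. by move=> sX; elim: i => //= i; apply: sfree_syz. Qed.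

Lemma sfree_Omega q X : sfree X -> sfree (Omega m q X).
Proof.
move=> sX; case: q => i; rewrite /Omega; first exact: iter_sfree.
by elim: i.+1 => //= j IH; apply/sfree_dual/sfree_syz/sfree_dual.
Qed.

(* [lam W L a] abstracts the bounds by [a] on the lengths of [Ext^1(W, L)] and of
   [Tor_1(W, L)], to which the same comparison argument applies. *)
Section Comparison.
Variable lam : lmodType A -> lmodType A -> nat -> Prop.
Hypothesis lam_sim : forall W W' L a, totref W -> sim W W' -> lam W L a -> lam W' L a.
Hypothesis lam_tri : forall X Y Z L a b, totref X -> totref Y -> totref Z -> tri X Y Z ->
  lam X L a -> lam Z L b -> lam Y L (a + b).
Hypothesis lam_mono : forall W L a b, (a <= b)%N -> lam W L a -> lam W L b.
Hypothesis lam_free : forall W L, sfree W -> lam W L 0.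

Variable dd : nat.
Hypothesis hd : has_dim A^o dd.

Local Notation Om X := (iter dd (syz m) X).
Local Notation k := (qmod m).

(** The constant counts the residue fields in a filtration of [X]: it adds up along extensions, is 0
    on zero and 1 on [k], and does not involve [L]. *)
Lemma lam_nil (q : int) X : fgen X -> nil_mod X -> exists C, forall L l,
  lam (Omega m q (Om k)) L l -> lam (Omega m q (Om X)) L (C * l).
Proof.
have [J [gT _ _ _]] := gorenstein_structure hd.
move: X; apply: nil_ind.
- move=> X Y fX h [C hC]; exists C => L l /hC; apply: lam_sim; first exact/totref_Omega/gT.
  by apply: Omega_sim (gT _ fX) _; apply: iter_syz_sim fX (iso_sim h).
- move=> X Y Z f g s fY [C hC] [C' hC']; exists (C + C')%N => L l hl.
  have [fi gs _] := s; have fX := fgen_sub noeA fi fY; have fZ := fgen_onto gs fY.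
  have t := tri_Omega q (gT _ fX) (gT _ fY) (gT _ fZ) (iter_tri_syz dd fX fZ (ses_tri s)).
  by rewrite mulnDl; apply: lam_tri t (hC _ _ hl) (hC' _ _ hl); apply/totref_Omega/gT.
- move=> X fX X0; exists 0%N => L l _; rewrite mul0n.
  have sX : sfree X.
    apply: iso_sim; exists (zeroL _ _); split; first by move=> x y _; rewrite [x]X0 [y]X0.
    by move=> y; exists 0; apply/matrixP => i [].
  by apply/lam_free/sfree_Omega/iter_sfree => //; apply: gT.
by exists 1%N => L l; rewrite mul1n.
Qed.

Lemma lam_shift (q : int) : exists C, forall L l,
  (lam (Omega m q (Om k)) L l -> lam (Omega m (q + 1) (Om k)) L (C * l)) /\
  (lam (Omega m (q + 1) (Om k)) L l -> lam (Omega m q (Om k)) L (C * l)).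
Proof.
have [J [gT sR [Jm nJ] [s sJ ms]]] := gorenstein_structure hd.
have fk := fgen_qmod m; have fR := fgen_qmod J.
have nR : nil_mod (qmod J).
  move=> y /nJ[c hc]; exists c => x; have [a ->] := qmod1 x.
  rewrite -[LHS]/(scaleL (qmod J) (y ^+ c) (qlin J a)) qlinM; apply/qlin0.
  by rewrite mulrC idealM.
have [C1 h1] : exists C, forall L l,
    lam (Omega m q (Om k)) L l -> lam (Omega m (q + 1) (Om k)) L (C * l).
  have [g [gs _]] := qmod_quo Jm; have sg := ses_ker gs.
  pose K : lmodType A := smod (ker g); have fK : fgen K := fgen_nmod noeA fR (ker g).
  have nK : nil_mod K.
    move=> y /nR[c hc]; exists c => x; apply: val_inj.
    by rewrite -[LHS]/(sval_lin (ker g) (y ^+ c *: x)) linM hc.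
  have [C hC] := lam_nil q fK nK; exists C => L l /hC.
  apply: lam_sim; first exact/totref_Omega/gT.
  apply: sim_trans (Omega_syz q (gT _ fk)).
  apply: Omega_sim; first exact: gT.
  exact: tri_free (fgen_iter noeA m dd fk) (iter_tri_syz dd fK fk (ses_tri sg)) sR.
have [C2 h2] : exists C, forall L l,
    lam (Omega m (q + 1) (Om k)) L l -> lam (Omega m q (Om k)) L (C * l).
  have [f [g [sg _ _]]] := qmod_ses J s; pose Q := qmod (addI J s).
  have fQ : fgen Q := fgen_qmod (addI J s).
  have nQ : nil_mod Q.
    have [_ gs _] := sg; move=> y /nR[c hc]; exists c => x.
    by have [z <-] := gs x; rewrite -linM hc linear0.
  have [C hC] := lam_nil (q + 1) fQ nQ; exists C => L l /hC.
  apply: lam_sim; first exact/totref_Omega/gT.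
  apply: sim_trans (sim_sym (Omega_syz q (gT _ fQ))) _.
  apply: Omega_sim; first exact/totref_syz/gT.
  (* As [s] lies outside [J] and is killed by [m] modulo [J], its annihilator [colon J s] is exactly
     [m]. *)
  have ik : sim (Om k) (Om (qmod (colon J s))).
    apply: iter_syz_sim fk _; apply/iso_sim/qmod_iso => x.
    rewrite colonE; apply/idP/idP => [/ms//|xs].
    apply: contrapT => /negP/(local_unit lm)[b bx].
    by move/negP: sJ; apply; rewrite -[s]mul1r -bx -mulrA idealM.
  apply: sim_sym; apply: sim_trans ik _.
  exact: tri_free (fgen_iter noeA m dd fQ) (iter_tri_syz dd (fgen_qmod _) fQ (ses_tri sg)) sR.
by exists (C1 + C2)%N => L l; split=> [/h1|/h2]; apply: lam_mono;
  rewrite leq_mul2r ?leq_addr ?leq_addl orbT.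
Qed.

Lemma lam_compare (q : int) : exists C, forall L l,
  (lam (Om k) L l -> lam (Omega m q (Om k)) L (C * l)) /\
  (lam (Omega m q (Om k)) L l -> lam (Om k) L (C * l)).
Proof.
have trans q1 q2 : (exists C, forall L l,
    (lam (Om k) L l -> lam (Omega m q1 (Om k)) L (C * l)) /\
    (lam (Omega m q1 (Om k)) L l -> lam (Om k) L (C * l))) ->
  (exists C, forall L l,
    (lam (Omega m q1 (Om k)) L l -> lam (Omega m q2 (Om k)) L (C * l)) /\
    (lam (Omega m q2 (Om k)) L l -> lam (Omega m q1 (Om k)) L (C * l))) ->
  exists C, forall L l,
    (lam (Om k) L l -> lam (Omega m q2 (Om k)) L (C * l)) /\
    (lam (Omega m q2 (Om k)) L l -> lam (Om k) L (C * l)).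
  move=> [C1 h1] [C2 h2]; exists (C1 * C2)%N => L l; split=> h.
    by rewrite [(C1 * C2)%N]mulnC -mulnA; apply: (h2 L _).1; apply: (h1 L l).1.
  by rewrite -mulnA; apply: (h1 L _).2; apply: (h2 L l).2.
have h0 : exists C, forall L l,
    (lam (Om k) L l -> lam (Omega m 0 (Om k)) L (C * l)) /\
    (lam (Omega m 0 (Om k)) L l -> lam (Om k) L (C * l)).
  by exists 1%N => L l; rewrite mul1n.
case: q => i.
  elim: i => [//|i IH]; apply: trans IH _.
  by have := lam_shift (Posz i); rewrite -PoszD addn1.
have back q' : exists C, forall L l,
    (lam (Omega m (q' + 1) (Om k)) L l -> lam (Omega m q' (Om k)) L (C * l)) /\
    (lam (Omega m q' (Om k)) L l -> lam (Omega m (q' + 1) (Om k)) L (C * l)).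
  by have [C hC] := lam_shift q'; exists C => L l; have [] := hC L l.
elim: i => [|i IH]; first exact: trans h0 (back (Negz 0)).
apply: trans IH _; have := back (Negz i.+1).
by have -> : Negz i.+1 + 1 = Negz i by rewrite !NegzE -addn1 PoszD opprD subrK.
Qed.

End Comparison.

(** * The comparison for Ext and for Tor *)

Lemma extle_tri X Y Z L a b : fgen X -> fgen Z -> tri X Y Z ->
  extle X L a -> extle Z L b -> extle Y L (a + b).
Proof.
move=> fX fZ t ha hb; have fY := tri_fgen fX fZ t.
have [X' [Y' [Z' [f [g [sX sY sZ s]]]]]] := t.
apply: (extle_sim (sim_fgen sY fY) (sim_sym sY)).
exact: extle_ses s (extle_sim fX sX ha) (extle_sim fZ sZ hb).
Qed.

Lemma extle_mono W L a b : (a <= b)%N -> extle W L a -> extle W L b.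
Proof.
move=> ab [K [F [f [g [fF s h]]]]]; exists K, F, f, g; split=> // l /h la.
exact: leq_trans la ab.
Qed.

Lemma extle_sfree W L : sfree W -> extle W L 0.
Proof.
move=> sW; have f0 := fgen_rV A 0; apply: (extle_sim f0 (sim_sym sW)).
have s0 : ses (zeroL 'rV[A]_0 'rV[A]_0) (idL _).
  split; first by move=> x y _; apply/matrixP => i [].
    by move=> x; exists x.
  move=> y; have -> : y = 0 by apply/matrixP => i [].
  by split=> // _; exists 0.
apply/(extleP _ _ (free_rV A 0) s0) => -[|l] // [c [cs cb]].
have [_ [x xc /negP[]]] := cs 0%N (ltn0Sn _); apply: (cb 0%N (leq0n _)).1.
have /psubP lx := (cb 1%N (ltn0Sn _)).2 _ xc; apply/psubP; exists (mklin lx) => y.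
by have -> : y = 0 by apply/matrixP => i [].
Qed.

Lemma Ext_compare dd (q : int) : has_dim A^o dd -> exists C, forall L l,
  let M := iter dd (syz m) (qmod m) in
  (extle M L l -> extle (Omega m q M) L (C * l)) /\
  (extle (Omega m q M) L l -> extle M L (C * l)).
Proof.
move=> hd; apply: (lam_compare _ _ _ _ hd).
- by move=> W W' L a [fW _]; apply: extle_sim.
- by move=> X Y Z L a b [fX _] _ [fZ _]; apply: extle_tri.
- by move=> W L a b; apply: extle_mono.
- by move=> W L; apply: extle_sfree.
Qed.

Lemma Tor_compare dd (q : int) : has_dim A^o dd -> exists C, forall L l,
  let M := iter dd (syz m) (qmod m) in
  let T W := dual_mod (iter 3 (syz m) W) in
  (extle (T M) L l -> extle (T (Omega m q M)) L (C * l)) /\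
  (extle (T (Omega m q M)) L l -> extle (T M) L (C * l)).
Proof.
pose T W := dual_mod (iter 3 (syz m) W).
have gT W : totref W -> totref (T W) by move=> gW; do 4 ?[apply: totref_dual|apply: totref_syz].
move=> hd; apply: (@lam_compare (fun W => extle (T W)) _ _ _ _ _ hd).
- move=> W W' L a gW s; apply: extle_sim; first exact: (gT _ gW).1.
  exact/sim_dual/iter_syz_sim/s/gW.1.
(* [T] is contravariant, so the outer terms and their bounds change places. *)
- move=> X Y Z L a b gX gY gZ t ha hb; rewrite addnC.
  apply: extle_tri hb ha; [exact: (gT _ gZ).1|exact: (gT _ gX).1|].
  apply: tri_dual; first by do 3 apply: totref_syz.
  exact: iter_tri_syz gX.1 gZ.1 t.
- by move=> W L a b; apply: extle_mono.
- by move=> W L sW; apply/extle_sfree/sfree_dual/iter_sfree.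
Qed.

End Vanishing.

(** * Degrees *)

Section Degrees.

(** The factor [j%:R] expresses growth of order at most n-1 without subtracting from [n]. *)
Lemma poly_upper (q : {poly rat}) n : (size q <= n)%N ->
  exists K : rat, forall j : nat, (0 < j)%N -> `|q.[j%:R]| * j%:R <= K * j%:R ^+ n.
Proof.
move=> sq; exists (\sum_(i < size q) `|q`_i|) => j j0.
rewrite horner_coef mulr_suml; apply: le_trans (ler_wpM2r (ler0n _ _) (ler_norm_sum _ _ _)) _.
rewrite mulr_suml; apply: ler_sum => i _.
rewrite normrM -mulrA; apply: ler_wpM2l; first exact: normr_ge0.
rewrite ger0_norm ?exprn_ge0 ?ler0n // -exprSr; apply: ler_weXn2l; first by rewrite ler1n.
exact: leq_trans (ltn_ord i) sq.
Qed.

(** If [p] had larger size, its leading term would make |a| j bounded in j, contradicting the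
    Archimedean property. *)
Lemma size_dominated (p q : {poly rat}) (C : rat) j0 :
    (forall j : nat, (j0 <= j)%N -> `|p.[j%:R]| <= C * `|q.[j%:R]|) ->
  (size p <= size q)%N.
Proof.
move=> h; rewrite leqNgt; apply/negP => sqp.
pose n := (size p).-1; have sp : size p = n.+1 by rewrite prednK // (leq_ltn_trans _ sqp).
pose a := p`_n; have a0 : a != 0 by rewrite -[a]/(lead_coef p) lead_coef_eq0 -size_poly_gt0 sp.
pose r := p - a *: 'X^n.
have sr : (size r <= n)%N.
  apply/leq_sizeP => i; rewrite coefB coefZ coefXn leq_eqVlt => /orP[/eqP<-|ni].
    by rewrite eqxx mulr1 subrr.
  by rewrite gtn_eqF // mulr0 subr0 nth_default // sp.
have [K1 h1] := poly_upper sr; have [|K2 h2] := @poly_upper q n; first by rewrite -ltnS -sp.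
have C0 : 0 <= `|C| by apply: normr_ge0.
have key (j : nat) : (0 < j)%N -> (j0 <= j)%N -> `|a| * j%:R <= K1 + `|C| * K2.
  move=> jp jj; have jn : 0 < (j%:R : rat) ^+ n by rewrite exprn_gt0 // ltr0n.
  rewrite -(ler_pM2r jn) mulrAC mulrDl -[`|C| * K2 * _]mulrA.
  have e : `|a| * (j%:R : rat) ^+ n <= `|r.[j%:R]| + `|p.[j%:R]|.
    have -> : `|a| * j%:R ^+ n = `|p.[j%:R] - r.[j%:R]|.
      by rewrite hornerD hornerN hornerZ hornerXn subKr normrM [`|_ ^+ n|]ger0_norm // ltW.
    by rewrite [leRHS]addrC ler_normB.
  apply: le_trans (ler_wpM2r (ler0n _ j) e) _; rewrite mulrDl lerD ?h1 //.
  apply: le_trans (_ : `|C| * (`|q.[j%:R]| * j%:R) <= _); last by rewrite ler_wpM2l ?h2.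
  rewrite mulrA ler_wpM2r ?ler0n //; apply: le_trans (h j jj) _.
  by rewrite ler_wpM2r ?normr_ge0 ?ler_norm.
pose x := (K1 + `|C| * K2) / `|a|.
have [j jx] : exists j : nat, x < j%:R.
  by exists (Num.bound `|x|); apply: le_lt_trans (ler_norm x) (archi_boundP (normr_ge0 x)).
have := key (maxn j0 j).+1 isT (leqW (leq_maxl _ _)).
rewrite -ler_pdivlMl ?normr_gt0 // mulrC leNgt => /negP; apply.
by apply: lt_le_trans jx _; rewrite ler_nat leqW // leq_maxr.
Qed.

Variable A : comNzRingType.

(** The bounds need a common constant for all [j]. Sizes are compared rather than degrees, which
    also covers the zero polynomial. *)
Lemma length_degree_eq (X Y : nat -> lmodType A) (x y : nat -> nat) C :
    (forall j, has_length (X j) (x j)) -> (forall j, has_length (Y j) (y j)) ->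
    evp (fun j => (x j)%:R) -> evp (fun j => (y j)%:R) ->
    (forall j, (x j <= C * y j)%N) -> (forall j, (y j <= C * x j)%N) ->
  length_degree X = length_degree Y.
Proof.
have ex (Z : nat -> lmodType A) z : (forall j, has_length (Z j) (z j)) ->
    evp (fun j => (z j)%:R) -> exists p, length_degree Z = deg p /\
    exists j0, forall j, (j0 <= j)%N -> p.[j%:R] = (z j)%:R.
  move=> hz [p0 [j0 hp0]]; rewrite /length_degree; case: pselect => [h|[]]; last first.
    by exists p0, j0 => j jj; exists (z j); rewrite // hp0.
  exists (projT1 (cid h)); split=> //; have [j1 hj1] := projT2 (cid h);
    exists j1 => j /hj1[l hl ->].
  by rewrite (is_max_uniq hl (hz j)).
move=> hX hY eX eY xy yx.
have [p [-> [a ha]]] := ex X x hX eX; have [q [-> [b hb]]] := ex Y y hY eY.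
rewrite /deg; suff -> : size p = size q by [].
apply/eqP; rewrite eqn_leq; apply/andP; split.
  apply: (@size_dominated _ _ C%:R (maxn a b)) => j; rewrite geq_max => /andP[/ha-> /hb->].
  by rewrite !normr_nat -natrM ler_nat.
apply: (@size_dominated _ _ C%:R (maxn a b)) => j; rewrite geq_max => /andP[/ha-> /hb->].
by rewrite !normr_nat -natrM ler_nat.
Qed.

Lemma differential_comp (m : ideal A) M :
  differential m M 1 *m differential m M 0 = 0.
Proof.
apply/row_matrixP => i; rewrite row0 rowE mulmxA !differentialE.
by have /kerP -> := valP (Defs.cover m (iter 2 (syz m) M) (delta_mx ord0 i)); rewrite linear0.
Qed.

End Degrees.

Theorem mainTheorem2 (A : comNzRingType) (m : ideal A) (d : nat)
  (hA : gorenstein_local m) (hreg : ~ regular_local m)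
  (hd : has_dim A^o d) (d_ge1 : (1 <= d)%N)
  (N : lmodType A) (t : nat) (I : ideal A)
  (hNfg : fin_gen N) (hN : perfect_module m N)
  (ht : has_dim N t) (t_ge1 : (1 <= t)%N)
  (hI : ideal_of_definition m N I) (n : int) :
  let k : lmodType A := qmod m in
  r1 m I N (Omega m d%:Z k) = r1 m I N (Omega m n (Omega m d%:Z k)) /\
  s1 m I N (Omega m n (Omega m d%:Z k)) = s1 m I N (Omega m d%:Z k).
Proof.
have [noeA lm [nE [E [e [dE [Einj E0 einj eexact dexact]]]]]] := hA.
have fN : fgen N by apply/fin_genP.
have [ns [gI hgI]] := noeA I.
pose s : seq A := [seq val (gI i) | i <- enum 'I_ns].
have sI : {subset s <= I} by move=> _ /mapP[i _ ->]; apply: (valP (gI i)).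
have Is (V : lmodType A) (x : V) (S : submodClosed V) :
    (forall b : A, b \in s -> b *: x \in S) -> forall a : A, a \in I -> a *: x \in S.
  move=> h a aI; have [c ec] := hgI (mksmod aI).
  have -> : a = \sum_i c i * val (gI i).
    by rewrite -[LHS]/(sval_lin I (mksmod aI)) ec linear_sum; apply: eq_bigr => i _; rewrite linM.
  rewrite scaler_suml; apply: rpred_sum => i _; rewrite -scalerA rpredZ // h //.
  by apply/mapP; exists i; rewrite ?mem_enum.
have accN q : accV {ffun 'I_q -> N} by apply: (fgen_accV noeA (fgen_ffun q fN)).
have finN : exists l, ilen (iter 1 (@ideal_mul A I N) (full N)) (full N) l.
  have [_ [l /has_length_ilen hl]] := hI; exists l; apply: (ilen_ext _ l).2 hl.
  apply: (@ilchain_lin _ _ _ (qlin _)) => //.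
    by move=> y _; have [x <-] := qlin_surj y; exists x; rewrite // subrr rpred0.
  by move=> x _; apply/zeroSP/idP => /qlin0.
pose k : lmodType A := qmod m; pose M := iter d (syz m) k.
have gM : totref dE M.
  have [J [gT _ _ _]] := gorenstein_structure noeA lm Einj E0 einj eexact dexact hd.
  exact/gT/fgen_qmod.
have gMn := totref_Omega noeA lm Einj E0 einj eexact dexact n gM.
have TorL W : exists l : nat -> nat, (forall j, has_length (Tor1 m W (quo_pow I j N)) (l j)) /\
    evp (fun j => (l j)%:R).
  exact: (homology_evp sI Is accN (differential_comp m W) finN).
have ExtL W : exists l : nat -> nat, (forall j, has_length (Ext1 m W (quo_pow I j N)) (l j)) /\
    evp (fun j => (l j)%:R).
  apply: (homology_evp sI Is accN _ finN).
  by rewrite -trmx_mul differential_comp // trmx0.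
have vx W : totref dE W -> vext m W := fun gW => totref_vext lm Einj einj eexact dexact gW.
have gS W : totref dE W -> totref dE (syz m W) := fun gW => totref_syz noeA lm Einj dexact gW.
(* A length is the least of its upper bounds, so the comparison of bounds becomes a comparison of
   lengths; the same holds for [ExtP]. *)
have TorP W L l : totref dE W -> has_length (Tor1 m W L) l ->
    extle (dual_mod (iter 3 (syz m) W)) L l /\
    forall b, extle (dual_mod (iter 3 (syz m) W)) L b -> (l <= b)%N.
  move=> gW [cl ml].
  have H b := Tor1_extle noeA lm L b gW.1 (vx _ gW) (vx _ (gS _ gW)) (vx _ (gS _ (gS _ gW))).
  by split=> [|b /H]; [apply/H|apply].
have ExtP W L l : totref dE W -> has_length (Ext1 m W L) l ->
    extle W L l /\ forall b, extle W L b -> (l <= b)%N.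
  move=> gW [cl ml]; have H b := Ext1_extle noeA lm L b gW.1.
  by split=> [|b /H]; [apply/H|apply].
split.
  have [x [hx ex]] := TorL M; have [y [hy ey]] := TorL (Omega m n M).
  have [C hC] := Tor_compare noeA lm Einj E0 einj eexact dexact n hd.
  apply: (length_degree_eq hx hy ex ey (C := C)) => j.
    exact: (TorP _ _ _ gM (hx j)).2 _ ((hC _ _).2 (TorP _ _ _ gMn (hy j)).1).
  exact: (TorP _ _ _ gMn (hy j)).2 _ ((hC _ _).1 (TorP _ _ _ gM (hx j)).1).
have [x [hx ex]] := ExtL M; have [y [hy ey]] := ExtL (Omega m n M).
have [C hC] := Ext_compare noeA lm Einj E0 einj eexact dexact n hd.
apply: (length_degree_eq hy hx ey ex (C := C)) => j.
  exact: (ExtP _ _ _ gMn (hy j)).2 _ ((hC _ _).1 (ExtP _ _ _ gM (hx j)).1).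
exact: (ExtP _ _ _ gM (hx j)).2 _ ((hC _ _).2 (ExtP _ _ _ gMn (hy j)).1).
Qed.
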